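(* Let $\varphi$ be an admissible order function and $a_0:\mathbb{R}^d\setminus\{0\}\to[\Lambda_1,\Lambda_2]$ measurable ($0<\Lambda_1\le\Lambda_2$), and let $(P_t)_{t\ge0}$ be the semigroup associated with the Lévy measure $\nu(dh)=\frac{a_0(h)}{|h|^d\varphi(|h|)}dh$ (see context). If $f\in C^0(\mathbb{R}^d)$, then $P_tf\in C^\infty(\mathbb{R}^d)$ for every $t>0$, and for each multi-index $\gamma$ with $|\gamma|=k$ there exists $C>0$ (depending on $k$) such that $$|D^\gamma P_tf(x)|\le C\,\varphi^{-1}(t)^{-k}\|f\|_{C^0}\qquad(t>0,\ x\in\mathbb{R}^d).$$
   Context: An admissible order function is a smooth $\varphi:(0,\infty)\to(0,\infty)$ with $\varphi(1)=1$ such that $\phi(r):=\varphi(r^{-1/2})^{-1}$ is a Bernstein function (i.e. $\phi\ge0$ is $C^\infty$ on $(0,\infty)$ with $(-1)^n\phi^{(n)}\le0$ for all $n\in\mathbb{N}$) and there are constants $0<\delta_1\le\delta_2<1$, $a_1\in(0,1]$, $a_2\in[1,\infty)$ with $a_1\lambda^{2\delta_1}\varphi(r)\le\varphi(\lambda r)\le a_2\lambda^{2\delta_2}\varphi(r)$ for all $\lambda\ge1$, $r>0$. In particular $\varphi$ is increasing and $\varphi^{-1}$ denotes its inverse function. $C^0(\mathbb{R}^d)$ is the space of bounded continuous functions with the sup norm $\|\cdot\|_{C^0}$. $(P_t)$ is the semigroup $P_tf(x)=\mathbb{E}[f(x+Y_t)]$, where $Y$ is the Lévy process on $\mathbb{R}^d$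 with $\mathbb{E}[e^{i\xi\cdot Y_t}]=\exp\big(-t\int_{\mathbb{R}^d}(1-e^{i\xi\cdot h}+i\xi\cdot h\,\mathbb{1}_{\{|h|\le1\}})\,\nu(dh)\big)$; equivalently, $(P_t)$ is the strongly continuous contraction semigroup on $C_\infty(\mathbb{R}^d)$ whose generator coincides on $C^2_\infty(\mathbb{R}^d)$ with $\mathcal{L}_0u(x)=\int_{\mathbb{R}^d}(u(x+h)-u(x)-\nabla u(x)\cdot h\mathbb{1}_{\{|h|\le1\}})\frac{a_0(h)}{|h|^d\varphi(|h|)}dh$. *)

(* Defs.v *)
From HB Require Import structures.
From mathcomp Require Import all_boot all_order all_algebra.
From mathcomp Require Import all_classical all_reals all_analysis.
Set Implicit Arguments. Unset Strict Implicit. Unset Printing Implicit Defensive.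
Import Order.TTheory GRing.Theory Num.Theory.
Import numFieldNormedType.Exports.
Local Open Scope classical_set_scope.
Local Open Scope ring_scope.

(* R^d is modelled as row vectors 'rV[R]_d (with the library's normed structure,
   used only for derivatives); the Euclidean norm and inner product are defined here. *)
Definition euclid_dot {R : realType} {d : nat} (x y : 'rV[R]_d) : R :=
  \sum_(i < d) x ord0 i * y ord0 i.
Definition euclid_norm {R : realType} {d : nat} (x : 'rV[R]_d) : R :=
  Num.sqrt (euclid_dot x x).

Definition Rd (R : realType) (d : nat) := g_sigma_algebraType (@open 'rV[R]_d).

Definition is_lebesgue_Rd {R : realType} {d : nat}
  (leb : {measure set (Rd R d) -> \bar R}) : Prop :=
  forall a b : 'rV[R]_d, (forall i, a ord0 i <= b ord0 i) ->
    leb [set x : Rd R d | forall i, a ord0 i < x ord0 i <= b ord0 i]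
    = (\prod_(i < d) (b ord0 i - a ord0 i))%:E.

Definition bernstein_transform {R : realType} (phi : R -> R) : R -> R :=
  fun r => (phi (r `^ (- 2^-1)))^-1.

Definition admissible {R : realType} (phi : R -> R) : Prop :=
  (forall r, 0 < r -> 0 < phi r) /\
  phi 1 = 1 /\
  (forall (n : nat) r, 0 < r -> derivable (derive1n n phi) r 1) /\
  (forall r, 0 < r -> 0 <= bernstein_transform phi r) /\
  (forall (n : nat) r, 0 < r -> derivable (derive1n n (bernstein_transform phi)) r 1) /\
  (forall (n : nat) r, (0 < n)%N -> 0 < r ->
     (-1) ^+ n * derive1n n (bernstein_transform phi) r <= 0) /\
  (exists d1 d2 a1 a2 : R,
     (0 < d1 /\ d1 <= d2 /\ d2 < 1 /\ 0 < a1 /\ a1 <= 1 /\ 1 <= a2) /\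
     forall lam r, 1 <= lam -> 0 < r ->
       a1 * lam `^ (2 * d1) * phi r <= phi (lam * r) /\
       phi (lam * r) <= a2 * lam `^ (2 * d2) * phi r).

Definition inv_order {R : realType} (phi : R -> R) (t : R) : R :=
  xget 0 [set r | 0 < r /\ phi r = t].

Definition levy_density {R : realType} {d : nat} (phi : R -> R)
  (a0 : 'rV[R]_d -> R) (h : 'rV[R]_d) : R :=
  a0 h / (euclid_norm h ^+ d * phi (euclid_norm h)).

(* real and imaginary parts of the Levy exponent
   psi(xi) = int (1 - e^{i xi.h} + i xi.h 1_{|h|<=1}) nu(dh) *)
Definition levy_exp_re {R : realType} {d : nat}
  (leb : {measure set (Rd R d) -> \bar R}) (phi : R -> R) (a0 : 'rV[R]_d -> R)
  (xi : 'rV[R]_d) : R :=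
  fine (\int[leb]_(h in [set h : Rd R d | (h : 'rV[R]_d) != (0%R : 'rV[R]_d)])
          ((1 - cos (euclid_dot xi h)) * levy_density phi a0 h)%R%:E)%E.

Definition levy_exp_im {R : realType} {d : nat}
  (leb : {measure set (Rd R d) -> \bar R}) (phi : R -> R) (a0 : 'rV[R]_d -> R)
  (xi : 'rV[R]_d) : R :=
  fine (\int[leb]_(h in [set h : Rd R d | (h : 'rV[R]_d) != (0%R : 'rV[R]_d)])
          ((euclid_dot xi h * (if (euclid_norm h <= 1)%R then 1 else 0) - sin (euclid_dot xi h))
             * levy_density phi a0 h)%R%:E)%E.

(* mu_t is the law of Y_t: E[e^{i xi.Y_t}] = exp(-t psi(xi)), written
   in real and imaginary parts *)
Definition levy_law {R : realType} {d : nat}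
  (leb : {measure set (Rd R d) -> \bar R}) (phi : R -> R) (a0 : 'rV[R]_d -> R)
  (t : R) (mu : probability (Rd R d) R) : Prop :=
  forall xi : 'rV[R]_d,
    (\int[mu]_y (cos (euclid_dot xi y))%:E)%E
      = (expR (- t * levy_exp_re leb phi a0 xi)
           * cos (t * levy_exp_im leb phi a0 xi))%:E /\
    (\int[mu]_y (sin (euclid_dot xi y))%:E)%E
      = (- (expR (- t * levy_exp_re leb phi a0 xi)
           * sin (t * levy_exp_im leb phi a0 xi)))%:E.

Definition semigroup {R : realType} {d : nat} (mu : probability (Rd R d) R)
  (f : 'rV[R]_d -> R) (x : 'rV[R]_d) : R :=
  fine (\int[mu]_y (f (x + (y : 'rV[R]_d))%R)%:E)%E.

Definition supnorm {R : realType} {d : nat} (f : 'rV[R]_d -> R) : R :=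
  sup (range (fun x => `|f x|)).

Definition unitv {R : realType} {d : nat} (i : 'I_d) : 'rV[R]_d := delta_mx ord0 i.
Definition pderiv {R : realType} {d : nat} (s : seq 'I_d)
  (g : 'rV[R]_d -> R) : 'rV[R]_d -> R :=
  foldr (fun i h => fun x => derive h x (unitv i)) g s.

Definition smooth {R : realType} {d : nat} (g : 'rV[R]_d -> R) : Prop :=
  forall (s : seq 'I_d) (x : 'rV[R]_d), differentiable (pderiv s g) x.

(* Main.v *)
(* Write [psi] for the Levy exponent. [P_t] multiplies the character [x -> e^(i xi.x)] by
   [exp (- t psi(xi))], so the derivatives of [P_t f], for a trigonometric polynomial [f], are
   given by the Fourier multipliers [(i xi)^gamma exp (- t psi(xi))], and these have to be bounded
   in the sup norm by [C r^-k] with [r = phi^-1(t)]. As [exp (- t psi)] is the [k]-th power of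
   [exp (- (t / k) psi)], first-order derivatives suffice. At each scale [rho_j = r 2^-j] the
   measure [t nu] dominates [q_j] times Lebesgue measure on a cube of side [rho_j], and the
   scaling of [phi] makes the jump intensity [q_j rho_j^d] grow at least like [c beta^j] with
   [beta > 1]. Condition on the first scale at which such a jump occurs: a jump uniform on the
   cube turns a derivative into a factor [2 / rho_j], while the probability that no coarser scale
   jumps is superexponentially small in [j], so the costs sum up to [O(1 / r)].
   Finally, a bounded continuous function is reached from trigonometric polynomials by two
   bounded pointwise limits (Bernstein polynomials in [sin (x_i / L)], then [L -> oo]), and by
   Taylor's formula uniform bounds on all derivatives survive such limits. *)

Require Import Defs.
From HB Require Import structures.
From mathcomp Require Import all_boot all_order all_algebra.
From mathcomp Require Import all_classical all_reals all_analysis.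
From mathcomp Require Import measurable_realfun complex ring lra.
Import Order.TTheory GRing.Theory Num.Theory.
Import numFieldNormedType.Exports.
Local Open Scope classical_set_scope.
Local Open Scope ring_scope.

Set Implicit Arguments. Unset Strict Implicit. Unset Printing Implicit Defensive.

Local Open Scope complex_scope.
Local Notation Re := complex.Re.
Local Notation Im := complex.Im.

(** * The complex exponential *)

(** The law of the process is known only through its characteristic function, so no transition
    density is constructed and no Fourier inversion occurs: everything rests on [mult_le], which is
    stable under sums, products and pointwise limits of multipliers. The Levy measure is infinite,
    so jumps are first cut off at size [rho J]. The compensator of the cut exponent is then a mere
    translation, invisible to the sup norm. If no scale coarser than [rho J] jumps, nothing is
    smoothed and the gradient of the trigonometric polynomial itself enters. It is not controlled by
    the sup norm, but its weight is the no-jump probability, which tends to 0 as [J] grows while the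
    polynomial stays fixed. The scaling exponents act at different places. The lower one gives
    [beta = 2^(2 d1)] and the decay of the measure at infinity. The upper one compares [phi] on a
    cube with [phi (rho j)], and [d2 < 1] makes [|h|^2] integrable near 0. In the [k]-th root the
    time becomes [t / k] while the length [r] remains [phi^-1(t)]; this lowers the intensities by
    the factor [kap = 1 / k] and is one source of the dependence of [C] on [k]. *)

Lemma ReD (R : realType) (z w : R[i]) : Re (z + w) = Re z + Re w.
Proof. by case: z w => [? ?] [? ?]. Qed.

Lemma ImD (R : realType) (z w : R[i]) : Im (z + w) = Im z + Im w.
Proof. by case: z w => [? ?] [? ?]. Qed.

Lemma ReM (R : realType) (z w : R[i]) : Re (z * w) = Re z * Re w - Im z * Im w.
Proof. by case: z w => [? ?] [? ?]. Qed.

Lemma ImM (R : realType) (z w : R[i]) : Im (z * w) = Re z * Im w + Im z * Re w.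
Proof. by case: z w => [? ?] [? ?]. Qed.

Lemma ReN (R : realType) (z : R[i]) : Re (- z) = - Re z.
Proof. by case: z. Qed.

Lemma ImN (R : realType) (z : R[i]) : Im (- z) = - Im z.
Proof. by case: z. Qed.

Definition reimE := (ReD, ImD, ReM, ImM, ReN, ImN).

Lemma complex_ext (R : realType) (z w : R[i]) : Re z = Re w -> Im z = Im w -> z = w.
Proof. by case: z w => [? ?] [? ?] /= -> ->. Qed.

Definition cis {R : realType} (y : R) : R[i] := cos y +i* sin y.

Definition cexp {R : realType} (z : R[i]) : R[i] := (expR (Re z))%:C * cis (Im z).

Lemma cisD (R : realType) (x y : R) : cis (x + y) = cis x * cis y.
Proof. by apply: complex_ext; rewrite reimE /= ?cosD ?sinD //; ring. Qed.

Lemma cis0 (R : realType) : cis (0 : R) = 1.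
Proof. by rewrite /cis cos0 sin0. Qed.

Lemma cexpD (R : realType) (z w : R[i]) : cexp (z + w) = cexp z * cexp w.
Proof. by rewrite /cexp !reimE expRD rmorphM cisD; ring. Qed.

Lemma cexp0 (R : realType) : cexp (0 : R[i]) = 1.
Proof. by rewrite /cexp /= expR0 cis0 mulr1. Qed.

Lemma cexp_natmul (R : realType) (z : R[i]) n : cexp (z *+ n) = cexp z ^+ n.
Proof. by elim: n => [|n IH]; rewrite ?cexp0// mulrS cexpD IH exprS. Qed.

(* A submultiplicative norm with values in [R], the library norm of [R[i]] being complex-valued. *)
Definition cn1 {R : realType} (z : R[i]) : R := `|Re z| + `|Im z|.

Lemma cn1_ge0 (R : realType) (z : R[i]) : 0 <= cn1 z.
Proof. by rewrite addr_ge0. Qed.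

Lemma cn1D (R : realType) (z w : R[i]) : cn1 (z + w) <= cn1 z + cn1 w.
Proof.
rewrite /cn1 !reimE addrACA; apply: lerD; exact: ler_normD.
Qed.

Lemma le_of_eq (R : realType) (x y : R) : x = y -> x <= y.
Proof. by move=> ->. Qed.

Lemma cn1M (R : realType) (z w : R[i]) : cn1 (z * w) <= cn1 z * cn1 w.
Proof.
rewrite /cn1 !reimE; apply: (le_trans (lerD (ler_normB _ _) (ler_normD _ _))).
by rewrite !normrM; apply: le_of_eq; ring.
Qed.

Lemma cn1X (R : realType) (z : R[i]) n : cn1 (z ^+ n) <= cn1 z ^+ n.
Proof.
elim: n => [|n IH]; first by rewrite !expr0 /cn1 /= normr0 normr1 addr0.
rewrite !exprS; apply: (le_trans (cn1M _ _)).
by rewrite ler_wpM2l // cn1_ge0.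
Qed.

Lemma cn1N (R : realType) (z : R[i]) : cn1 (- z) = cn1 z.
Proof. by rewrite /cn1 !reimE !normrN. Qed.

Lemma cn1_sum (R : realType) n (F : 'I_n -> R[i]) :
  cn1 (\sum_i F i) <= \sum_i cn1 (F i).
Proof.
elim/big_ind2: _ => [|z a w b za wb|//]; first by rewrite /cn1 /= normr0 addr0.
exact: le_trans (cn1D _ _) (lerD za wb).
Qed.

(** The mean value theorem between 0 and [x]; the intermediate point is kept because [|c| <= |x|] is
    what yields second-order estimates. *)
Lemma cos_MVT_bound (R : realType) (x : R) : exists2 c, `|c| <= `|x| & cos x - 1 = - sin c * x.
Proof.
have H := @MVT_segment R (@cos R) (fun y => - sin y).
have cc a b : {within `[a, b], continuous (@cos R)}.
  by apply: continuous_subspaceT => y; exact: continuous_cos.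
have [x0|x0] := leP 0 x.
  have [c] := H 0 x x0 (fun y _ => is_derive_cos y) (cc _ _).
  rewrite in_itv /= subr0 cos0 => /andP[c0 cx] E; exists c => //.
  by rewrite !ger0_norm.
have [c] := H x 0 (ltW x0) (fun y _ => is_derive_cos y) (cc _ _).
rewrite in_itv /= cos0 sub0r => /andP[c0 cx] E; exists c.
  by rewrite !ler0_norm // ?lerN2 // ltW.
by apply: oppr_inj; rewrite opprB E; ring.
Qed.

Lemma sin_MVT_bound (R : realType) (x : R) : exists2 c, `|c| <= `|x| & sin x = cos c * x.
Proof.
have H := @MVT_segment R (@sin R) (@cos R).
have cc a b : {within `[a, b], continuous (@sin R)}.
  by apply: continuous_subspaceT => y; exact: continuous_sin.
have [x0|x0] := leP 0 x.
  have [c] := H 0 x x0 (fun y _ => is_derive_sin y) (cc _ _).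
  rewrite in_itv /= subr0 sin0 subr0 => /andP[c0 cx] E; exists c => //.
  by rewrite !ger0_norm.
have [c] := H x 0 (ltW x0) (fun y _ => is_derive_sin y) (cc _ _).
rewrite in_itv /= sin0 !sub0r => /andP[c0 cx] E; exists c.
  by rewrite !ler0_norm // ?lerN2 // ltW.
by apply: oppr_inj; rewrite E; ring.
Qed.

Lemma abs_sin_le (R : realType) (x : R) : `|sin x| <= `|x|.
Proof.
have [c _ ->] := sin_MVT_bound x.
by rewrite normrM ler_piMl // cos_max.
Qed.

Lemma abs_cos_sub1_le (R : realType) (x : R) : `|cos x - 1| <= x ^+ 2.
Proof.
have [c cx ->] := cos_MVT_bound x.
rewrite normrM normrN -real_normK ?num_real // expr2 ler_wpM2r //.
exact: le_trans (abs_sin_le _) cx.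
Qed.

(** Two mean value steps give [(cos c - 1) x] with [|cos c - 1| <= |c|]. A quadratic bound suffices,
    as it is matched with the weight [|h|^2] near the origin. *)
Lemma abs_sin_sub_le (R : realType) (x : R) : `|sin x - x| <= x ^+ 2.
Proof.
have [c cx ->] := sin_MVT_bound x.
have -> : cos c * x - x = (cos c - 1) * x by ring.
rewrite normrM -[leRHS]real_normK ?num_real // expr2 ler_wpM2r //.
have [c' c'c ->] := cos_MVT_bound c.
rewrite normrM normrN; apply: le_trans cx.
rewrite ler_piMl //; exact: sin_max.
Qed.

(** From [exp (- x) >= 1 - x] one gets [exp x (1 - x) <= 1], hence [(exp x - 1 - x) (1 - x) <= x^2];
    the factor 2 comes from [1 - x >= 1/2]. *)
Lemma expR_sub_affine_le (R : realType) (x : R) : `|x| <= 2^-1 -> `|expR x - 1 - x| <= 2 * x ^+ 2.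
Proof.
move=> hx; have x1 : x <= 2^-1 := le_trans (ler_norm _) hx.
have lo := expR_ge1Dx x.
have hi : expR x * (1 - x) <= 1.
  have := expR_ge1Dx (- x); rewrite expRN => h.
  by rewrite mulrC -ler_pdivlMr ?expR_gt0 // mul1r.
rewrite ger0_norm; last by lra.
have : (expR x - 1 - x) * (1 - x) <= x ^+ 2 by move: hi; rewrite expr2; lra.
have e0 : 0 <= expR x - 1 - x by lra.
move: (expR x - 1 - x) e0 => e e0 h; nra.
Qed.

Lemma cexp_sub_affine_le (R : realType) (z : R[i]) :
  cn1 z <= 2^-1 -> cn1 (cexp z - 1 - z) <= 5 * cn1 z ^+ 2.
Proof.
case: z => a b; rewrite /cn1 /cexp /cis !reimE /= => h.
have a0 := normr_ge0 a; have b0 := normr_ge0 b.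
have ha : `|a| <= 2^-1 by lra.
have hb : `|b| <= 2^-1 by lra.
have H1 := expR_sub_affine_le ha.
have H2 := abs_cos_sub1_le b.
have H3 := abs_sin_sub_le b.
have H4 := abs_sin_le b.
move: H1 H2 H3.
rewrite -[a ^+ 2]real_normK ?num_real // -[b ^+ 2]real_normK ?num_real // => H1 H2 H3.
have E : 0 <= expR a <= 2.
  rewrite expR_ge0 /=; move: (ler_norm (expR a - 1 - a)) (ler_norm a) => ? ?.
  have : `|a| ^+ 2 <= 2^-1 * 2^-1 by rewrite expr2 ler_pM.
  by lra.
case/andP: E => E0 E2.
have H5 : `|expR a - 1| <= 2 * `|a|.
  have -> : expR a - 1 = (expR a - 1 - a) + a by ring.
  apply: (le_trans (ler_normD _ _)); nra.
have R1 : `|expR a * cos b - 0 * sin b - 1 - a| <= 2 * `|a| ^+ 2 + 2 * `|b| ^+ 2.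
  have -> : expR a * cos b - 0 * sin b - 1 - a = (expR a - 1 - a) + expR a * (cos b - 1) by ring.
  apply: (le_trans (ler_normD _ _)); apply: lerD => //.
  by rewrite normrM ler_pM // ger0_norm.
have R2 : `|expR a * sin b + 0 * cos b - 0 - b| <= 2 * `|a| * `|b| + `|b| ^+ 2.
  have -> : expR a * sin b + 0 * cos b - 0 - b = (expR a - 1) * sin b + (sin b - b) by ring.
  apply: (le_trans (ler_normD _ _)); apply: lerD => //.
  by rewrite normrM ler_pM.
rewrite ?subr0 in R2 *.
apply: (le_trans (lerD R1 R2)); nra.
Qed.

Lemma cn1_cexp_le (R : realType) (z : R[i]) : cn1 (cexp z) <= expR (cn1 z).
Proof.
case: z => a b; rewrite /cn1 /cexp /cis !reimE /= !mul0r subr0 addr0.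
rewrite !normrM (ger0_norm (expR_ge0 _)) -mulrDr expRD.
apply: ler_pM; rewrite ?expR_ge0 ?addr_ge0 ?ler_expR ?ler_norm //.
apply: le_trans (expR_ge1Dx _).
apply: lerD; [exact: cos_max | exact: abs_sin_le].
Qed.

Definition ccvg {R : realType} (u : nat -> R[i]) (z : R[i]) :=
  ((fun n => Re (u n)) @ \oo --> Re z) /\ ((fun n => Im (u n)) @ \oo --> Im z).

Lemma ccvg_cn1 (R : realType) (u : nat -> R[i]) z :
  (fun n => cn1 (u n - z)) @ \oo --> (0 : R) -> ccvg u z.
Proof.
move=> h; split; apply/subr_cvg0; apply/norm_cvg0P;
  apply: (squeeze_cvgr _ (cvg_cst 0) h); apply: nearW => n;
  by rewrite normr_ge0 /= /cn1 !reimE ?lerDl ?lerDr normr_ge0.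
Qed.

Lemma ccvgM (R : realType) (u v : nat -> R[i]) z w :
  ccvg u z -> ccvg v w -> ccvg (fun n => u n * v n) (z * w).
Proof.
move=> [u1 u2] [v1 v2]; split.
  under eq_fun do rewrite ReM; rewrite ReM.
  by apply: cvgB; apply: cvgM.
under eq_fun do rewrite ImM; rewrite ImM.
by apply: cvgD; apply: cvgM.
Qed.

Lemma ccvg_cst (R : realType) (z : R[i]) : ccvg (fun=> z) z.
Proof. by split; exact: cvg_cst. Qed.

Lemma ccvgB (R : realType) (u v : nat -> R[i]) z w :
  ccvg u z -> ccvg v w -> ccvg (fun n => u n - v n) (z - w).
Proof.
move=> [u1 u2] [v1 v2]; split.
  under eq_fun do rewrite ReD ReN; rewrite ReD ReN.
  exact: cvgB.
under eq_fun do rewrite ImD ImN; rewrite ImD ImN.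
exact: cvgB.
Qed.

Lemma ccvg_cexp (R : realType) (u : nat -> R[i]) z : ccvg u z -> ccvg (cexp \o u) (cexp z).
Proof.
move=> [u1 u2]; apply: ccvgM.
  split => /=; last exact: cvg_cst.
  by apply: continuous_cvg => //; exact: continuous_expR.
split => /=.
  by apply: continuous_cvg => //; exact: continuous_cos.
by apply: continuous_cvg => //; exact: continuous_sin.
Qed.

Lemma cn1_natdiv (R : realType) (z : R[i]) n : cn1 (z / n.+1%:R) = cn1 z / n.+1%:R.
Proof.
have -> : (n.+1%:R : R[i])^-1 = (n.+1%:R^-1)%:C by rewrite fmorphV rmorph_nat.
rewrite /cn1 !reimE /= !mulr0 subr0 add0r !normrM.
by rewrite [`|_^-1|]ger0_norm ?invr_ge0 ?ler0n // mulrDl.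
Qed.

(** The difference of the powers of [1 + z/n] and [exp (z/n)] factors as their difference, of order
    [c^2 / n^2], times a sum of [n] terms each at most [exp c]. The limit serves to transfer
    multiplier bounds from [1 + z/n] to the exponential. *)
Lemma euler_ccvg (R : realType) (z : R[i]) :
  ccvg (fun n => (1 + z / n.+1%:R) ^+ n.+1) (cexp z).
Proof.
apply: ccvg_cn1.
set c := cn1 z; have c0 : 0 <= c := cn1_ge0 z.
apply: (@squeeze_cvgr _ _ _ _ (fun=> 0) (fun n => (5 * c ^+ 2 * expR c) * n.+1%:R^-1)); last 2 first.
- exact: cvg_cst.
- rewrite -[X in _ --> X](mulr0 (5 * c ^+ 2 * expR c)).
  by apply: cvgM; [exact: cvg_cst|exact: cvg_harmonic].
have [N hN] : exists N, 2 * c < N%:R.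
  by exists (Num.truncn (2 * c)).+1; exact: truncnS_gt.
exists N => // n /= nN; rewrite cn1_ge0 /=.
have n0 : (0 : R) < n.+1%:R by rewrite ltr0n.
set F := 1 + z / n.+1%:R; set E := cexp (z / n.+1%:R).
have -> : cexp z = E ^+ n.+1.
  by rewrite -cexp_natmul -[(z / n.+1%:R) *+ n.+1]mulr_natr divfK // pnatr_eq0.
have cz : cn1 (z / n.+1%:R) = c / n.+1%:R by exact: cn1_natdiv.
have chalf : c / n.+1%:R <= 2^-1.
  rewrite ler_pdivrMr //.
  have : (N%:R : R) <= n.+1%:R by rewrite ler_nat (leq_trans nN).
  by lra.
have E1 : cn1 E <= expR (c / n.+1%:R) by rewrite -cz; exact: cn1_cexp_le.
have F1 : cn1 F <= expR (c / n.+1%:R).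
  apply: le_trans (expR_ge1Dx _).
  rewrite -cz; apply: (le_trans (cn1D _ _)).
  by rewrite /cn1 /= normr1 normr0 addr0.
rewrite subrXX; apply: (le_trans (cn1M _ _)).
have D1 : cn1 (F - E) <= 5 * (c / n.+1%:R) ^+ 2.
  have -> : F - E = - (E - 1 - z / n.+1%:R) by rewrite /F; ring.
  by rewrite cn1N -cz; apply: cexp_sub_affine_le; rewrite cz.
have S1 : cn1 (\sum_(i < n.+1) F ^+ (n.+1.-1 - i) * E ^+ i) <= n.+1%:R * expR c.
  apply: (le_trans (cn1_sum _)).
  apply: (@le_trans _ _ (\sum_(i < n.+1) expR c)); last by rewrite sumr_const card_ord mulr_natl.
  apply: ler_sum => i _; apply: (le_trans (cn1M _ _)).
  apply: (@le_trans _ _ (expR (c / n.+1%:R) ^+ (n.+1.-1 - i) * expR (c / n.+1%:R) ^+ i)).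
    apply: ler_pM; rewrite ?cn1_ge0 //.
      by apply: (le_trans (cn1X _ _)); rewrite lerXn2r ?nnegrE ?cn1_ge0 ?expR_ge0.
    by apply: (le_trans (cn1X _ _)); rewrite lerXn2r ?nnegrE ?cn1_ge0 ?expR_ge0.
  rewrite -exprD subnK /=; last by rewrite -ltnS.
  rewrite -expRM_natl ler_expR mulrA [_ * c]mulrC -mulrA ler_piMr //.
  by rewrite ler_pdivrMr // mul1r ler_nat.
apply: (le_trans (ler_pM (cn1_ge0 _) (cn1_ge0 _) D1 S1)).
apply: le_of_eq; rewrite expr_div_n; field.
by rewrite nat1r pnatr_eq0.
Qed.

(** * Multipliers on trigonometric polynomials *)

(* [s] encodes the trigonometric polynomial [x -> \sum_(c <- s) Re (c.1 * e^(i c.2.x))], to which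
   the Fourier multiplier [m] is applied. Frequencies may repeat in [s], but [evm m s] only
   depends on the function [trig s] as soon as [mult_le m A] holds for some [A]. *)
Definition evm {R : realType} {d : nat} (m : 'rV[R]_d -> R[i])
  (s : seq (R[i] * 'rV[R]_d)) (x : 'rV[R]_d) : R :=
  \sum_(c <- s) Re (m c.2 * c.1 * cis (euclid_dot c.2 x)).

Local Notation trig := (evm (fun=> 1)).

(** An operator norm bound for the Fourier multiplier [m] on trigonometric polynomials with the sup
    norm; quantifying over every bound [M] replaces the supremum. *)
Definition mult_le {R : realType} {d : nat} (m : 'rV[R]_d -> R[i]) (A : R) : Prop :=
  forall s (M : R), (forall x, `|trig s x| <= M) -> forall x, `|evm m s x| <= A * M.

Lemma evm_comp (R : realType) (d : nat) (m m' : 'rV[R]_d -> R[i]) s x :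
  evm m [seq (m' c.2 * c.1, c.2) | c <- s] x = evm (fun xi => m xi * m' xi) s x.
Proof. by rewrite /evm big_map; apply: eq_bigr => c _ /=; rewrite !mulrA. Qed.

Lemma evm_trig (R : realType) (d : nat) (m : 'rV[R]_d -> R[i]) s x :
  trig [seq (m c.2 * c.1, c.2) | c <- s] x = evm m s x.
Proof.
by rewrite evm_comp; apply: eq_bigr => c _ /=; rewrite mul1r.
Qed.

Lemma evm_eq (R : realType) (d : nat) (m m' : 'rV[R]_d -> R[i]) s x :
  m =1 m' -> evm m s x = evm m' s x.
Proof. by move=> mm'; apply: eq_bigr => c _; rewrite mm'. Qed.

Lemma evmD (R : realType) (d : nat) (m m' : 'rV[R]_d -> R[i]) s x :
  evm (fun xi => m xi + m' xi) s x = evm m s x + evm m' s x.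
Proof. by rewrite -big_split; apply: eq_bigr => c _ /=; rewrite !mulrDl ReD. Qed.

Lemma evmZ (R : realType) (d : nat) (a : R) (m : 'rV[R]_d -> R[i]) s x :
  evm (fun xi => a%:C * m xi) s x = a * evm m s x.
Proof.
by rewrite big_distrr; apply: eq_bigr => c _ /=; rewrite -!mulrA ReM /= mul0r subr0.
Qed.

Lemma mult_le_eq (R : realType) (d : nat) (m m' : 'rV[R]_d -> R[i]) (A : R) :
  m =1 m' -> mult_le m A -> mult_le m' A.
Proof. by move=> mm' h s M sM x; rewrite -(evm_eq _ _ mm'); exact: h. Qed.

Lemma mult_le1 (R : realType) (d : nat) : mult_le (fun=> 1 : R[i]) (1 : R) (d := d).
Proof. by move=> s M sM x; rewrite mul1r. Qed.

Lemma mult_le_ge0 (R : realType) (d : nat) s (M : R) :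
  (forall x : 'rV[R]_d, `|trig s x| <= M) -> 0 <= M.
Proof. by move=> /(_ 0); exact: le_trans. Qed.

Lemma mult_leW (R : realType) (d : nat) (m : 'rV[R]_d -> R[i]) (A B : R) :
  A <= B -> mult_le m A -> mult_le m B.
Proof.
move=> AB h s M sM x; apply: (le_trans (h _ _ sM x)).
by rewrite ler_wpM2r // (mult_le_ge0 sM).
Qed.

Lemma mult_leM (R : realType) (d : nat) (m m' : 'rV[R]_d -> R[i]) (A B : R) :
  mult_le m A -> mult_le m' B -> mult_le (fun xi => m xi * m' xi) (A * B).
Proof.
move=> h h' s M sM x; rewrite -evm_comp -mulrA; apply: h => y.
by rewrite evm_trig; exact: h'.
Qed.

Lemma mult_leD (R : realType) (d : nat) (m m' : 'rV[R]_d -> R[i]) (A B : R) :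
  mult_le m A -> mult_le m' B -> mult_le (fun xi => m xi + m' xi) (A + B).
Proof.
move=> h h' s M sM x; rewrite evmD mulrDl; apply: (le_trans (ler_normD _ _)).
by apply: lerD; [exact: h | exact: h'].
Qed.

Lemma mult_leZ (R : realType) (d : nat) (a : R) (m : 'rV[R]_d -> R[i]) (A : R) :
  mult_le m A -> mult_le (fun xi => a%:C * m xi) (`|a| * A).
Proof. by move=> h s M sM x; rewrite evmZ normrM -mulrA ler_wpM2l //; exact: h. Qed.

Lemma mult_leX (R : realType) (d : nat) (m : 'rV[R]_d -> R[i]) (A : R) n :
  mult_le m A -> mult_le (fun xi => m xi ^+ n) (A ^+ n).
Proof.
move=> h; elim: n => [|n IH]; first exact: mult_le1.
rewrite exprS; apply: mult_le_eq (mult_leM h IH) => xi.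
by rewrite exprS.
Qed.

Lemma mult_le_sum (R : realType) (d : nat) n (m : 'I_n -> 'rV[R]_d -> R[i]) (A : 'I_n -> R) :
  (forall i, mult_le (m i) (A i)) -> mult_le (fun xi => \sum_(i < n) m i xi) (\sum_(i < n) A i).
Proof.
elim: n m A => [|n IH] m A h.
  move=> s M sM x; rewrite big_ord0 mul0r /evm big1 ?normr0 // => c _.
  by rewrite big_ord0 !mul0r.
rewrite big_ord_recl.
apply: mult_le_eq (mult_leD (h ord0) (IH _ _ (fun i => h (lift ord0 i)))) => xi.
by rewrite big_ord_recl.
Qed.

Lemma mult_le_prod (R : realType) (d : nat) (I : Type) (r : seq I) (m : I -> 'rV[R]_d -> R[i]) (A : R) :
  (forall i, mult_le (m i) A) -> mult_le (fun xi => \prod_(i <- r) m i xi) (A ^+ size r).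
Proof.
move=> h; elim: r => [|i r IH].
  by apply: mult_le_eq (@mult_le1 R d) => xi; rewrite big_nil.
rewrite exprS; apply: mult_le_eq (mult_leM (h i) IH) => xi.
by rewrite big_cons.
Qed.

Lemma evm_cvg (R : realType) (d : nat) (m : nat -> 'rV[R]_d -> R[i]) m' s x :
  (forall xi, ccvg (fun n => m n xi) (m' xi)) ->
  (fun n => evm (m n) s x) @ \oo --> evm m' s x.
Proof.
move=> h; rewrite /evm; elim: s => [|c s IH].
  rewrite big_nil; under eq_fun do rewrite big_nil; exact: cvg_cst.
rewrite big_cons; under eq_fun do rewrite big_cons.
apply: cvgD => //.
have [h1 _] := ccvgM (ccvgM (h c.2) (ccvg_cst c.1)) (ccvg_cst (cis (euclid_dot c.2 x))).
exact: h1.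
Qed.

(** For a fixed polynomial only finitely many frequencies matter, and its bound [M] does not involve
    [n]; pointwise convergence of the multipliers is therefore enough. *)
Lemma mult_le_cvg (R : realType) (d : nat) (m : nat -> 'rV[R]_d -> R[i]) m' (A : R) :
  (\forall n \near \oo, mult_le (m n) A) ->
  (forall xi, ccvg (fun n => m n xi) (m' xi)) -> mult_le m' A.
Proof.
move=> h hc s M sM x.
have H : (fun n => `|evm (m n) s x|) @ \oo --> `|evm m' s x|.
  by apply: cvg_norm; exact: evm_cvg.
apply: (ler_cvg_to H (cvg_cst (A * M : R))).
by apply: filterS h => n hn; exact: hn.
Qed.

Lemma euclid_dotDr (R : realType) (d : nat) (x y z : 'rV[R]_d) :
  euclid_dot x (y + z) = euclid_dot x y + euclid_dot x z.
Proof. by rewrite -big_split; apply: eq_bigr => i _; rewrite mxE mulrDr. Qed.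

Lemma euclid_dotDl (R : realType) (d : nat) (x y z : 'rV[R]_d) :
  euclid_dot (y + z) x = euclid_dot y x + euclid_dot z x.
Proof. by rewrite -big_split; apply: eq_bigr => i _; rewrite mxE mulrDl. Qed.

Lemma evm_cis (R : realType) (d : nat) (m : 'rV[R]_d -> R[i]) (b : 'rV[R]_d) s x :
  evm (fun xi => m xi * cis (euclid_dot xi b)) s x = evm m s (x + b).
Proof.
by apply: eq_bigr => c _; congr Re; rewrite euclid_dotDr cisD; ring.
Qed.

Lemma mult_le_cis (R : realType) (d : nat) (b : 'rV[R]_d) :
  mult_le (fun xi => cis (euclid_dot xi b)) 1.
Proof.
move=> s M sM x; rewrite mul1r.
have -> : evm (fun xi => cis (euclid_dot xi b)) s x = trig s (x + b); last exact: sM.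
by rewrite -evm_cis; apply: evm_eq => xi; rewrite mul1r.
Qed.

(** Written as [(1 - lam/n) + N/n], the multiplier has norm at most [(1 - lam/n) + lam/n = 1], where
    [lam <= n] makes the first coefficient nonnegative. *)
Lemma mult_le_euler (R : realType) (d : nat) (N : 'rV[R]_d -> R[i]) (lam : R) n :
  mult_le N lam -> 0 <= lam -> lam <= n.+1%:R ->
  mult_le (fun xi => 1 + (N xi - lam%:C) / n.+1%:R) 1.
Proof.
move=> h l0 ln.
have n0 : (0 : R) < n.+1%:R by rewrite ltr0n.
have := mult_leD (mult_leZ (1 - lam / n.+1%:R) (@mult_le1 R d)) (mult_leZ (n.+1%:R^-1) h).
rewrite ger0_norm; last by rewrite subr_ge0 ler_pdivrMr // mul1r.
rewrite ger0_norm ?invr_ge0 ?ler0n //.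
have -> : (1 - lam / n.+1%:R) * 1 + n.+1%:R^-1 * lam = 1 by ring.
apply: mult_le_eq => xi.
rewrite rmorphB rmorphM /= fmorphV rmorph_nat rmorph1; ring.
Qed.

Lemma euler_near (R : realType) (lam : R) : \forall n \near \oo, lam <= n.+1%:R.
Proof.
exists (Num.truncn lam) => // n /= h; apply: ltW; apply: (lt_le_trans (truncnS_gt lam)).
by rewrite ler_nat ltnS.
Qed.

(** When [N] is the transform of a positive density of mass [lam], this is the contractivity of a
    compound Poisson semigroup; it follows from Euler's limit, each approximating power being a
    contraction. *)
Lemma mult_le_cexp (R : realType) (d : nat) (N : 'rV[R]_d -> R[i]) (lam : R) :
  mult_le N lam -> 0 <= lam -> mult_le (fun xi => cexp (N xi - lam%:C)) 1.
Proof.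
move=> h l0; apply: mult_le_cvg (fun xi => euler_ccvg (N xi - lam%:C)).
apply: filterS (euler_near lam) => n ln.
have := mult_leX n.+1 (mult_le_euler h l0 ln).
by rewrite expr1n.
Qed.

(* The Poisson semigroup generated by [N - lam], with the no-jump event removed, factors
   through [N] and hence inherits the smoothing of [N]. *)
Lemma mult_le_cexp_jump (R : realType) (d : nat) (D N : 'rV[R]_d -> R[i]) (lam a : R) :
  mult_le N lam -> 0 <= lam -> 0 <= a -> mult_le (fun xi => D xi * N xi) (lam * a) ->
  mult_le (fun xi => D xi * (cexp (N xi - lam%:C) - (expR (- lam))%:C)) a.
Proof.
move=> h l0 a0 hD.
have e xi : ccvg (fun n => D xi * ((1 + (N xi - lam%:C) / n.+1%:R) ^+ n.+1
    - (1 + (- lam%:C) / n.+1%:R) ^+ n.+1)) (D xi * (cexp (N xi - lam%:C) - (expR (- lam))%:C)).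
  apply: ccvgM; first exact: ccvg_cst.
  apply: ccvgB; first exact: euler_ccvg.
  have -> : (expR (- lam))%:C = cexp (- lam%:C).
    by rewrite /cexp !reimE /= oppr0 cis0 mulr1.
  exact: euler_ccvg.
apply: mult_le_cvg e.
apply: filterS (euler_near lam) => n ln.
have n0 : (0 : R) < n.+1%:R by rewrite ltr0n.
pose q : R := 1 - lam / n.+1%:R.
have q0 : 0 <= q by rewrite subr_ge0 ler_pdivrMr // mul1r.
have q1 : q <= 1 by rewrite gerBl divr_ge0 // ltW.
have E := mult_le_euler h l0 ln.
have S := mult_le_sum (fun i : 'I_n.+1 => mult_leM (mult_leX (n.+1.-1 - i) E)
   (mult_leZ (q ^+ i) (@mult_le1 R d))).
have := mult_leM (mult_leZ (n.+1%:R^-1) hD) S.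
move=> H; apply: mult_leW (mult_le_eq _ H); last first.
  move=> xi.
  have -> : 1 + - lam%:C / n.+1%:R = q%:C.
    by rewrite /q rmorphB rmorphM /= fmorphV rmorph_nat rmorph1; ring.
  rewrite subrXX; under eq_bigr do rewrite mulr1 rmorphXn.
  rewrite fmorphV rmorph_nat !mulrA; congr (_ * _).
  by rewrite /q rmorphB rmorphM /= fmorphV rmorph_nat rmorph1; ring.
under eq_bigr do rewrite expr1n mul1r mulr1 (ger0_norm (exprn_ge0 _ q0)).
rewrite ger0_norm ?invr_ge0 ?ler0n //.
(* As [1 - q = lam / n.+1], the geometric sum absorbs the intensity [lam], so the final bound [a] is
   the cost of a single jump however frequent jumps are. *)
have -> : n.+1%:R^-1 * (lam * a) * \sum_(i < n.+1) q ^+ i = a * (1 - q ^+ n.+1).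
  by rewrite -[1 - _]opprB subrX1 /q; ring.
by rewrite ler_piMr // gerBl exprn_ge0.
Qed.

(** * Lebesgue measure and densities on R^d *)

Lemma open_measurable_Rd (R : realType) (d : nat) (A : set 'rV[R]_d) :
  open A -> measurable (A : set (Rd R d)).
Proof. by move=> oA; exact: sub_sigma_algebra. Qed.

Lemma continuous_measurable_Rd (R : realType) (d : nat) (f : 'rV[R]_d -> R) :
  continuous f -> measurable_fun setT (f : Rd R d -> R).
Proof.
move=> /continuousP cf; apply: (measurability _ (RGenOpens.measurableE R)).
move=> _ [_ [a [b ->] <-]]; rewrite setTI; apply: open_measurable_Rd.
by apply: cf; exact: interval_open.
Qed.

Lemma measurable_coord (R : realType) (d : nat) (i : 'I_d) :
  measurable_fun setT (fun h : Rd R d => (h : 'rV[R]_d) ord0 i).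
Proof.
apply: (@continuous_measurable_Rd R d (fun h => h ord0 i)).
exact: coord_continuous.
Qed.

Lemma continuous_Rd_measurable (R : realType) (d : nat) (f : 'rV[R]_d -> 'rV[R]_d) :
  continuous f -> measurable_fun setT (f : Rd R d -> Rd R d).
Proof.
move=> /continuousP cf; apply: (@measurability _ _ _ (Rd R d) _ _ (@open 'rV[R]_d)) => //.
move=> _ [U oU <-]; rewrite setTI; apply: open_measurable_Rd.
exact: cf.
Qed.

Definition box {R : realType} {d : nat} (a b : 'rV[R]_d) : set (Rd R d) :=
  [set x | forall i, a ord0 i < (x : 'rV[R]_d) ord0 i <= b ord0 i].

Lemma measurable_box (R : realType) (d : nat) (a b : 'rV[R]_d) : measurable (box a b).
Proof.
have -> : box a b = \bigcap_(i in [set: 'I_d])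
    ((fun h : Rd R d => (h : 'rV[R]_d) ord0 i) @^-1` `]a ord0 i, b ord0 i]%classic).
  by apply/seteqP; split => x h i => [_|]; have := h i; rewrite /= in_itv /=; auto.
apply: fin_bigcap_measurable => [|i _]; first exact: finite_finset.
by rewrite -[X in measurable X]setTI; apply: measurable_coord => //; exact: measurable_itv.
Qed.

Lemma box_setI_closed (R : realType) (d : nat) :
  setI_closed [set box ab.1 ab.2 | ab in [set: 'rV[R]_d * 'rV[R]_d]].
Proof.
move=> _ _ [[a b] _ <-] [[a' b'] _ <-] /=.
exists (\row_i Num.max (a ord0 i) (a' ord0 i), \row_i Num.min (b ord0 i) (b' ord0 i)) => //=.
apply/seteqP; split => x /=.
  by move=> h; split => i; have := h i; rewrite !mxE gt_max le_min => /andP[/andP[h1 h2] /andP[h3 h4]];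
    apply/andP.
by move=> [h h'] i; rewrite !mxE gt_max le_min; have /andP[-> ->] := h i; have /andP[-> ->] := h' i.
Qed.

(** All pairs of rational corners are indexed, those whose box leaves [U] contributing the empty
    set, so that the union visibly runs over a countable type. *)
Lemma open_bigcup_box (R : realType) (d : nat) (U : set 'rV[R]_d) : open U ->
  U = \bigcup_(q in [set: 'rV[rat]_d * 'rV[rat]_d])
    (if `[< box (map_mx ratr q.1) (map_mx ratr q.2) `<=` U >]
     then box (map_mx ratr q.1) (map_mx ratr q.2) else set0).
Proof.
move=> oU; apply/seteqP; split => x; last first.
  by case=> q _; case: ifP => // /asboolP h; exact: h.
move=> Ux; have := oU; rewrite openE => /(_ _ Ux) /nbhs_ballP[e /= e0 be].
have ha (i : 'I_d) : exists q : rat, x ord0 i - e < ratr q < x ord0 i.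
  have /rat_in_itvoo[q] : x ord0 i - e < x ord0 i by rewrite ltrBlDr ltrDl.
  by rewrite in_itv => hq; exists q.
have hb (i : 'I_d) : exists q : rat, x ord0 i < ratr q < x ord0 i + e.
  have /rat_in_itvoo[q] : x ord0 i < x ord0 i + e by rewrite ltrDl.
  by rewrite in_itv => hq; exists q.
have [a ah] := choice ha; have [b bh] := choice hb.
exists (\row_i a i, \row_i b i) => //.
case: ifP => /= /asboolP h.
  move=> i; rewrite !mxE; have /andP[_ ->] := ah i; have /andP[? _] := bh i.
  exact: ltW.
case: h => y yh; apply: be; split => // i j; rewrite (ord1 i).
have := yh j; rewrite !mxE /ball /= ltr_distlC => /andP[h1 h2].
have /andP[h3 _] := ah j; have /andP[_ h4] := bh j.
by rewrite (lt_trans h3) //= (le_lt_trans h2).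
Qed.

Lemma measurable_Rd_box (R : realType) (d : nat) :
  @measurable _ (Rd R d) =
  <<s [set box ab.1 ab.2 | ab in [set: 'rV[R]_d * 'rV[R]_d]] >>.
Proof.
apply/seteqP; split.
  apply: smallest_sub; first exact: smallest_sigma_algebra.
  move=> U oU; rewrite (open_bigcup_box oU).
  apply: (@countable_bigcupT_measurable _ (g_sigma_algebraType
    [set box ab.1 ab.2 | ab in [set: 'rV[R]_d * 'rV[R]_d]])); first exact: countableP.
  move=> q; case: ifP => _; last exact: measurable0.
  by apply: sub_sigma_algebra; exists (map_mx ratr q.1, map_mx ratr q.2).
apply: smallest_sub; first exact: sigma_algebra_measurable.
by move=> _ [[a b] _ <-]; exact: measurable_box.
Qed.

Lemma translate_continuous (R : realType) (d : nat) (v : 'rV[R]_d) :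
  continuous (fun h : 'rV[R]_d => h + v).
Proof. by move=> x; apply: continuousD; [by move=> U | exact: cst_continuous]. Qed.

Lemma box_empty (R : realType) (d : nat) (a b : 'rV[R]_d) i :
  b ord0 i < a ord0 i -> box a b = set0.
Proof.
move=> h; apply/seteqP; split => // x /(_ i)/andP[h1 h2].
by have := lt_le_trans h1 h2; rewrite ltNge (ltW h).
Qed.

(** [leb] is specified by its values on boxes alone. The translated measure has the same values,
    boxes form a generating system closed under intersection, and the cubes [g k] exhaust the space
    with finite measure, so the uniqueness theorem for measures applies. *)
Lemma lebesgue_Rd_translate (R : realType) (d : nat)
  (leb : {measure set (Rd R d) -> \bar R}) (hleb : is_lebesgue_Rd leb) (v : 'rV[R]_d)
  (A : set (Rd R d)) : measurable A ->
  pushforward leb ((fun h => h + v) : Rd R d -> Rd R d) A = leb A.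
Proof.
move=> mA.
have mt : measurable_fun setT ((fun h => h + v) : Rd R d -> Rd R d).
  by apply: continuous_Rd_measurable; exact: translate_continuous.
pose g (k : nat) : set (Rd R d) := box (const_mx (- k%:R)) (const_mx k%:R).
have lebbox (a b : 'rV[R]_d) : (forall i, a ord0 i <= b ord0 i) ->
  leb (box a b) = (\prod_(i < d) (b ord0 i - a ord0 i))%:E by move=> ab; exact: hleb.
have pbox (a b : 'rV[R]_d) : pushforward leb ((fun h => h + v) : Rd R d -> Rd R d) (box a b)
   = leb (box (a - v) (b - v)).
  rewrite /pushforward; congr (leb _); apply/seteqP; split => x h i; have := h i;
    by rewrite !mxE ltrBlDr lerBrDr.
apply: (measure_unique _ g (measurable_Rd_box R d) (@box_setI_closed R d) _ _
  (pushforward leb ((fun h => h + v) : Rd R d -> Rd R d)) leb) => //.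
- by move=> k; exists (const_mx (- k%:R), const_mx k%:R).
- apply/seteqP; split => // x _.
  exists (Num.truncn (\sum_i `|(x : 'rV[R]_d) ord0 i|)).+1 => // i; rewrite !mxE.
  have h : `|(x : 'rV[R]_d) ord0 i| < (Num.truncn (\sum_i `|(x : 'rV[R]_d) ord0 i|)).+1%:R.
    apply: le_lt_trans (truncnS_gt _).
    by rewrite (bigD1 i) //= lerDl sumr_ge0.
  by move: h; rewrite ltr_norml => /andP[-> /ltW ->].
- move=> _ [[a b] _ <-] /=; rewrite pbox.
  (* The volume formula covers only ordered corners; a box with misordered corners is empty, and so
     is its translate. *)
  have [ab|/existsNP[i /negP]] := pselect (forall i, a ord0 i <= b ord0 i).
    rewrite !lebbox //; last by move=> i; rewrite !mxE lerD2r.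
    by congr (_%:E); apply: eq_bigr => i _; rewrite !mxE; ring.
  rewrite -ltNge => ba.
  by rewrite (box_empty ba) (@box_empty _ _ (a - v) _ i) // !mxE ltrD2r.
- move=> k.
  apply: (@le_lt_trans _ _ (leb (box (const_mx (- k%:R) - v) (const_mx k%:R - v)))).
    by rewrite le_eqVlt; apply/orP; left; apply/eqP; exact: pbox.
  rewrite lebbox ?ltry // => i.
  by rewrite !mxE lerD2r (le_trans _ (ler0n _ k)) // oppr_le0.
Qed.

(* The kernel is [e^(+ i xi.h)], so that [hat leb g] is the multiplier of [f -> \int f (. + h) g h dh]. *)
Definition hat {R : realType} {d : nat} (leb : {measure set (Rd R d) -> \bar R})
    (g : Rd R d -> R) (xi : 'rV[R]_d) : R[i] :=
  (\int[leb]_h (cos (euclid_dot xi h) * g h)) +i* (\int[leb]_h (sin (euclid_dot xi h) * g h)).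

Lemma continuous_sum (R : realType) (T : topologicalType) (I : Type) (r : seq I)
    (F : I -> T -> R) : (forall i, continuous (F i)) -> continuous (fun x => \sum_(i <- r) F i x).
Proof.
move=> cF; elim: r => [|i r IH].
  have -> : (fun x => \sum_(i <- [::]) F i x) = cst 0 by apply/funext => x; rewrite big_nil.
  by move=> x; exact: cst_continuous.
have -> : (fun x => \sum_(j <- i :: r) F j x) = (fun x => F i x + \sum_(j <- r) F j x).
  by apply/funext => x; rewrite big_cons.
by move=> x; apply: cvgD; [exact: cF | exact: IH].
Qed.

Lemma continuous_scale (R : realType) (T : topologicalType) (a : R) (f : T -> R) :
  continuous f -> continuous (fun x => a * f x).
Proof. by move=> cf x; apply: continuousM; [exact: cst_continuous | exact: cf]. Qed.

Lemma continuous_sub (R : realType) (T : topologicalType) (f g : T -> R) :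
  continuous f -> continuous g -> continuous (fun x => f x - g x).
Proof. by move=> cf cg x; apply: continuousB; [exact: cf | exact: cg]. Qed.

Lemma euclid_dot_continuous (R : realType) (d : nat) (xi : 'rV[R]_d) :
  continuous (euclid_dot xi).
Proof.
by apply: continuous_sum => i; apply: continuous_scale => y; exact: coord_continuous.
Qed.

Lemma cos_dot_continuous (R : realType) (d : nat) (xi : 'rV[R]_d) :
  continuous (fun h => cos (euclid_dot xi h)).
Proof.
by move=> x; apply: continuous_comp; [exact: euclid_dot_continuous | exact: continuous_cos].
Qed.

Lemma sin_dot_continuous (R : realType) (d : nat) (xi : 'rV[R]_d) :
  continuous (fun h => sin (euclid_dot xi h)).
Proof.
by move=> x; apply: continuous_comp; [exact: euclid_dot_continuous | exact: continuous_sin].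
Qed.

Lemma RintegrableZl (R : realType) (d : measure_display) (T : measurableType d)
    (mu : {measure set T -> \bar R}) (D : set T) (a : R) (g : T -> R) : measurable D ->
  mu.-integrable D (EFin \o g) -> mu.-integrable D (EFin \o (fun h => a * g h)).
Proof.
move=> mD ig; rewrite (_ : _ \o _ = (fun h => a%:E * (EFin \o g) h)%E) //.
exact: integrableZl.
Qed.

Lemma RintegrableD (R : realType) (d : measure_display) (T : measurableType d)
    (mu : {measure set T -> \bar R}) (D : set T) (f g : T -> R) : measurable D ->
  mu.-integrable D (EFin \o f) -> mu.-integrable D (EFin \o g) ->
  mu.-integrable D (EFin \o (fun h => f h + g h)).
Proof. by move=> mD i1 i2; exact: (integrableD mD i1 i2). Qed.

Lemma RintegrableB (R : realType) (d : measure_display) (T : measurableType d)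
    (mu : {measure set T -> \bar R}) (D : set T) (f g : T -> R) : measurable D ->
  mu.-integrable D (EFin \o f) -> mu.-integrable D (EFin \o g) ->
  mu.-integrable D (EFin \o (fun h => f h - g h)).
Proof. by move=> mD i1 i2; exact: (integrableB mD i1 i2). Qed.

Lemma measurable_bounded_mul_integrable (R : realType) (d : nat)
    (leb : {measure set (Rd R d) -> \bar R}) (f g : Rd R d -> R) (M : R) :
  measurable_fun setT f -> (forall x, `|f x| <= M) ->
  leb.-integrable setT (EFin \o g) -> leb.-integrable setT (EFin \o (fun h => f h * g h)).
Proof.
move=> mf fM ig; have := @integrableMr _ _ _ leb setT measurableT f (EFin \o g) mf _ ig.
apply; exists M; split; first exact: num_real.
by move=> y My x _ /=; exact: le_trans (fM x) (ltW My).
Qed.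

Lemma cos_integrable (R : realType) (d : nat)
    (leb : {measure set (Rd R d) -> \bar R}) (g : Rd R d -> R) (xi : 'rV[R]_d) :
  leb.-integrable setT (EFin \o g) ->
  leb.-integrable setT (EFin \o (fun h : Rd R d => cos (euclid_dot xi h) * g h)).
Proof.
apply: (@measurable_bounded_mul_integrable _ _ _ _ _ 1) => [|x]; last exact: cos_max.
exact: (@continuous_measurable_Rd R d (fun h => cos (euclid_dot xi h)) (@cos_dot_continuous _ _ _)).
Qed.

Lemma sin_integrable (R : realType) (d : nat)
    (leb : {measure set (Rd R d) -> \bar R}) (g : Rd R d -> R) (xi : 'rV[R]_d) :
  leb.-integrable setT (EFin \o g) ->
  leb.-integrable setT (EFin \o (fun h : Rd R d => sin (euclid_dot xi h) * g h)).
Proof.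
apply: (@measurable_bounded_mul_integrable _ _ _ _ _ 1) => [|x]; last exact: sin_max.
exact: (@continuous_measurable_Rd R d (fun h => sin (euclid_dot xi h)) (@sin_dot_continuous _ _ _)).
Qed.

Lemma trig_continuous (R : realType) (d : nat) (m : 'rV[R]_d -> R[i]) s : continuous (evm m s).
Proof.
apply: continuous_sum => c.
have -> : (fun x => Re (m c.2 * c.1 * cis (euclid_dot c.2 x))) = (fun x =>
   Re (m c.2 * c.1) * cos (euclid_dot c.2 x) - Im (m c.2 * c.1) * sin (euclid_dot c.2 x)).
  by apply/funext => y; rewrite ReM.
apply: continuous_sub; apply: continuous_scale.
  exact: cos_dot_continuous.
exact: sin_dot_continuous.
Qed.

Lemma evm_bounded (R : realType) (d : nat) (m : 'rV[R]_d -> R[i]) s :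
  exists2 M, 0 <= M & forall x, `|evm m s x| <= M.
Proof.
exists (\sum_(c <- s) (cn1 (m c.2 * c.1) * 2)).
  by rewrite sumr_ge0 // => c _; rewrite mulr_ge0 // cn1_ge0.
move=> x; apply: (le_trans (ler_norm_sum _ _ _)); apply: ler_sum => c _.
apply: (@le_trans _ _ (cn1 (m c.2 * c.1 * cis (euclid_dot c.2 x)))); first by rewrite lerDl.
apply: (le_trans (cn1M _ _)); rewrite ler_wpM2l ?cn1_ge0 //.
by rewrite /cn1 /= -[2]/(1 + 1) lerD // ?cos_max ?sin_max.
Qed.

Lemma trig_mul_integrable (R : realType) (d : nat)
    (leb : {measure set (Rd R d) -> \bar R}) (g : Rd R d -> R) s x :
  leb.-integrable setT (EFin \o g) ->
  leb.-integrable setT (EFin \o (fun h : Rd R d => trig s (x + h) * g h)).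
Proof.
have [M M0 hM] := evm_bounded (fun=> 1 : R[i]) s.
apply: (@measurable_bounded_mul_integrable _ _ _ _ _ M) => [|y]; last exact: hM.
apply: (@continuous_measurable_Rd R d (fun h => trig s (x + h))) => y.
apply: continuous_comp; last exact: trig_continuous.
by apply: continuousD; [exact: cst_continuous | by move=> U].
Qed.

Lemma evm_hat (R : realType) (d : nat) (leb : {measure set (Rd R d) -> \bar R})
    (g : Rd R d -> R) s x : leb.-integrable setT (EFin \o g) ->
  evm (hat leb g) s x = \int[leb]_h (trig s (x + h) * g h).
Proof.
move=> ig; elim: s => [|c s IH].
  by rewrite /evm big_nil; under eq_Rintegral do rewrite big_nil mul0r;
    rewrite Rintegral_cst // mul0r.
have evm_cons m : evm m (c :: s) =1 fun y => Re (m c.2 * c.1 * cis (euclid_dot c.2 y)) + evm m s y.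
  by move=> y; rewrite /evm big_cons.
rewrite evm_cons IH.
under [RHS]eq_Rintegral do rewrite evm_cons mulrDl.
have ic := cos_integrable c.2 ig; have is_ := sin_integrable c.2 ig.
pose A := Re (c.1 * cis (euclid_dot c.2 x)); pose B := Im (c.1 * cis (euclid_dot c.2 x)).
have E (h : Rd R d) : Re (1 * c.1 * cis (euclid_dot c.2 (x + h))) * g h =
    A * (cos (euclid_dot c.2 h) * g h) - B * (sin (euclid_dot c.2 h) * g h).
  by rewrite /A /B mul1r euclid_dotDr cisD !reimE /=; ring.
have iA : leb.-integrable setT (EFin \o (fun h : Rd R d => A * (cos (euclid_dot c.2 h) * g h))).
  exact: RintegrableZl.
have iB : leb.-integrable setT (EFin \o (fun h : Rd R d => B * (sin (euclid_dot c.2 h) * g h))).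
  exact: RintegrableZl.
rewrite RintegralD //; last 2 first.
- rewrite (_ : _ \o _ = EFin \o (fun h : Rd R d =>
    A * (cos (euclid_dot c.2 h) * g h) - B * (sin (euclid_dot c.2 h) * g h))).
    exact: (integrableB measurableT iA iB).
  by apply/funext => h /=; rewrite E.
- exact: trig_mul_integrable.
congr (_ + _).
under [RHS]eq_Rintegral do rewrite E.
rewrite RintegralB // !RintegralZl //.
by rewrite -mulrA ReM /hat /=; ring.
Qed.

(** By [evm_hat] the multiplier integrates translates against a nonnegative density, so its norm is
    at most the total mass. *)
Lemma mult_le_hat (R : realType) (d : nat) (leb : {measure set (Rd R d) -> \bar R})
    (g : Rd R d -> R) : leb.-integrable setT (EFin \o g) -> (forall h, 0 <= g h) ->
  mult_le (hat leb g) (\int[leb]_h g h).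
Proof.
move=> ig g0 s M sM x; rewrite (evm_hat _ _ ig).
have it := trig_mul_integrable s x ig.
apply: (le_trans (le_normr_Rintegral measurableT it)).
rewrite -RintegralZr //; apply: le_Rintegral => //.
- exact: (integrable_norm it).
- rewrite (_ : _ \o _ = (fun h => M%:E * (EFin \o g) h)%E); first exact: integrableZl.
  by apply/funext => h /=; rewrite mulrC.
- by move=> h _; rewrite normrM (ger0_norm (g0 h)) mulrC ler_wpM2l.
Qed.

Lemma hatD (R : realType) (d : nat) (leb : {measure set (Rd R d) -> \bar R})
    (f g : Rd R d -> R) xi :
  leb.-integrable setT (EFin \o f) -> leb.-integrable setT (EFin \o g) ->
  hat leb (fun h => f h + g h) xi = hat leb f xi + hat leb g xi.
Proof.
move=> i1 i2; apply: complex_ext; rewrite reimE /=.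
  under eq_Rintegral do rewrite mulrDr.
  by rewrite RintegralD //; exact: cos_integrable.
under eq_Rintegral do rewrite mulrDr.
by rewrite RintegralD //; exact: sin_integrable.
Qed.

Lemma hatZ (R : realType) (d : nat) (leb : {measure set (Rd R d) -> \bar R})
    (a : R) (g : Rd R d -> R) xi :
  leb.-integrable setT (EFin \o g) ->
  hat leb (fun h => a * g h) xi = a%:C * hat leb g xi.
Proof.
move=> ig; apply: complex_ext; rewrite reimE /= mul0r ?subr0 ?addr0.
  under eq_Rintegral do rewrite mulrCA.
  by rewrite RintegralZl //; exact: cos_integrable.
under eq_Rintegral do rewrite mulrCA.
by rewrite RintegralZl //; exact: sin_integrable.
Qed.

(** Applied to [z = i xi_i], it presents the symbol of a partial derivative as a limit of difference
    quotients of translations. *)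
Lemma deriv_cexp_ccvg (R : realType) (z : R[i]) :
  ccvg (fun n => n.+1%:R * (cexp (z / n.+1%:R) - 1)) z.
Proof.
apply: ccvg_cn1.
set c := cn1 z; have c0 : 0 <= c := cn1_ge0 z.
apply: (@squeeze_cvgr _ _ _ _ (fun=> 0) (fun n => (5 * c ^+ 2) * n.+1%:R^-1)); last 2 first.
- exact: cvg_cst.
- rewrite -[X in _ --> X](mulr0 (5 * c ^+ 2)).
  by apply: cvgM; [exact: cvg_cst|exact: cvg_harmonic].
apply: filterS (euler_near (2 * c)) => n nc; rewrite cn1_ge0 /=.
have n0 : (0 : R) < n.+1%:R by rewrite ltr0n.
have cz : cn1 (z / n.+1%:R) = c / n.+1%:R by exact: cn1_natdiv.
have chalf : c / n.+1%:R <= 2^-1 by rewrite ler_pdivrMr //; lra.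
have -> : n.+1%:R * (cexp (z / n.+1%:R) - 1) - z =
   (n.+1%:R : R)%:C * (cexp (z / n.+1%:R) - 1 - z / n.+1%:R).
  by rewrite rmorph_nat; field; rewrite nat1r pnatr_eq0.
apply: (le_trans (cn1M _ _)).
have -> : cn1 (n.+1%:R : R)%:C = n.+1%:R by rewrite /cn1 /= normr0 addr0 ger0_norm.
apply: (@le_trans _ _ (n.+1%:R * (5 * (c / n.+1%:R) ^+ 2))).
  by rewrite ler_wpM2l // -cz; apply: cexp_sub_affine_le; rewrite cz.
by apply: le_of_eq; rewrite expr_div_n; field; rewrite nat1r pnatr_eq0.
Qed.

Lemma indic_integrable (R : realType) (d : nat) (leb : {measure set (Rd R d) -> \bar R})
    (A : set (Rd R d)) : measurable A -> (leb A < +oo)%E ->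
  leb.-integrable setT (EFin \o (\1_A : Rd R d -> R)).
Proof.
move=> mA lA; apply/integrableP; split.
  by apply/measurable_EFinP; exact: measurable_indic.
under eq_integral do rewrite /= ger0_norm //.
by rewrite integral_indic // setIT.
Qed.

Lemma Rintegral_indic (R : realType) (d : nat) (leb : {measure set (Rd R d) -> \bar R})
    (A : set (Rd R d)) : measurable A -> \int[leb]_h (\1_A h : R) = fine (leb A).
Proof. by move=> mA; rewrite /Rintegral integral_indic // setIT. Qed.

Lemma Rintegral_translate (R : realType) (d : nat)
    (leb : {measure set (Rd R d) -> \bar R}) (hleb : is_lebesgue_Rd leb) (v : 'rV[R]_d)
    (G : Rd R d -> R) : measurable_fun setT G ->
  leb.-integrable setT (EFin \o (fun h : Rd R d => G ((h : 'rV[R]_d) + v))) ->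
  \int[leb]_h G h = \int[leb]_h G ((h : 'rV[R]_d) + v).
Proof.
move=> mG iG; rewrite /Rintegral; congr fine.
have mt : measurable_fun setT ((fun h => h + v) : Rd R d -> Rd R d).
  by apply: continuous_Rd_measurable; exact: translate_continuous.
rewrite -(@integral_pushforward _ _ _ _ R _ mt leb setT (EFin \o G)) //.
- by apply: eq_measure_integral => A mA _; apply/esym; exact: lebesgue_Rd_translate.
- by apply/measurable_EFinP.
Qed.

Lemma lebesgue_box (R : realType) (d : nat)
    (leb : {measure set (Rd R d) -> \bar R}) (hleb : is_lebesgue_Rd leb) (a b : 'rV[R]_d) :
  (forall i, a ord0 i <= b ord0 i) ->
  fine (leb (box a b)) = \prod_(i < d) (b ord0 i - a ord0 i).
Proof. by move=> ab; have -> := hleb a b ab. Qed.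

Lemma lebesgue_box_lty (R : realType) (d : nat)
    (leb : {measure set (Rd R d) -> \bar R}) (hleb : is_lebesgue_Rd leb) (a b : 'rV[R]_d) :
  (leb (box a b) < +oo)%E.
Proof.
have [ab|/existsNP[i /negP]] := pselect (forall i, a ord0 i <= b ord0 i).
  by rewrite (hleb a b ab) ltry.
by rewrite -ltNge => ba; rewrite (box_empty ba) measure0.
Qed.

(** Translating the polynomial amounts to translating the box. The indicators of the box and of its
    shift by [eta] in direction [i] differ only inside two slabs of thickness [eta], whose volumes
    give the bound. *)
Lemma mult_le_shift_box (R : realType) (d : nat)
    (leb : {measure set (Rd R d) -> \bar R}) (hleb : is_lebesgue_Rd leb) (a b : 'rV[R]_d)
    (i : 'I_d) (eta : R) : (forall j, a ord0 j <= b ord0 j) -> 0 < eta ->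
  mult_le (fun xi => (cis (eta * xi ord0 i) - 1) * hat leb \1_(box a b) xi)
    (2 * eta * \prod_(j < d | j != i) (b ord0 j - a ord0 j)).
Proof.
move=> ab eta0 s M sM x.
pose v : 'rV[R]_d := eta *: unitv i.
have dv xi : euclid_dot xi v = eta * xi ord0 i.
  rewrite /euclid_dot (bigD1 i) //= big1 => [|j ji].
    by rewrite /v !mxE !eqxx /= mulr1 addr0 mulrC.
  by rewrite /v !mxE eqxx (negbTE ji) /= !mulr0.
(* [B1] is the slab left behind at the face [a_i], [B2] the slab gained beyond the face [b_i]; they
   cover the symmetric difference even if [eta] exceeds the side. *)
pose B1 : set (Rd R d) := box a (\row_j if j == i then a ord0 i + eta else b ord0 j).
pose B2 : set (Rd R d) := box (\row_j if j == i then b ord0 i else a ord0 j)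
  (\row_j if j == i then b ord0 i + eta else b ord0 j).
have iQ := indic_integrable (measurable_box a b) (lebesgue_box_lty hleb a b).
have iQv := indic_integrable (measurable_box (a + v) (b + v)) (lebesgue_box_lty hleb (a + v) (b + v)).
have iB1 : leb.-integrable setT (EFin \o (\1_B1 : Rd R d -> R)).
  by apply: indic_integrable; [exact: measurable_box | exact: lebesgue_box_lty].
have iB2 : leb.-integrable setT (EFin \o (\1_B2 : Rd R d -> R)).
  by apply: indic_integrable; [exact: measurable_box | exact: lebesgue_box_lty].
have shift (h : Rd R d) : \1_(box (a + v) (b + v)) (h + v) = \1_(box a b) h :> R.
  rewrite !indicE; congr (_%:R); congr nat_of_bool.
  by apply/idP/idP; rewrite !inE => H j; have := H j; rewrite !mxE ltrD2r lerD2r.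
have -> : evm (fun xi => (cis (eta * xi ord0 i) - 1) * hat leb \1_(box a b) xi) s x =
   \int[leb]_h (trig s (x + h) * \1_(box (a + v) (b + v)) h)
   - \int[leb]_h (trig s (x + h) * \1_(box a b) h).
  have -> : evm (fun xi => (cis (eta * xi ord0 i) - 1) * hat leb \1_(box a b) xi) s x =
     evm (fun xi => hat leb \1_(box a b) xi * cis (euclid_dot xi v)) s x
     + evm (fun xi => (-1 : R)%:C * hat leb \1_(box a b) xi) s x.
    by rewrite -evmD; apply: evm_eq => xi; rewrite dv rmorphN1; ring.
  rewrite evmZ evm_cis !(evm_hat _ _ iQ) mulN1r; congr (_ - _).
  rewrite (@Rintegral_translate _ _ _ hleb v (fun h => trig s (x + h) * \1_(box (a + v) (b + v)) h)).
  - by apply: eq_Rintegral => h _; rewrite shift addrAC addrA.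
  - have /integrableP[/measurable_EFinP] := trig_mul_integrable s x iQv; exact.
  - rewrite (_ : _ \o _ = EFin \o (fun h : Rd R d => trig s (x + v + h) * \1_(box a b) h)).
      exact: trig_mul_integrable.
    by apply/funext => h /=; rewrite shift addrAC addrA.
rewrite -RintegralB //; try exact: trig_mul_integrable.
have iD : leb.-integrable setT (EFin \o (fun h : Rd R d =>
    trig s (x + h) * \1_(box (a + v) (b + v)) h - trig s (x + h) * \1_(box a b) h)).
  by apply: RintegrableB => //; exact: trig_mul_integrable.
apply: (le_trans (le_normr_Rintegral measurableT iD)).
apply: (@le_trans _ _ (\int[leb]_h (M * (\1_B1 h + \1_B2 h)))).
  apply: le_Rintegral => //.
  - exact: (integrable_norm iD).
  - by apply: RintegrableZl => //; exact: RintegrableD.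
  move=> h _; rewrite -mulrBr normrM ler_pM //.
  rewrite !indicE.
  have [hv|hv] := boolP (h \in box (a + v) (b + v));
  have [hq|hq] := boolP (h \in box a b); rewrite ?subrr ?normr0 ?addr_ge0 //=.
  - have : h \in B2; last by move=> ->; rewrite subr0 normr1 lerDr ler0n.
    rewrite inE in hv; move: hq; rewrite notin_setE => hq; rewrite inE => j; rewrite !mxE.
    have H j' : j' != i -> a ord0 j' < (h : 'rV[R]_d) ord0 j' <= b ord0 j'.
      by move=> ji; have := hv j'; rewrite !mxE eqxx (negbTE ji) /= mulr0 !addr0.
    case: eqVneq => [->|ji]; last exact: H.
    have := hv i; rewrite !mxE !eqxx /= mulr1 => /andP[h1 ->]; rewrite andbT ltNge.
    apply/negP => h2; apply: hq => j'; case: (eqVneq j' i) => [->|]; last exact: H.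
    by rewrite h2 andbT (lt_trans _ h1) // ltrDl.
  - have : h \in B1; last by move=> ->; rewrite sub0r normrN normr1 lerDl ler0n.
    rewrite inE in hq; move: hv; rewrite notin_setE => hv; rewrite inE => j; rewrite !mxE.
    case: eqVneq => [->|ji]; last exact: hq.
    have /andP[h1 h2] := hq i; rewrite h1 /= leNgt.
    apply/negP => h3; apply: hv => j'; rewrite !mxE eqxx /=; case: (eqVneq j' i) => [->|].
      by rewrite /= mulr1 h3 (le_trans h2) // lerDl ltW.
    by move=> _; rewrite mulr0 !addr0; exact: hq.
rewrite RintegralZl //; last exact: RintegrableD.
rewrite RintegralD // !Rintegral_indic; [|exact: measurable_box..].
have E1 : fine (leb B1) = eta * \prod_(j < d | j != i) (b ord0 j - a ord0 j).
  rewrite /B1 (lebesgue_box hleb).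
    rewrite (bigD1 i) //= mxE eqxx addrAC subrr add0r; congr (_ * _).
    by apply: eq_bigr => j ji; rewrite mxE (negbTE ji).
  by move=> j; rewrite mxE; case: eqVneq => [->|_] //; rewrite lerDl ltW.
have E2 : fine (leb B2) = eta * \prod_(j < d | j != i) (b ord0 j - a ord0 j).
  rewrite /B2 (lebesgue_box hleb).
    rewrite (bigD1 i) //= !mxE eqxx addrAC subrr add0r; congr (_ * _).
    by apply: eq_bigr => j ji; rewrite !mxE (negbTE ji).
  by move=> j; rewrite !mxE; case: eqVneq => [_|_] //; rewrite lerDl ltW.
rewrite E1 E2.
by apply: le_of_eq; ring.
Qed.

(** Divided by [eta = 1 / n.+1], the slab bound no longer depends on [n]. What remains is the area
    of the two faces orthogonal to direction [i], the total variation of the indicator in that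
    direction. *)
Lemma mult_le_deriv_box (R : realType) (d : nat)
    (leb : {measure set (Rd R d) -> \bar R}) (hleb : is_lebesgue_Rd leb) (a b : 'rV[R]_d)
    (i : 'I_d) : (forall j, a ord0 j <= b ord0 j) ->
  mult_le (fun xi => 'i * (xi ord0 i)%:C * hat leb \1_(box a b) xi)
    (2 * \prod_(j < d | j != i) (b ord0 j - a ord0 j)).
Proof.
move=> ab; apply: (@mult_le_cvg _ _ (fun n xi =>
  n.+1%:R * (cexp ('i * (xi ord0 i)%:C / n.+1%:R) - 1) * hat leb \1_(box a b) xi)).
  apply: nearW => n.
  have n0 : (0 : R) < n.+1%:R^-1 by rewrite invr_gt0 ltr0n.
  have := mult_leZ n.+1%:R (mult_le_shift_box hleb i ab n0).
  rewrite ger0_norm // [X in mult_le _ X](_ : _ = 2 * \prod_(j < d | j != i) (b ord0 j - a ord0 j)).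
    apply: mult_le_eq => xi; rewrite mulrA rmorph_nat; congr (_ * (_ - 1) * _).
    rewrite /cexp (_ : 'i * _ / _ = (0 : R) +i* (n.+1%:R^-1 * xi ord0 i)) ?expR0 ?mul1r //.
    have -> : (n.+1%:R : R[i])^-1 = (n.+1%:R^-1)%:C by rewrite fmorphV rmorph_nat.
    by apply: complex_ext; rewrite !reimE /=; ring.
  by field; rewrite nat1r pnatr_eq0.
move=> xi; apply: ccvgM; last exact: ccvg_cst.
exact: deriv_cexp_ccvg.
Qed.

(** * Smoothing by the first jump *)

Lemma hat0 (R : realType) (d : nat) (leb : {measure set (Rd R d) -> \bar R}) xi :
  hat leb (cst 0) xi = 0.
Proof.
by apply: complex_ext => /=; under eq_Rintegral do rewrite /= mulr0;
  rewrite Rintegral_cst // mul0r.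
Qed.

Section jump_decomposition.
Context (R : realType) (d : nat) (leb : {measure set (Rd R d) -> \bar R})
  (hleb : is_lebesgue_Rd leb).
Variables (rho q : nat -> R).
Hypothesis rho_gt0 : forall j, 0 < rho j.
Hypothesis q_ge0 : forall j, 0 <= q j.

(** Placed off the origin, so that norms of its points are comparable to [r] and cubes at different
    dyadic scales are disjoint. *)
Definition cube (r : R) : set (Rd R d) := box (const_mx r) (const_mx (2 * r)).

(** [lam j] is the intensity of jumps landing in the [j]-th cube, and [N j - lam j] is the symbol of
    the compound Poisson process formed by them. *)
Let lam j := q j * rho j ^+ d.
Let N j (xi : 'rV[R]_d) : R[i] := (q j)%:C * hat leb \1_(cube (rho j)) xi.

Let lam_ge0 j : 0 <= lam j.
Proof. by rewrite mulr_ge0 // exprn_ge0 // ltW. Qed.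

Lemma cube_integrable r : leb.-integrable setT (EFin \o (\1_(cube r) : Rd R d -> R)).
Proof. by apply: indic_integrable; [exact: measurable_box | exact: lebesgue_box_lty]. Qed.

Lemma lebesgue_cube r : 0 < r -> fine (leb (cube r)) = r ^+ d.
Proof.
move=> r0; rewrite /cube lebesgue_box // => [|i]; last by rewrite !mxE mulr_natl mulr2n lerDl ltW.
by under eq_bigr do rewrite !mxE mulr_natl mulr2n addrK; rewrite prodr_const card_ord.
Qed.

Let mult_N j : mult_le (N j) (lam j).
Proof.
have := mult_leZ (q j) (mult_le_hat (cube_integrable (rho j)) (fun h => ler0n _ _)).
by rewrite Rintegral_indic ?lebesgue_cube ?ger0_norm //; exact: measurable_box.
Qed.

(** The two faces have total area [2 rho^(d-1)], which is [2 / rho] times the volume of the cube. *)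
Let mult_DN i j : mult_le (fun xi => 'i * (xi ord0 i)%:C * N j xi) (lam j * (2 / rho j)).
Proof.
have h0 k : (const_mx (rho j) : 'rV[R]_d) ord0 k <= (const_mx (2 * rho j) : 'rV[R]_d) ord0 k.
  by rewrite !mxE mulr_natl mulr2n lerDl ltW.
have := mult_leZ (q j) (mult_le_deriv_box hleb i h0).
rewrite [X in mult_le _ X](_ : _ = lam j * (2 / rho j)).
  by apply: mult_le_eq => xi; rewrite /N; ring.
rewrite ger0_norm // /lam.
under eq_bigr do rewrite !mxE [2 * _]mulr_natl mulr2n addrK.
rewrite prodr_const (_ : #|_| = d.-1); last by rewrite cardC1 card_ord.
have : (0 < d)%N by case: d i => // -[].
move=> d0; rewrite -[in RHS](prednK d0) exprS; field.
by rewrite gt_eqF.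
Qed.

Let E j xi := cexp (N j xi - (lam j)%:C).

(* The probability of no jump at any of the scales [rho 0, ..., rho (n - 1)]. *)
Definition nojump n := \prod_(j < n) expR (- lam j).

Lemma nojumpS n : nojump n.+1 = nojump n * expR (- lam n).
Proof. by rewrite /nojump big_ord_recr. Qed.

Lemma nojump_ge0 n : 0 <= nojump n.
Proof. by rewrite prodr_ge0 // => i _; exact: expR_ge0. Qed.

(* Conditioning on the first scale [j] at which a jump occurs: the jumps of the coarser scales
   are absent with probability [nojump j], and one jump uniform on the cube of side [rho j]
   smooths a derivative at cost [2 / rho j]. *)
Let mult_first_jump i n :
  mult_le (fun xi => 'i * (xi ord0 i)%:C * (\prod_(j < n) E j xi - (nojump n)%:C))
    (\sum_(j < n) nojump j * (2 / rho j)).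
Proof.
elim: n => [|n IH].
  move=> s M _ x; rewrite big_ord0 mul0r /evm big1 ?normr0 // => c _.
  by rewrite /nojump !big_ord0 rmorph1 subrr mulr0 !mul0r.
(* With [P] the product up to [n] and [p] its no-jump part, [P E - p e = (P - p) E + p (E - e)],
   where [e = exp (- lam n)]. The first term is the induction hypothesis composed with a
   contraction; in the second the first jump occurs at scale [n]. *)
have h1 := mult_leM IH (mult_le_cexp (mult_N n) (lam_ge0 n)).
have h2 := mult_leZ (nojump n) (mult_le_cexp_jump (mult_N n) (lam_ge0 n) (a := 2 / rho n)
  (D := fun xi => 'i * (xi ord0 i)%:C) _ (mult_DN i n)).
have {}h2 := h2 (divr_ge0 (ler0n _ 2) (ltW (rho_gt0 n))).
have := mult_leD h1 h2.
rewrite mulr1 (ger0_norm (nojump_ge0 n)) big_ord_recr; apply: mult_le_eq => xi.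
have e : (nojump n.+1)%:C = (nojump n)%:C * (expR (- lam n))%:C by rewrite nojumpS rmorphM.
rewrite e big_ord_recr /= -/(E n xi).
by set P := \prod_(j < n) E j xi; ring.
Qed.

(** The density splits as [g = r + f J], with [f J] the part carried by the cubes and [r >= 0], so
    the exponential factors. The drift and the [r] part form a contraction [W]. The cube part is
    smoothed by its first jump, except on the no-jump event, where only the gradient bound [M'] of
    the polynomial is available. *)
Lemma first_jump_bound (i : 'I_d) (J : nat) (g : Rd R d -> R) (b : 'rV[R]_d) s (M M' : R) :
  leb.-integrable setT (EFin \o g) ->
  (forall h, \sum_(j < J) q j * \1_(cube (rho j)) h <= g h) ->
  (forall x, `|trig s x| <= M) ->
  (forall x, `|evm (fun xi => 'i * (xi ord0 i)%:C) s x| <= M') ->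
  forall x, `|evm (fun xi => 'i * (xi ord0 i)%:C *
      (cis (euclid_dot xi b) * cexp (hat leb g xi - (\int[leb]_h g h)%:C))) s x|
    <= (\sum_(j < J) nojump j * (2 / rho j)) * M + nojump J * M'.
Proof.
move=> ig qg sM sM' x.
pose f n (h : Rd R d) := \sum_(j < n) q j * \1_(cube (rho j)) h.
have fS n h : f n.+1 h = f n h + q n * \1_(cube (rho n)) h by rewrite /f big_ord_recr.
have iq j : leb.-integrable setT (EFin \o (fun h => q j * \1_(cube (rho j)) h)).
  by apply: RintegrableZl => //; exact: cube_integrable.
have f_int n : leb.-integrable setT (EFin \o f n).
  elim: n => [|n IH].
    rewrite (_ : _ \o _ = cst 0%E); first exact: integrable0.
    by apply/funext => h; rewrite /f /= big_ord0.
  by rewrite (funext (fS n)); apply: RintegrableD.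
have hat_f n xi : cexp (hat leb (f n) xi - (\int[leb]_h f n h)%:C) = \prod_(j < n) E j xi.
  elim: n => [|n IH].
    have -> : f 0 = cst 0 by apply/funext => h; rewrite /f big_ord0.
    by rewrite hat0 Rintegral_cst // mul0r subrr cexp0 big_ord0.
  rewrite (funext (fS n)) hatD // hatZ ?RintegralD //; last exact: cube_integrable.
  rewrite RintegralZl //; last exact: cube_integrable.
  rewrite Rintegral_indic ?lebesgue_cube //; last exact: measurable_box.
  rewrite big_ord_recr /= -IH /E -cexpD; congr cexp.
  by rewrite rmorphD /= /N /lam; ring.
pose r h := g h - f J h.
have ir : leb.-integrable setT (EFin \o r) by exact: RintegrableB.
have r0 h : 0 <= r h by rewrite subr_ge0; exact: qg.
have gE : g = (fun h => r h + f J h) by apply/funext => h; rewrite /r subrK.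
have Wle : mult_le (fun xi => cis (euclid_dot xi b) * cexp (hat leb r xi - (\int[leb]_h r h)%:C)) 1.
  rewrite -[1]mulr1; apply: mult_leM; first exact: mult_le_cis.
  by apply: mult_le_cexp; [exact: mult_le_hat | exact: Rintegral_ge0].
set W := (fun xi : 'rV[R]_d => _) in Wle.
rewrite (@evm_eq _ _ _ (fun xi =>
    W xi * ('i * (xi ord0 i)%:C * (\prod_(j < J) E j xi - (nojump J)%:C))
    + (nojump J)%:C * (W xi * ('i * (xi ord0 i)%:C)))); last first.
  move=> xi; rewrite gE hatD // RintegralD // /W -hat_f.
  have -> : hat leb r xi + hat leb (f J) xi - (\int[leb]_h r h + \int[leb]_h f J h)%:C =
    (hat leb r xi - (\int[leb]_h r h)%:C) + (hat leb (f J) xi - (\int[leb]_h f J h)%:C).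
    by rewrite rmorphD /=; ring.
  by rewrite cexpD; ring.
rewrite evmD evmZ; apply: (le_trans (ler_normD _ _)); apply: lerD.
  have := mult_leM Wle (mult_first_jump i J); rewrite mul1r; exact.
rewrite normrM (ger0_norm (nojump_ge0 J)) ler_wpM2l ?nojump_ge0 //.
rewrite -evm_comp -[M']mul1r; apply: Wle => y.
by rewrite (evm_trig (fun xi => 'i * (xi ord0 i)%:C)); exact: sM'.
Qed.

End jump_decomposition.

(** * Scaling of the order function *)

Section order_function.
Context (R : realType) (phi : R -> R) (d1 a1 : R).
Hypothesis phi_gt0 : forall r : R, 0 < r -> 0 < phi r.
Hypothesis phi_cont : forall r : R, 0 < r -> {for r, continuous phi}.
Hypothesis phi1 : phi 1 = 1.
Hypothesis d1_gt0 : 0 < d1.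
Hypothesis a1_gt0 : 0 < a1.
Hypothesis a1_le1 : a1 <= 1.
Hypothesis phi_lower : forall lam r : R, 1 <= lam -> 0 < r ->
  a1 * lam `^ (2 * d1) * phi r <= phi (lam * r).

(** [inv_order] returns the default 0 when no preimage exists, so existence has to be shown: lower
    scaling from [phi 1 = 1] forces large and small values of [phi], and the intermediate value
    theorem does the rest. *)
Lemma inv_orderP (t : R) : 0 < t -> 0 < inv_order phi t /\ phi (inv_order phi t) = t.
Proof.
move=> t0; apply: (@xgetPex _ 0 [set r | 0 < r /\ phi r = t]) => /=.
(* Chosen so that [a1 * lam^(2 d1) = max(t, 1/t)]. Scaling from 1 to [lam] then gives
   [phi lam >= t], and scaling from [1/lam] to 1 gives [phi (1/lam) <= t]. *)
pose y := Num.max t t^-1 / a1.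
have m1 : 1 <= Num.max t t^-1.
  rewrite le_max; case: (leP 1 t) => //= t1.
  by rewrite invf_ge1 // ltW.
have y1 : 1 <= y by rewrite ler_pdivlMr // mul1r (le_trans a1_le1).
have y0 : 0 < y := lt_le_trans ltr01 y1.
pose lam := y `^ (2 * d1)^-1.
have dd0 : 0 < 2 * d1 by rewrite mulr_gt0.
have lam1 : 1 <= lam by rewrite -(powRr0 y) ler_powR // invr_ge0 ltW.
have lam0 : 0 < lam := lt_le_trans ltr01 lam1.
have lamE : lam `^ (2 * d1) = y.
  by rewrite -powRrM mulVf ?gt_eqF // powRr1 // ltW.
have hi : t <= phi lam.
  have := phi_lower lam1 ltr01; rewrite mulr1 phi1 mulr1 lamE mulrC divfK ?gt_eqF //.
  by apply: le_trans; rewrite le_max lexx.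
have lo : phi lam^-1 <= t.
  have il0 : 0 < lam^-1 by rewrite invr_gt0.
  have := phi_lower lam1 il0; rewrite mulfV ?gt_eqF // phi1 lamE [a1 * y]mulrC divfK ?gt_eqF //.
  move=> h; have h2 : t^-1 * phi lam^-1 <= 1.
    apply: le_trans h; rewrite ler_pM2r ?phi_gt0 //.
    by rewrite le_max lexx orbT.
  by rewrite -(ler_pM2l (x := t^-1)) ?invr_gt0 // mulVf ?gt_eqF.
have ll : lam^-1 <= lam by rewrite (le_trans _ lam1) // invf_le1.
have il0 : 0 < lam^-1 by rewrite invr_gt0.
have ct : {within `[lam^-1, lam], continuous phi}.
  apply: continuous_in_subspaceT => x; rewrite inE /= in_itv /= => /andP[h _].
  by apply: phi_cont; exact: lt_le_trans h.
have [|c] := IVT ll ct (v := t); first by rewrite ge_min lo le_max hi orbT.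
by rewrite in_itv /= => /andP[h _] e; exists c; split => //; exact: lt_le_trans h.
Qed.

(** Up to the constant [a1], each halving of the argument multiplies [1 / phi] by at least this
    factor; it is the [beta] that drives the jump intensities. *)
Definition growth := 2 `^ (2 * d1) : R.

Lemma growth_gt1 : 1 < growth.
Proof. by rewrite /growth /powR pnatr_eq0 expR_gt1 !mulr_gt0 // ln_gt0 // ltr1n. Qed.

Lemma powR_dyadic (a : R) j : (2 ^+ j : R) `^ a = (2 `^ a) ^+ j.
Proof.
by rewrite -!powR_mulrn ?powR_ge0 // -!powRrM mulrC.
Qed.

Lemma phi_dyadic r j : 0 < r -> a1 * growth ^+ j * phi (r / 2 ^+ j) <= phi r.
Proof.
move=> r0; have p0 : (0 : R) < 2 ^+ j by rewrite exprn_gt0.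
have := phi_lower (lam := 2 ^+ j) (exprn_ege1 _ _) (divr_gt0 r0 p0).
by rewrite powR_dyadic mulrCA mulfV ?gt_eqF // mulr1; apply; rewrite ler1n.
Qed.
End order_function.

(** * Summing the smoothing costs over dyadic scales *)

Section dyadic_sum.
Context (R : realType) (c beta : R).
Hypothesis c_gt0 : 0 < c.
Hypothesis beta_gt1 : 1 < beta.

(** Bernoulli's inequality in the form [n (beta - 1) <= beta^n]. *)
Lemma exists_pow_ge (x : R) : exists N, x <= beta ^+ N.
Proof.
exists (Num.truncn (x / (beta - 1))).+1.
have b0 : 0 < beta - 1 by rewrite subr_gt0.
have : x / (beta - 1) < (Num.truncn (x / (beta - 1))).+1%:R by exact: truncnS_gt.
set n := (Num.truncn _).+1; rewrite ltr_pdivrMr // => h.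
apply: le_trans (ltW h) _.
elim: n {h} => [|n IH]; first by rewrite mul0r expr0.
rewrite exprS -natr1 mulrDl mul1r.
have : 1 <= beta ^+ n by rewrite exprn_ege1 // ltW.
move=> p1; have -> : beta * beta ^+ n = beta ^+ n + (beta - 1) * beta ^+ n by ring.
by apply: lerD => //; rewrite ler_peMr // ltW.
Qed.

Lemma pow_le_expR (x : R) N : 0 <= x -> x ^+ N.+1 / N.+1%:R ^+ N.+1 <= expR x.
Proof.
move=> x0; rewrite -expr_div_n.
have {2}-> : x = N.+1%:R * (x / N.+1%:R) by rewrite mulrC divfK // pnatr_eq0.
rewrite expRM_natl lerXn2r ?nnegrE ?divr_ge0 ?expR_ge0 //.
by apply: le_trans (expR_ge1Dx _); rewrite lerDr.
Qed.

(* The no-jump probabilities decay superexponentially in the scale, so they beat the cost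
   [2 ^ j] of differentiating at scale [j]. *)
Lemma nojump_sum_bound : exists2 K, 0 < K & forall p : nat -> R,
  p 0%N = 1 -> (forall n, 0 <= p n) ->
  (forall n, p n.+1 <= expR (- (c * beta ^+ n))) ->
  (forall n, \sum_(j < n) p j * 2 ^+ j <= K) /\ (forall n, p n.+1 <= K * (4^-1) ^+ n).
Proof.
(* With [beta^(N+1) >= 4], the bound [exp x >= (x / (N+1))^(N+1)] at [x = c beta^n] gives decay
   [4^-n], which still leaves [2^-n] after paying [2^n]. *)
have [N hN] : exists N, 4 <= beta ^+ N.+1.
  have [N hN] := exists_pow_ge 4; exists N; apply: (le_trans hN).
  by rewrite exprS ler_peMl ?exprn_ge0 // ltW // (lt_trans ltr01).
pose nN : R := N.+1%:R ^+ N.+1.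
have nN0 : 0 < nN by rewrite exprn_gt0 // ltr0n.
pose K0 := nN / c ^+ N.+1.
have K0_gt0 : 0 < K0 by rewrite divr_gt0 ?exprn_gt0.
have key n : expR (- (c * beta ^+ n)) <= K0 * (4^-1) ^+ n.
  have b0 : 0 < beta ^+ n by rewrite exprn_gt0 // (lt_trans ltr01).
  have x0 : 0 < c * beta ^+ n by rewrite mulr_gt0.
  have := pow_le_expR N (ltW x0); rewrite -/nN exprMn => h.
  rewrite expRN -[leRHS]invrK lef_pV2 ?posrE ?expR_gt0 ?invr_gt0 ?mulr_gt0 ?exprn_gt0 ?invr_gt0 ?exprn_gt0 //.
  apply: le_trans h.
  rewrite /K0 invfM invf_div exprVn invrK.
  have -> : c ^+ N.+1 * beta ^+ n ^+ N.+1 / nN = c ^+ N.+1 / nN * beta ^+ n ^+ N.+1 by ring.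
  rewrite ler_wpM2l //; first by rewrite divr_ge0 ?exprn_ge0 // ltW.
  by rewrite -exprM mulnC exprM lerXn2r // ?nnegrE ?exprn_ge0 // (le_trans ler01) // ltW.
exists (1 + 4 * K0) => [|p p0 pge pS]; first by rewrite ltr_wpDr // mulr_ge0 // ltW.
have pS' n : p n.+1 <= K0 * (4^-1) ^+ n := le_trans (pS n) (key n).
split=> n; last first.
  apply: (le_trans (pS' n)); rewrite ler_wpM2r ?exprn_ge0 //.
  by move: K0_gt0; lra.
case: n => [|n]; first by rewrite big_ord0 addr_ge0 // mulr_ge0 // ltW.
(* The strengthened bound makes the induction close exactly: the new term is at most [2 K0 2^-n],
   the increment of [4 K0 (1 - 2^-n)]. *)
suff : \sum_(j < n.+1) p j * 2 ^+ j <= 1 + 4 * K0 * (1 - (2^-1) ^+ n).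
  move/le_trans; apply; rewrite lerD2l; apply: ler_piMr; first by rewrite mulr_ge0 // ltW.
  by rewrite gerBl exprn_ge0.
elim: n => [|n IH].
  by rewrite big_ord1 p0 !expr0 mulr1 subrr mulr0 addr0.
rewrite big_ord_recr /=.
apply: (le_trans (lerD IH (ler_wpM2r (exprn_ge0 _ _) (pS' n)))) => //.
have -> : K0 * 4^-1 ^+ n * 2 ^+ n.+1 = 2 * K0 * 2^-1 ^+ n.
  have -> : (4^-1 : R) = 2^-1 * 2^-1 by lra.
  rewrite exprMn exprS.
  have -> : K0 * (2^-1 ^+ n * 2^-1 ^+ n) * (2 * 2 ^+ n) = 2 * K0 * 2^-1 ^+ n * ((2^-1 * 2) ^+ n).
    by rewrite exprMn; ring.
  by rewrite mulVf // expr1n mulr1.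
rewrite !exprS; have : 0 <= (2^-1 : R) ^+ n by rewrite exprn_ge0.
by move: (2^-1 ^+ n) => y y0; apply: le_of_eq; field.
Qed.
End dyadic_sum.

(** * The Euclidean norm and a dyadic integrability criterion *)

Lemma euclid_norm_ge0 (R : realType) (d : nat) (h : 'rV[R]_d) : 0 <= euclid_norm h.
Proof. exact: sqrtr_ge0. Qed.

Lemma coord_le_euclid_norm (R : realType) (d : nat) (h : 'rV[R]_d) i :
  `|h ord0 i| <= euclid_norm h.
Proof.
rewrite -sqrtr_sqr ler_wsqrtr // /euclid_dot (bigD1 i) //= -expr2 lerDl.
by rewrite sumr_ge0 // => j _; rewrite -expr2 sqr_ge0.
Qed.

Lemma euclid_norm_gt0 (R : realType) (d : nat) (h : 'rV[R]_d) : h != 0 -> 0 < euclid_norm h.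
Proof.
move=> h0; have [i hi] : exists i, h ord0 i != 0.
  apply/existsP; apply: contraR h0 => /existsPn H; apply/eqP/rowP => i.
  by rewrite mxE; apply/eqP; rewrite -[_ == _]negbK H.
by apply: lt_le_trans (coord_le_euclid_norm h i); rewrite normr_gt0.
Qed.

Lemma euclid_norm_le (R : realType) (d : nat) (h : 'rV[R]_d) (r : R) :
  (0 < d)%N -> 0 <= r -> (forall i, `|h ord0 i| <= r) -> euclid_norm h <= d%:R * r.
Proof.
move=> d0 r0 hr.
have dr0 : 0 <= d%:R * r by rewrite mulr_ge0.
rewrite -(ger0_norm dr0) -sqrtr_sqr ler_wsqrtr //.
apply: (@le_trans _ _ (\sum_(i < d) r ^+ 2)).
  by apply: ler_sum => i _; rewrite -expr2 -real_normK ?num_real // lerXn2r ?nnegrE.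
rewrite sumr_const card_ord -[_ *+ d]mulr_natl exprMn ler_wpM2r ?sqr_ge0 //.
by rewrite expr2 ler_peMr // ler1n.
Qed.

Lemma euclid_norm_continuous (R : realType) (d : nat) :
  continuous (@euclid_norm R d).
Proof.
move=> x; apply: (@continuous_comp _ _ _ (fun h : 'rV[R]_d => euclid_dot h h) Num.sqrt);
  last exact: sqrt_continuous.
apply: continuous_sum => i y; apply: continuousM; exact: coord_continuous.
Qed.

Lemma continuous_on_measurable_Rd (R : realType) (d : nat) (D : set 'rV[R]_d)
    (f : 'rV[R]_d -> R) : open D -> (forall x, D x -> {for x, continuous f}) ->
  measurable_fun (D : set (Rd R d)) (f : Rd R d -> R).
Proof.
move=> oD cf; apply: (measurability _ (RGenOpens.measurableE R)).
move=> _ [_ [a [b ->] <-]]; apply: open_measurable_Rd.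
rewrite openE => x [Dx fx]; rewrite /interior.
apply: filterI; first exact: open_nbhs_nbhs.
apply: (cf x Dx); apply: open_nbhs_nbhs; split => //; exact: interval_open.
Qed.

Lemma open_nonzero (R : realType) (d : nat) : open [set h : 'rV[R]_d | h != 0].
Proof.
have -> : [set h : 'rV[R]_d | h != 0] = euclid_norm @^-1` [set x | 0 < x].
  apply/seteqP; split => x /=; first exact: euclid_norm_gt0.
  apply: contraTN => /eqP ->; rewrite /euclid_norm /euclid_dot big1 ?sqrtr0 ?ltxx // => i _.
  by rewrite mxE mul0r.
have /continuousP := @euclid_norm_continuous R d; apply; exact: open_gt.
Qed.

(** Since the [f j] are nonnegative, an index chosen point by point already gives [F <= \sum_j f j],
    whose integral is at most a geometric series. No partition into dyadic shells is required. *)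
Lemma dominated_series_integrable (R : realType) (d : nat)
    (leb : {measure set (Rd R d) -> \bar R}) (F : Rd R d -> R) (f : nat -> Rd R d -> R)
    (C k : R) : measurable_fun setT F -> (forall h, 0 <= F h) -> (forall j h, 0 <= f j h) ->
  (forall j, leb.-integrable setT (EFin \o f j)) ->
  (forall j, \int[leb]_h f j h <= C * k ^+ j) -> 0 <= C -> 0 < k -> k < 1 ->
  (forall h, exists j, F h <= f j h) -> leb.-integrable setT (EFin \o F).
Proof.
move=> mF F0 f0 fi fC C0 k0 k1 Ff; apply/integrableP; split; first exact/measurable_EFinP.
have mf j : measurable_fun setT (EFin \o f j) by have /integrableP[] := fi j.
have f0E j h : (0 <= (f j h)%:E)%E by rewrite lee_fin.
apply: (@le_lt_trans _ _ (\int[leb]_h \sum_(j <oo) (f j h)%:E)%E).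
  apply: ge0_le_integral => //.
  - by apply/measurable_EFinP; exact: measurableT_comp.
  - by apply: ge0_emeasurable_sum; [move=> j h _ _; exact: f0E | move=> j _; exact: mf].
  - move=> h _; rewrite /= ger0_norm //; have [j hj] := Ff h.
    apply: (@le_trans _ _ (\sum_(0 <= i < j.+1) (f i h)%:E)%E); last first.
      by apply: nneseries_lim_ge => n _ _; exact: f0E.
    rewrite big_nat_recr //= (le_trans (y := (f j h)%:E)) ?lee_fin //.
    by rewrite leeDr // sume_ge0 // => i _; exact: f0E.
rewrite integral_nneseries //.
apply: (@le_lt_trans _ _ (C / (1 - k))%:E); last exact: ltry.
apply: lime_le.
  by apply: is_cvg_nneseries => n _ _; apply: integral_ge0 => h _; exact: f0E.
apply: nearW => n.
have E j : (\int[leb]_h (f j h)%:E)%E = (\int[leb]_h f j h)%:E.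
  by rewrite /Rintegral fineK //; exact: (integrable_fin_num measurableT (fi j)).
under eq_bigr do rewrite E.
rewrite sumEFin lee_fin.
apply: (@le_trans _ _ (series (geometric C k) n)).
  by rewrite /series /=; apply: ler_sum => j _; exact: fC.
by apply: geometric_le_lim => //; rewrite gtr0_norm.
Qed.

Lemma exists_dyadic (R : realType) (x : R) : 1 <= x -> exists j, 2 ^+ j <= x < 2 ^+ j.+1.
Proof.
move=> x1.
have [N hN] : exists N, x < 2 ^+ N.
  have [N hN] := @exists_pow_ge R 2 (ltr1n _ 2) (x + 1); exists N.
  by apply: lt_le_trans hN; rewrite ltrDl.
elim: N hN => [|N IH] hN; first by move: (le_lt_trans x1 hN); rewrite expr0 ltxx.
by case: (ltP x (2 ^+ N)) => [/IH //|h]; exists N; rewrite h.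
Qed.

(** * The Levy measure and its truncations *)

Section levy.
Context (R : realType) (d : nat) (d_gt0 : (0 < d)%N).
Context (leb : {measure set (Rd R d) -> \bar R}) (hleb : is_lebesgue_Rd leb).
Context (phi : R -> R) (d1 d2 a1 a2 : R).
Hypothesis phi_gt0 : forall r : R, 0 < r -> 0 < phi r.
Hypothesis phi_cont : forall r : R, 0 < r -> {for r, continuous phi}.
Hypothesis phi1 : phi 1 = 1.
Hypothesis d1_gt0 : 0 < d1.
Hypothesis d2_gt0 : 0 < d2.
Hypothesis d2_lt1 : d2 < 1.
Hypothesis a1_gt0 : 0 < a1.
Hypothesis a2_gt0 : 0 < a2.
Hypothesis phi_lower : forall lam r : R, 1 <= lam -> 0 < r ->
  a1 * lam `^ (2 * d1) * phi r <= phi (lam * r).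
Hypothesis phi_upper : forall lam r : R, 1 <= lam -> 0 < r ->
  phi (lam * r) <= a2 * lam `^ (2 * d2) * phi r.
Context (Lam1 Lam2 : R) (Lam1_gt0 : 0 < Lam1) (a0 : 'rV[R]_d -> R).
Hypothesis ha0m : measurable_fun [set h : Rd R d | (h : 'rV[R]_d) != 0] a0.
Hypothesis ha0b : forall h : 'rV[R]_d, h != 0 -> Lam1 <= a0 h <= Lam2.

Let D0 : set (Rd R d) := [set h : Rd R d | (h : 'rV[R]_d) != 0].

Lemma measurable_D0 : measurable D0.
Proof. apply: open_measurable_Rd; exact: open_nonzero. Qed.

(** Extension by 0 at the origin turns integrals over the punctured space into integrals over the
    whole space. *)
Definition nu : Rd R d -> R := (levy_density phi a0 : Rd R d -> R) \_ D0.

Lemma nuE (h : Rd R d) : (h : 'rV[R]_d) != 0 -> nu h = levy_density phi a0 h.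
Proof. by move=> h0; rewrite /nu patchE ifT // inE. Qed.

Lemma nu0 (h : Rd R d) : (h : 'rV[R]_d) = 0 -> nu h = 0.
Proof. by move=> h0; rewrite /nu patchE ifF //; apply/negP; rewrite inE /D0 /= h0 eqxx. Qed.

Lemma nu_ge0 h : 0 <= nu h.
Proof.
have [h0|h0] := eqVneq (h : 'rV[R]_d) 0; first by rewrite nu0.
rewrite nuE // /levy_density divr_ge0 //.
  by have /andP[+ _] := ha0b h0; apply: le_trans; exact: ltW.
by rewrite mulr_ge0 ?exprn_ge0 ?euclid_norm_ge0 // ltW // phi_gt0 // euclid_norm_gt0.
Qed.

Lemma measurable_nu : measurable_fun setT nu.
Proof.
apply/(measurable_restrictT _ measurable_D0).
apply: measurable_funM => //.
apply: (@continuous_on_measurable_Rd R d [set h | h != 0]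
  (fun h => (euclid_norm h ^+ d * phi (euclid_norm h))^-1)); first exact: open_nonzero.
move=> x x0; have e0 := euclid_norm_gt0 x0.
apply: continuousV; first by rewrite mulf_neq0 // ?expf_neq0 // gt_eqF // phi_gt0.
apply: continuousM.
  apply: (@continuous_comp _ _ _ (@euclid_norm R d) (fun y => y ^+ d)).
    exact: euclid_norm_continuous.
  exact: exprn_continuous.
apply: (@continuous_comp _ _ _ (@euclid_norm R d) phi); first exact: euclid_norm_continuous.
exact: phi_cont.
Qed.

(** The usual integrability weight of a Levy measure; both integrands of the Levy exponent are
    bounded by multiples of it. *)
Definition wt (h : Rd R d) : R := Num.min 1 (euclid_norm h ^+ 2).

Lemma wt_ge0 h : 0 <= wt h.
Proof. by rewrite le_min ler01 sqr_ge0. Qed.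

Lemma measurable_wt : measurable_fun setT wt.
Proof.
apply: measurable_minr => //.
apply: (@continuous_measurable_Rd R d (fun h => euclid_norm h ^+ 2)) => x.
apply: (@continuous_comp _ _ _ (@euclid_norm R d) (fun y => y ^+ 2)).
  exact: euclid_norm_continuous.
exact: exprn_continuous.
Qed.

(** A cube containing the closed ball of radius [r]; the factor 2 leaves room for the open left
    faces. *)
Definition ball_box (r : R) : set (Rd R d) := box (const_mx (- (2 * r))) (const_mx (2 * r)).

Lemma ball_box_mem (h : Rd R d) r : euclid_norm h <= r -> 0 < r -> ball_box r h.
Proof.
move=> hr r0 i; rewrite !mxE; have := le_trans (coord_le_euclid_norm h i) hr.
by rewrite ler_norml => /andP[? ?]; apply/andP; split; lra.
Qed.

Lemma ball_box_integral r : 0 < r -> \int[leb]_h (\1_(ball_box r) h : R) = 4 ^+ d * r ^+ d.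
Proof.
move=> r0; rewrite Rintegral_indic; last exact: measurable_box.
rewrite lebesgue_box //; last by move=> i; rewrite !mxE; lra.
under eq_bigr do rewrite !mxE.
rewrite prodr_const card_ord -exprMn; congr (_ ^+ _); ring.
Qed.

Lemma nu_le (h : Rd R d) (e p : R) : (h : 'rV[R]_d) != 0 -> 0 < e -> e <= euclid_norm h ->
  0 < p -> p <= phi (euclid_norm h) -> nu h <= Lam2 / (e ^+ d * p).
Proof.
move=> h0 e0 eh p0 ph; rewrite nuE // /levy_density.
have n0 := euclid_norm_gt0 h0.
have /andP[l1 l2] := ha0b h0.
have a0h : 0 <= a0 h by apply: le_trans l1; exact: ltW.
apply: ler_pM => //; first by rewrite invr_ge0 mulr_ge0 ?exprn_ge0 ?(ltW n0) // ltW // phi_gt0.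
rewrite lef_pV2 ?posrE ?mulr_gt0 ?exprn_gt0 ?phi_gt0 //.
by apply: ler_pM; rewrite ?exprn_ge0 ?(ltW e0) ?(ltW p0) // lerXn2r // ?nnegrE ltW.
Qed.

Lemma powR_dyadic_le (a x : R) j : 0 <= a -> 2 ^+ j <= x -> (2 `^ a) ^+ j <= x `^ a.
Proof.
move=> a_ge0 h; rewrite -powR_dyadic.
have p0 : (0 : R) <= 2 ^+ j by rewrite exprn_ge0.
by apply: ge0_ler_powR; rewrite ?nnegrE // (le_trans p0).
Qed.

Lemma powR_dyadic_ge (a x : R) j : 0 <= a -> 0 <= x -> x <= 2 ^+ j -> x `^ a <= (2 `^ a) ^+ j.
Proof.
move=> a_ge0 x0 h; rewrite -powR_dyadic.
by apply: ge0_ler_powR; rewrite ?nnegrE // exprn_ge0.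
Qed.

Lemma nu_le_far (h : Rd R d) j : (h : 'rV[R]_d) != 0 -> 2 ^+ j <= euclid_norm h ->
  nu h <= Lam2 / (2 ^+ j ^+ d * (a1 * (2 `^ (2 * d1)) ^+ j)).
Proof.
move=> h0 hj; have e0 := euclid_norm_gt0 h0.
apply: nu_le => //; rewrite ?exprn_gt0 ?mulr_gt0 ?exprn_gt0 ?powR_gt0 //.
have e1 : 1 <= euclid_norm h by apply: le_trans hj; rewrite exprn_ege1 // ler1n.
have := phi_lower e1 ltr01; rewrite phi1 !mulr1; apply: le_trans.
by rewrite ler_pM2l // powR_dyadic_le // mulr_ge0 // ltW.
Qed.

Lemma nu_le_near (h : Rd R d) j : (h : 'rV[R]_d) != 0 ->
  (euclid_norm h)^-1 <= 2 ^+ j.+1 -> 1 <= (euclid_norm h)^-1 ->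
  nu h <= Lam2 / ((2 ^+ j.+1)^-1 ^+ d * (a2 * (2 `^ (2 * d2)) ^+ j.+1)^-1).
Proof.
move=> h0 hj e1; have e0 := euclid_norm_gt0 h0.
have ei0 : 0 < (euclid_norm h)^-1 by rewrite invr_gt0.
apply: nu_le => //.
- by rewrite -[leRHS]invrK lef_pV2 ?posrE ?exprn_gt0.
- by rewrite invr_gt0 mulr_gt0 ?exprn_gt0 ?powR_gt0.
- have := phi_upper e1 e0; rewrite mulVf ?gt_eqF // phi1 => h1.
  rewrite -[leRHS]invrK lef_pV2 ?posrE ?invr_gt0 ?phi_gt0 ?mulr_gt0 ?exprn_gt0 ?powR_gt0 //.
  rewrite -[leLHS]mul1r ler_pdivrMr ?phi_gt0 //; apply: (le_trans h1).
  rewrite ler_pM2r ?phi_gt0 // ler_pM2l // powR_dyadic_ge // ?(ltW ei0) //.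
  by rewrite mulr_ge0 // ltW.
Qed.

(** [k1] and [k2] are the geometric ratios of the far and near shells. [w1 j] bounds [nu] where
    [|h| >= 2^j], and [w2 j] bounds [|h|^2 nu] where [|h|] lies between [2^-(j+1)] and [2^-j]. *)
Let k1 : R := (2 `^ (2 * d1))^-1.
Let k2 : R := 2 `^ (2 * d2) / 4.
Let w1 j : R := Lam2 / (2 ^+ j ^+ d * (a1 * (2 `^ (2 * d1)) ^+ j)).
Let w2 j : R := (2 ^+ j)^-1 ^+ 2 *
  (Lam2 / ((2 ^+ j.+1)^-1 ^+ d * (a2 * (2 `^ (2 * d2)) ^+ j.+1)^-1)).

Let Lam2_gt0 : 0 < Lam2.
Proof.
have h0 : (const_mx 1 : 'rV[R]_d) != 0.
  by apply/eqP => /rowP /(_ (Ordinal d_gt0)); rewrite !mxE => /eqP; rewrite oner_eq0.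
have /andP[l1 l2] := ha0b h0.
exact: lt_le_trans Lam1_gt0 (le_trans l1 l2).
Qed.

(** On dyadic shells the volume cancels [|h|^d]. Far out, lower scaling from 1 leaves [2^(-2 d1 j)];
    near 0, upper scaling bounds [1 / phi] by a multiple of [2^(2 d2 j)], which the weight [4^-j]
    beats because [d2 < 1]. *)
Lemma wt_nu_integrable : leb.-integrable setT (EFin \o (fun h => wt h * nu h)).
Proof.
have two0 n : (0 : R) < 2 ^+ n by rewrite exprn_gt0.
have B1 : 0 < 2 `^ (2 * d1) by rewrite powR_gt0.
have B2 : 0 < 2 `^ (2 * d2) by rewrite powR_gt0.
have w1_ge0 j : 0 <= w1 j.
  by rewrite ltW // divr_gt0 // mulr_gt0 ?exprn_gt0 // mulr_gt0 // exprn_gt0.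
have w2_ge0 j : 0 <= w2 j.
  rewrite ltW // mulr_gt0 ?exprn_gt0 ?invr_gt0 // divr_gt0 // mulr_gt0 ?exprn_gt0 ?invr_gt0 //.
  by rewrite mulr_gt0 // exprn_gt0.
pose f j (h : Rd R d) := w1 j * \1_(ball_box (2 ^+ j.+1)) h + w2 j * \1_(ball_box (2 ^+ j)^-1) h.
have ib r : leb.-integrable setT (EFin \o (\1_(ball_box r) : Rd R d -> R)).
  by apply: indic_integrable; [exact: measurable_box | exact: lebesgue_box_lty].
have k1_gt0 : 0 < k1 by rewrite invr_gt0.
have k1_lt1 : k1 < 1 by rewrite invf_lt1 // growth_gt1.
have k2_gt0 : 0 < k2 by rewrite divr_gt0.
have k2_lt1 : k2 < 1.
  rewrite ltr_pdivrMr // mul1r.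
  have g1 : 1 < growth (1 - d2) by rewrite growth_gt1 // subr_gt0.
  have -> : 4 = 2 `^ (2 * d2) * growth (1 - d2).
    rewrite /growth -powRD; last by rewrite pnatr_eq0 implybT.
    have -> : 2 * d2 + 2 * (1 - d2) = 2%:R by ring.
    by rewrite powR_mulrn // expr2; ring.
  by rewrite ltr_pMr.
pose C1 := Lam2 / a1 * (4 ^+ d * 2 ^+ d).
pose C2 := Lam2 * a2 * 2 `^ (2 * d2) * (4 ^+ d * 2 ^+ d).
have C1_ge0 : 0 <= C1 by rewrite ltW // !mulr_gt0 ?invr_gt0 // exprn_gt0.
have C2_ge0 : 0 <= C2 by rewrite ltW // !mulr_gt0 // exprn_gt0.
apply: (@dominated_series_integrable _ _ leb _ f (C1 + C2) (Num.max k1 k2)).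
- by apply: measurable_funM; [exact: measurable_wt | exact: measurable_nu].
- by move=> h; rewrite mulr_ge0 // ?wt_ge0 ?nu_ge0.
- by move=> j h; rewrite addr_ge0 // mulr_ge0.
- by move=> j; apply: RintegrableD => //; apply: RintegrableZl.
- move=> j; rewrite RintegralD //; try exact: RintegrableZl.
  rewrite !RintegralZl // !ball_box_integral ?invr_gt0 // mulrDl; apply: lerD.
    apply: (@le_trans _ _ (C1 * k1 ^+ j)).
      apply: le_of_eq; rewrite /w1 /C1 /k1 exprVn exprS exprMn; field.
      by rewrite !expf_neq0 ?gt_eqF.
    by rewrite ler_wpM2l // lerXn2r ?nnegrE ?le_max ?(ltW k1_gt0) ?lexx.
  apply: (@le_trans _ _ (C2 * k2 ^+ j)).
    apply: le_of_eq; rewrite /w2 /C2 /k2 !exprVn [2 ^+ j.+1]exprS [2 `^ _ ^+ j.+1]exprS !exprMn exprVn.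
    have -> : (4 : R) ^+ j = 2 ^+ j * 2 ^+ j by rewrite -exprMn; congr (_ ^+ _); ring.
    field.
    by rewrite !expf_neq0 ?gt_eqF.
  by rewrite ler_wpM2l // lerXn2r ?nnegrE ?le_max ?(ltW k1_gt0) ?lexx ?orbT // ltW.
- by rewrite addr_ge0.
- by rewrite lt_max k1_gt0.
- by rewrite gt_max k1_lt1.
move=> h; have [h0|h0] := eqVneq (h : 'rV[R]_d) 0.
  by exists 0; rewrite nu0 // mulr0 addr_ge0 // mulr_ge0.
have e0 := euclid_norm_gt0 h0.
have [e1|e1] := leP 1 (euclid_norm h).
  have [j /andP[j1 j2]] := exists_dyadic e1; exists j.
  rewrite /f [\1_(ball_box (2 ^+ j.+1)) h]indicE mem_set; last first.
    by apply: ball_box_mem; rewrite // ltW.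
  rewrite mulr1 -[leLHS]addr0; apply: lerD; last exact: mulr_ge0 (w2_ge0 _) (ler0n _ _).
    rewrite -[leRHS]mul1r ler_pM ?wt_ge0 ?nu_ge0 //; first by rewrite /wt ge_min lexx.
  exact: nu_le_far.
have ei1 : 1 <= (euclid_norm h)^-1 by rewrite invf_ge1 // ltW.
have [j /andP[j1 j2]] := exists_dyadic ei1; exists j.
have ej : euclid_norm h <= (2 ^+ j)^-1.
  by rewrite -[leLHS]invrK lef_pV2 ?posrE // ?invr_gt0.
rewrite /f [\1_(ball_box (2 ^+ j)^-1) h]indicE mem_set; last first.
  by apply: ball_box_mem; rewrite // ?invr_gt0.
rewrite mulr1 -[leLHS]add0r; apply: lerD; first exact: mulr_ge0 (w1_ge0 _) (ler0n _ _).
rewrite ler_pM ?wt_ge0 ?nu_ge0 //.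
  by rewrite /wt ge_min; apply/orP; right; rewrite lerXn2r ?nnegrE ?invr_ge0 ?euclid_norm_ge0 // ltW.
by apply: nu_le_near => //; exact: ltW.
Qed.
End levy.

(** * Cutting off small jumps and passing to the limit in the symbol *)

Section truncation.
Context (R : realType) (d : nat) (leb : {measure set (Rd R d) -> \bar R}).
Variable g : Rd R d -> R.
Hypothesis mg : measurable_fun setT g.
Hypothesis g_ge0 : forall h, 0 <= g h.
Hypothesis g0 : forall h : Rd R d, (h : 'rV[R]_d) = 0 -> g h = 0.
Hypothesis wt_g : leb.-integrable setT (EFin \o (fun h => wt h * g h)).
Variable rho : nat -> R.
Hypothesis rho_gt0 : forall j, 0 < rho j.
Hypothesis rho_cvg : forall e : R, 0 < e -> \forall j \near \oo, rho j < e.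

Definition trunc (r : R) (h : Rd R d) : R := \1_[set h : Rd R d | r < euclid_norm h] h * g h.

Let mA r : measurable [set h : Rd R d | r < euclid_norm h].
Proof.
apply: open_measurable_Rd.
have /continuousP := @euclid_norm_continuous R d; move/(_ [set x | r < x]); apply.
exact: open_gt.
Qed.

Lemma measurable_trunc r : measurable_fun setT (trunc r).
Proof. by apply: measurable_funM => //; exact: measurable_indic. Qed.

Lemma trunc_ge0 r h : 0 <= trunc r h.
Proof. by rewrite mulr_ge0. Qed.

(** Where [|h| > r] the weight [wt] is at least [c = min(1, r^2)], so the truncated density is at
    most [wt * g / c]. *)
Lemma trunc_integrable r : 0 < r -> leb.-integrable setT (EFin \o trunc r).
Proof.
move=> r0; pose c : R := Num.min 1 (r ^+ 2).
have c0 : 0 < c by rewrite lt_min ltr01 exprn_gt0.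
apply: (@le_integrable _ _ _ leb setT measurableT _ (EFin \o (fun h => c^-1 * (wt h * g h)))).
- by apply/measurable_EFinP; exact: measurable_trunc.
- move=> h _; rewrite /= lee_fin ger0_norm ?trunc_ge0 // (le_trans _ (ler_norm _)) //.
  rewrite /trunc indicE; have [hA|hA] := boolP (h \in _); last first.
    by rewrite mul0r mulr_ge0 ?invr_ge0 ?(ltW c0) // mulr_ge0 // wt_ge0.
  rewrite mul1r mulrA ler_peMl // -ler_pdivrMl ?invr_gt0 // invrK mulr1.
  rewrite inE /= in hA.
  rewrite /c /wt le_min ge_min lexx /= ge_min; apply/orP; right.
  by rewrite lerXn2r ?nnegrE ?euclid_norm_ge0 // ltW.
- exact: RintegrableZl.
Qed.

(** Dominated convergence: at each [h] other than 0 the truncation is inactive as soon as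
    [rho J < |h|], and at 0 the density vanishes. *)
Lemma trunc_cvg (F : Rd R d -> R) (C : R) : measurable_fun setT F ->
  (forall h, `|F h| <= C * wt h) ->
  (fun J => \int[leb]_h (F h * trunc (rho J) h)) @ \oo --> \int[leb]_h (F h * g h).
Proof.
move=> mF FC; have C0 (h : Rd R d) : 0 <= C * wt h by exact: le_trans (normr_ge0 _) (FC h).
have [|||||] := @dominated_convergence _ _ _ leb setT measurableT
  (fun J h => (F h * trunc (rho J) h)%:E) (fun h => (F h * g h)%:E) (fun h => (C * (wt h * g h))%:E).
- by move=> n; apply/measurable_EFinP; apply: measurable_funM => //; exact: measurable_trunc.
- by apply/measurable_EFinP; exact: measurable_funM.
- apply: aeW => h _.
  have [h0|h0] := eqVneq (h : 'rV[R]_d) 0.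
    by rewrite /trunc g0 // !mulr0; under eq_fun do rewrite mulr0 mulr0; exact: cvg_cst.
  apply/cvg_ballP => e e0; have := rho_cvg (euclid_norm_gt0 h0).
  apply: filterS => n hn; rewrite /trunc indicE mem_set // mul1r.
  exact: ballxx.
- exact: RintegrableZl.
- apply: aeW => h n _; rewrite /= lee_fin normrM mulrA ler_pM //.
  by rewrite ger0_norm ?trunc_ge0 // /trunc ler_piMl // indicE lern1 leq_b1.
move=> i1 _ H; apply: fine_cvg; rewrite /Rintegral fineK; first exact: H.
exact: (integrable_fin_num measurableT i1).
Qed.

Definition symbol_re (xi : 'rV[R]_d) : R := \int[leb]_h ((1 - cos (euclid_dot xi h)) * g h).
Definition compensator (xi : 'rV[R]_d) (h : Rd R d) : R :=
  euclid_dot xi h * (if euclid_norm h <= 1 then 1 else 0).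
Definition symbol_im (xi : 'rV[R]_d) : R :=
  \int[leb]_h ((compensator xi h - sin (euclid_dot xi h)) * g h).

Let l1 (xi : 'rV[R]_d) : R := \sum_i `|xi ord0 i|.

Let dot_le xi (h : 'rV[R]_d) : `|euclid_dot xi h| <= l1 xi * euclid_norm h.
Proof.
apply: (le_trans (ler_norm_sum _ _ _)); rewrite /l1 mulr_suml; apply: ler_sum => i _.
by rewrite normrM ler_wpM2l // coord_le_euclid_norm.
Qed.

Let l1_ge0 xi : 0 <= l1 xi.
Proof. by rewrite sumr_ge0. Qed.

Let dot2_le xi (h : 'rV[R]_d) : euclid_dot xi h ^+ 2 <= l1 xi ^+ 2 * euclid_norm h ^+ 2.
Proof.
rewrite -exprMn -real_normK ?num_real // lerXn2r ?nnegrE ?mulr_ge0 ?euclid_norm_ge0 //.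
Qed.

Lemma one_sub_cos_le xi (h : Rd R d) : `|1 - cos (euclid_dot xi h)| <= (2 + l1 xi ^+ 2) * wt h.
Proof.
rewrite /wt; case: (leP 1 (euclid_norm h ^+ 2)) => _.
  rewrite mulr1; apply: (@le_trans _ _ (1 + 1)); last by rewrite -[1 + 1]/2 lerDl sqr_ge0.
  by apply: (le_trans (ler_normB _ _)); rewrite normr1 lerD2l cos_max.
rewrite distrC; apply: (le_trans (abs_cos_sub1_le _)); apply: (le_trans (dot2_le _ _)).
by rewrite ler_wpM2r ?sqr_ge0 // lerDr.
Qed.

(** In the unit ball the compensator removes the linear part of the sine and a quadratic remainder
    is left; outside it only the bounded sine remains. *)
Lemma comp_sub_sin_le xi (h : Rd R d) :
  `|compensator xi h - sin (euclid_dot xi h)| <= (1 + l1 xi ^+ 2) * wt h.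
Proof.
rewrite /compensator /wt; have e0 := euclid_norm_ge0 (h : 'rV[R]_d).
case: ifPn => he.
  have e2 : euclid_norm h ^+ 2 <= 1 by rewrite -(expr1n _ 2) lerXn2r ?nnegrE.
  rewrite mulr1 (min_idPr e2) distrC; apply: (le_trans (abs_sin_sub_le _)).
  by apply: (le_trans (dot2_le _ _)); rewrite ler_wpM2r ?sqr_ge0 // lerDr.
rewrite -ltNge in he.
have e2 : 1 <= euclid_norm h ^+ 2 by rewrite exprn_ege1 // ltW.
rewrite mulr0 sub0r normrN (min_idPl e2) mulr1.
by apply: (le_trans (sin_max _)); rewrite lerDl sqr_ge0.
Qed.

Let mdot xi : measurable_fun setT (euclid_dot xi : Rd R d -> R).
Proof. by apply: continuous_measurable_Rd; exact: euclid_dot_continuous. Qed.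

Let mcos xi : measurable_fun setT (fun h : Rd R d => cos (euclid_dot xi h)).
Proof. exact: (@continuous_measurable_Rd R d _ (@cos_dot_continuous R d xi)). Qed.

Let msin xi : measurable_fun setT (fun h : Rd R d => sin (euclid_dot xi h)).
Proof. exact: (@continuous_measurable_Rd R d _ (@sin_dot_continuous R d xi)). Qed.

Let unit_ball : Rd R d -> R := fun h => if euclid_norm h <= 1 then 1 else 0.

Let munit : measurable_fun setT unit_ball.
Proof.
apply: measurable_fun_ifT => //.
apply: measurable_fun_ler => //.
exact: (@continuous_measurable_Rd R d _ (@euclid_norm_continuous R d)).
Qed.

Let mcomp xi : measurable_fun setT (compensator xi).
Proof. exact: measurable_funM. Qed.

Lemma measurable_one_sub_cos xi : measurable_fun setT (fun h : Rd R d => 1 - cos (euclid_dot xi h)).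
Proof. exact: measurable_funB. Qed.

Lemma measurable_comp_sub_sin xi :
  measurable_fun setT (fun h : Rd R d => compensator xi h - sin (euclid_dot xi h)).
Proof. exact: measurable_funB. Qed.

(** The first moment of the truncated jumps of size at most 1; translating by its opposite
    reproduces the compensator of the Levy exponent. *)
Definition drift (r : R) : 'rV[R]_d :=
  \row_i \int[leb]_h ((h : 'rV[R]_d) ord0 i * unit_ball h * trunc r h).

Let comp_le xi (h : Rd R d) : `|compensator xi h| <= l1 xi.
Proof.
rewrite /compensator; case: ifPn => he; last by rewrite mulr0 normr0.
by rewrite mulr1; apply: (le_trans (dot_le _ _)); rewrite ler_piMr.
Qed.

Lemma comp_integrable xi r : 0 < r ->
  leb.-integrable setT (EFin \o (fun h => compensator xi h * trunc r h)).
Proof.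
move=> r0; apply: (@measurable_bounded_mul_integrable _ _ _ _ _ (l1 xi)) => //.
exact: trunc_integrable.
Qed.

Lemma drift_dot xi r : 0 < r ->
  euclid_dot xi (drift r) = \int[leb]_h (compensator xi h * trunc r h).
Proof.
move=> r0; have iT := trunc_integrable r0.
have E h : compensator xi h * trunc r h =
    \sum_(i < d) xi ord0 i * ((h : 'rV[R]_d) ord0 i * unit_ball h * trunc r h).
  by rewrite /compensator -/(unit_ball h) /euclid_dot !mulr_suml; apply: eq_bigr => i _; ring.
have ii i : leb.-integrable setT (EFin \o
    (fun h : Rd R d => (h : 'rV[R]_d) ord0 i * unit_ball h * trunc r h)).
  apply: (@measurable_bounded_mul_integrable _ _ _ _ _ 1) => //.
    by apply: measurable_funM => //; exact: measurable_coord.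
  move=> h; rewrite /unit_ball; case: ifPn => he; last by rewrite mulr0 normr0.
  by rewrite mulr1 (le_trans (coord_le_euclid_norm _ _)).
under eq_Rintegral do rewrite E.
rewrite /euclid_dot; under eq_bigr do rewrite mxE.
elim: (index_enum _) => [|i s IH].
  by rewrite big_nil; under eq_Rintegral do rewrite big_nil; rewrite Rintegral_cst // mul0r.
rewrite big_cons IH; under [RHS]eq_Rintegral do rewrite big_cons.
rewrite RintegralD //; [by rewrite RintegralZl | exact: RintegrableZl |].
elim: s {IH} => [|j s IH].
  by rewrite (_ : _ \o _ = cst 0%E) //; [exact: integrable0 | apply/funext => h /=; rewrite big_nil].
rewrite (_ : _ \o _ = EFin \o (fun h : Rd R d => xi ord0 j * ((h : 'rV[R]_d) ord0 j * unit_ball h * trunc r h)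
   + \sum_(i <- s) xi ord0 i * ((h : 'rV[R]_d) ord0 i * unit_ball h * trunc r h))).
  by apply: RintegrableD => //; exact: RintegrableZl.
by apply/funext => h /=; rewrite big_cons.
Qed.

(** The mass term and the drift complete [hat] to the full compensated exponent. Read from right to
    left, the truncated semigroup is a translation times a compound Poisson semigroup, to which the
    multiplier bounds apply. *)
Lemma truncated_symbol xi r : 0 < r ->
  cis (euclid_dot xi (- drift r)) * cexp (hat leb (trunc r) xi - (\int[leb]_h trunc r h)%:C)
  = cexp (- ((\int[leb]_h ((1 - cos (euclid_dot xi h)) * trunc r h)) +i*
      (\int[leb]_h ((compensator xi h - sin (euclid_dot xi h)) * trunc r h)))).
Proof.
move=> r0; have iT := trunc_integrable r0.
have dN : euclid_dot xi (- drift r) = - \int[leb]_h (compensator xi h * trunc r h).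
  by rewrite -drift_dot // /euclid_dot -sumrN; apply: eq_bigr => i _; rewrite mxE mulrN.
have -> : cis (euclid_dot xi (- drift r)) = cexp ((0 : R) +i* (euclid_dot xi (- drift r))).
  by rewrite /cexp /= expR0 mul1r.
rewrite -cexpD; congr cexp; apply: complex_ext; rewrite !reimE /=.
  under [in RHS]eq_Rintegral do rewrite mulrBl mul1r.
  rewrite RintegralB //; last exact: cos_integrable.
  ring.
rewrite dN; under [in RHS]eq_Rintegral do rewrite mulrBl.
rewrite RintegralB //; [by ring | exact: comp_integrable | exact: sin_integrable].
Qed.

Lemma truncated_symbol_cvg xi :
  ccvg (fun J => cis (euclid_dot xi (- drift (rho J))) *
      cexp (hat leb (trunc (rho J)) xi - (\int[leb]_h trunc (rho J) h)%:C))
    (cexp (- (symbol_re xi +i* symbol_im xi))).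
Proof.
under eq_fun do rewrite truncated_symbol //.
apply: ccvg_cexp; split => /=; apply: cvgN.
  exact: (trunc_cvg (measurable_one_sub_cos xi) (one_sub_cos_le xi)).
exact: (trunc_cvg (measurable_comp_sub_sin xi) (comp_sub_sin_le xi)).
Qed.

Lemma mult_le_symbol :
  mult_le (fun xi => cexp (- (symbol_re xi +i* symbol_im xi))) 1.
Proof.
apply: mult_le_cvg truncated_symbol_cvg; apply: nearW => J.
rewrite -[1]mulr1; apply: mult_leM; first exact: mult_le_cis.
apply: mult_le_cexp; last by apply: Rintegral_ge0 => h _; exact: trunc_ge0.
by apply: mult_le_hat; [exact: trunc_integrable | exact: trunc_ge0].
Qed.

(** The polynomial, and with it the bound [M'] on its gradient, is fixed before [J] tends to
    infinity; the no-jump term therefore disappears and only [S] survives. *)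
Lemma mult_le_deriv_symbol (hleb : is_lebesgue_Rd leb) (i : 'I_d) (q : nat -> R) (S : R) :
  (forall j, 0 <= q j) ->
  (forall J h, \sum_(j < J) q j * \1_(cube (rho j)) h <= trunc (rho J) h) ->
  (forall J, \sum_(j < J) nojump d rho q j * (2 / rho j) <= S) ->
  nojump d rho q @ \oo --> (0 : R) ->
  mult_le (fun xi => 'i * (xi ord0 i)%:C * cexp (- (symbol_re xi +i* symbol_im xi))) S.
Proof.
move=> q0 qg Sle p0 s M sM x.
have M0 := mult_le_ge0 sM.
have [M' M'0 hM'] := evm_bounded (fun xi : 'rV[R]_d => 'i * (xi ord0 i)%:C) s.
have cv : (fun J => `|evm (fun xi => 'i * (xi ord0 i)%:C *
    (cis (euclid_dot xi (- drift (rho J))) *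
      cexp (hat leb (trunc (rho J)) xi - (\int[leb]_h trunc (rho J) h)%:C))) s x|) @ \oo -->
    `|evm (fun xi => 'i * (xi ord0 i)%:C * cexp (- (symbol_re xi +i* symbol_im xi))) s x|.
  apply: cvg_norm; apply: evm_cvg => xi.
  by apply: ccvgM; [exact: ccvg_cst | exact: truncated_symbol_cvg].
have cr : (fun J => S * M + nojump d rho q J * M') @ \oo --> S * M.
  rewrite -[X in _ --> X]addr0 -[X in _ --> _ + X](mul0r M').
  by apply: cvgD; [exact: cvg_cst | apply: cvgM => //; exact: cvg_cst].
apply: (ler_cvg_to cv cr); apply: nearW => J.
have := first_jump_bound hleb rho_gt0 q0 (- drift (rho J))
  (trunc_integrable (rho_gt0 J)) (qg J) sM hM' x.
move/le_trans; apply.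
by rewrite lerD2r ler_wpM2r.
Qed.
End truncation.

(** * The gradient bound at the scale [r] *)

Section gradient.
Context (R : realType) (d : nat) (d_gt0 : (0 < d)%N).
Context (leb : {measure set (Rd R d) -> \bar R}) (hleb : is_lebesgue_Rd leb).
Context (phi : R -> R) (d1 d2 a1 a2 : R).
Hypothesis phi_gt0 : forall r : R, 0 < r -> 0 < phi r.
Hypothesis phi_cont : forall r : R, 0 < r -> {for r, continuous phi}.
Hypothesis phi1 : phi 1 = 1.
Hypothesis d1_gt0 : 0 < d1.
Hypothesis d2_gt0 : 0 < d2.
Hypothesis d2_lt1 : d2 < 1.
Hypothesis a1_gt0 : 0 < a1.
Hypothesis a2_gt0 : 0 < a2.
Hypothesis phi_lower : forall lam r : R, 1 <= lam -> 0 < r ->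
  a1 * lam `^ (2 * d1) * phi r <= phi (lam * r).
Hypothesis phi_upper : forall lam r : R, 1 <= lam -> 0 < r ->
  phi (lam * r) <= a2 * lam `^ (2 * d2) * phi r.
Context (Lam1 Lam2 : R) (Lam1_gt0 : 0 < Lam1) (a0 : 'rV[R]_d -> R).
Hypothesis ha0m : measurable_fun [set h : Rd R d | (h : 'rV[R]_d) != 0] a0.
Hypothesis ha0b : forall h : 'rV[R]_d, h != 0 -> Lam1 <= a0 h <= Lam2.

(** On the cube of side [rho] one has [|h| <= D rho]. Upper scaling, with [D^(2 d2) <= D^2], then
    gives the lower bound [c0 / (rho^d phi rho)] for the Levy density there. *)
Let D : R := d%:R * 2.
Let c0 : R := Lam1 / (D ^+ d * (a2 * D ^+ 2)).

Let D_ge1 : 1 <= D.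
Proof. have h : (1 : R) <= d%:R by rewrite ler1n.
by rewrite /D; lra. Qed.

Let D_gt0 : 0 < D.
Proof. exact: lt_le_trans ltr01 D_ge1. Qed.

Lemma cube_pos (h : Rd R d) (rho : R) : 0 < rho -> cube rho h ->
  rho < euclid_norm h <= D * rho.
Proof.
move=> rho0 hc; have := hc (Ordinal d_gt0); rewrite !mxE => /andP[h1 _]; apply/andP; split.
  by apply: lt_le_trans h1 (le_trans (ler_norm _) (coord_le_euclid_norm _ _)).
rewrite /D -mulrA; apply: euclid_norm_le => //; first by rewrite mulr_ge0 // ltW.
move=> i; have := hc i; rewrite !mxE => /andP[h2 h3]; rewrite ger0_norm //.
by apply: ltW; apply: lt_trans h2.
Qed.

Lemma nu_ge_cube (h : Rd R d) (rho : R) : 0 < rho -> cube rho h ->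
  c0 / (rho ^+ d * phi rho) <= nu phi a0 h.
Proof.
move=> rho0 hc; have /andP[h1 h2] := cube_pos rho0 hc.
have e0 : 0 < euclid_norm h := lt_trans rho0 h1.
have hn0 : (h : 'rV[R]_d) != 0.
  apply: contraTneq e0 => ->; rewrite /euclid_norm /euclid_dot big1 ?sqrtr0 ?ltxx // => i _.
  by rewrite mxE mul0r.
rewrite nuE // /levy_density.
have /andP[l1 l2] := ha0b hn0.
have /andP[q1 q2] : 1 <= euclid_norm h / rho <= D.
  by rewrite ler_pdivlMr // mul1r (ltW h1) ler_pdivrMr.
have pe : phi (euclid_norm h) <= a2 * D ^+ 2 * phi rho.
  have := phi_upper q1 rho0; rewrite divfK ?gt_eqF // => /le_trans; apply.
  rewrite ler_pM2r ?phi_gt0 // ler_pM2l //.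
  apply: (@le_trans _ _ (D `^ (2 * d2))).
    apply: ge0_ler_powR => //; first by rewrite mulr_ge0 // ltW.
      by rewrite nnegrE (le_trans ler01).
    by rewrite nnegrE ltW.
  rewrite -powR_mulrn ?(ltW D_gt0) // ler_powR //.
  by move: d2_lt1; lra.
have P0 : 0 < euclid_norm h ^+ d * phi (euclid_norm h).
  by rewrite mulr_gt0 ?exprn_gt0 // phi_gt0.
have P1 : euclid_norm h ^+ d * phi (euclid_norm h) <= (D * rho) ^+ d * (a2 * D ^+ 2 * phi rho).
  apply: ler_pM => //; rewrite ?exprn_ge0 ?(ltW e0) //; first by rewrite ltW // phi_gt0.
  by rewrite lerXn2r // nnegrE ?(ltW e0) // mulr_ge0 // ltW.
apply: (@le_trans _ _ (Lam1 / ((D * rho) ^+ d * (a2 * D ^+ 2 * phi rho)))).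
  apply: le_of_eq; rewrite /c0 (exprMn _ D rho); move: (D ^+ d) (D ^+ 2) (rho ^+ d) (phi rho) => A B E P.
  by rewrite -[LHS]mulrA -invfM; congr (_ * _^-1); ring.
apply: ler_pM => //; first exact: ltW.
  by rewrite invr_ge0 (le_trans _ P1) // ltW.
by rewrite lef_pV2 ?posrE // (lt_le_trans P0 P1).
Qed.

Let c0_gt0 : 0 < c0.
Proof. by rewrite divr_gt0 // mulr_gt0 ?exprn_gt0 // mulr_gt0 // exprn_gt0. Qed.

Let nu_nonneg h : 0 <= nu phi a0 h.
Proof. exact: (nu_ge0 phi_gt0 Lam1_gt0 ha0b). Qed.

Section scale.
Variables (t r : R).
Hypotheses (t_gt0 : 0 < t) (r_gt0 : 0 < r).

Let rho j : R := r / 2 ^+ j.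
Let q j : R := t * (c0 / (rho j ^+ d * phi (rho j))).

Let rho_gt0 j : 0 < rho j.
Proof. by rewrite divr_gt0 // exprn_gt0. Qed.

Let rhoS j : rho j.+1 = rho j / 2.
Proof. by rewrite /rho exprSr; field; rewrite expf_neq0. Qed.

Let rho_le i j : (i <= j)%N -> rho j <= rho i.
Proof.
move=> ij; rewrite ler_pM2l // lef_pV2 ?posrE ?exprn_gt0 //.
by rewrite ler_weXn2l // ler1n.
Qed.

Let q_ge0 j : 0 <= q j.
Proof.
rewrite mulr_ge0 ?(ltW t_gt0) // divr_ge0 ?(ltW c0_gt0) // mulr_ge0 ?exprn_ge0 ?(ltW (rho_gt0 j)) //.
by rewrite ltW // phi_gt0.
Qed.

(** Here [2 rho j <= rho i], so the cubes at most touch, and the half-open faces exclude a common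
    point. *)
Let cube_disj i j (h : Rd R d) : (i < j)%N -> cube (rho i) h -> cube (rho j) h -> False.
Proof.
move=> ij hi hj; have := hi (Ordinal d_gt0); have := hj (Ordinal d_gt0); rewrite !mxE.
move=> /andP[_ h1] /andP[h2 _]; have := lt_le_trans h2 h1.
have := rho_le ij; rewrite rhoS; lra.
Qed.

(** By disjointness at most one term of the sum is nonzero. Its cube lies beyond the cutoff, since
    [j < J] gives [rho J <= rho j < |h|]. *)
Lemma jump_intensity_le J h :
  \sum_(j < J) q j * \1_(cube (rho j)) h <= trunc (fun h => t * nu phi a0 h) (rho J) h.
Proof.
have nu0' : 0 <= t * nu phi a0 h by rewrite mulr_ge0 ?(ltW t_gt0) //; exact: nu_nonneg.
have [[j0 hj0]|H] := pselect (exists j : 'I_J, cube (rho j) h); last first.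
  rewrite big1; last first.
    by move=> j _; rewrite indicE memNset ?mulr0 // => hj; apply: H; exists j.
  by rewrite mulr_ge0.
rewrite (bigD1 j0) //= big1 ?addr0; last first.
  move=> j jj0; rewrite indicE memNset ?mulr0 // => hj.
  have [lt|gt|e] := ltngtP j j0.
  - exact: (cube_disj lt hj hj0).
  - exact: (cube_disj gt hj0 hj).
  - by move: jj0; rewrite -(inj_eq val_inj) /= e eqxx.
have /andP[h1 _] := cube_pos (rho_gt0 j0) hj0.
rewrite /trunc !indicE !mem_set //=; last first.
  by apply: le_lt_trans h1; apply: rho_le; exact: ltnW.
rewrite mulr1 mul1r /q ler_pM2l //.
exact: nu_ge_cube.
Qed.

Variables (kap : R).
Hypotheses (kap_gt0 : 0 < kap) (kapt : kap * phi r <= t).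

Let c : R := kap * c0 * a1.

Lemma jump_rate_ge j : c * growth d1 ^+ j <= q j * rho j ^+ d.
Proof.
have pj : 0 < phi (rho j) by rewrite phi_gt0.
have -> : q j * rho j ^+ d = t * c0 / phi (rho j).
  by rewrite /q; field; rewrite expf_neq0 ?gt_eqF.
rewrite ler_pdivlMr //.
have := phi_dyadic phi_lower j r_gt0; rewrite -/(rho j) => h.
apply: (@le_trans _ _ (kap * phi r * c0)); last by rewrite ler_pM2r.
have -> : c * growth d1 ^+ j * phi (rho j) = kap * (a1 * growth d1 ^+ j * phi (rho j)) * c0.
  by rewrite /c; ring.
by rewrite ler_pM2r // ler_pM2l.
Qed.

(** The summation bound enters as a hypothesis on a given [K]: as [c] depends on [kap] but not on
    [t] or [r], one [K] serves all times and scales. *)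
Lemma mult_le_gradient_of (K : R) (i : 'I_d) :
  (forall p : nat -> R, p 0%N = 1 -> (forall n, 0 <= p n) ->
  (forall n, p n.+1 <= expR (- (c * growth d1 ^+ n))) ->
  (forall n, \sum_(j < n) p j * 2 ^+ j <= K) /\ (forall n, p n.+1 <= K * (4^-1) ^+ n)) ->
  mult_le (fun xi => 'i * (xi ord0 i)%:C *
     cexp (- (symbol_re leb (fun h => t * nu phi a0 h) xi +i*
              symbol_im leb (fun h => t * nu phi a0 h) xi))) (2 * K / r).
Proof.
move=> HK.
pose p := nojump d rho q.
have p0 : p 0%N = 1 by rewrite /p /nojump big_ord0.
have p_ge0 n : 0 <= p n by exact: nojump_ge0.
have p_le1 n : p n <= 1.
  by rewrite /p /nojump prodr_ile1 // => j _; rewrite expR_ge0 /= -expR0 ler_expR oppr_le0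
    mulr_ge0 // exprn_ge0 // ltW.
have pS n : p n.+1 <= expR (- (c * growth d1 ^+ n)).
  rewrite /p nojumpS -[leRHS]mul1r ler_pM ?expR_ge0 ?p_ge0 ?p_le1 //.
  by rewrite ler_expR lerN2 jump_rate_ge.
have [HS Hp] := HK p p0 p_ge0 pS.
have two_cvg : (fun n => (2^-1 : R) ^+ n) @ \oo --> (0 : R).
  by apply: cvg_expr; rewrite ger0_norm ?invf_lt1 ?ltr1n.
apply: (@mult_le_deriv_symbol _ _ leb _ _ _ _ _ rho _ _ hleb i q).
- by apply: measurable_funM => //; apply: (measurable_nu (a0 := a0) phi_gt0 phi_cont).
- by move=> h; rewrite mulr_ge0 ?(ltW t_gt0) //; exact: nu_nonneg.
- by move=> h h0; rewrite nu0 // mulr0.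
- have iw := wt_nu_integrable d_gt0 hleb phi_gt0 phi_cont phi1 d1_gt0 d2_gt0 d2_lt1 a1_gt0 a2_gt0
    phi_lower phi_upper Lam1_gt0 ha0m ha0b.
  rewrite (_ : _ \o _ = EFin \o (fun h => t * (wt h * nu phi a0 h))); first exact: RintegrableZl.
  by apply/funext => h /=; rewrite mulrCA.
- exact: rho_gt0.
- move=> e e0; have er : 0 < e / r by rewrite divr_gt0.
  have /cvgr0Pnorm_lt /(_ _ er) := two_cvg; apply: filterS => n.
  rewrite ger0_norm ?exprn_ge0 // exprVn ltr_pdivlMr // mulrC.
  by [].
- exact: q_ge0.
- exact: jump_intensity_le.
- move=> J; rewrite -/p.
  have -> : \sum_(j < J) p j * (2 / rho j) = 2 / r * \sum_(j < J) p j * 2 ^+ j.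
    rewrite mulr_sumr; apply: eq_bigr => j _; rewrite /rho; field.
    by rewrite expf_neq0 // gt_eqF.
  have -> : 2 * K / r = 2 / r * K by ring.
  by rewrite ler_pM2l ?divr_gt0.
- rewrite -/p -(cvg_shiftS p).
  apply: (@squeeze_cvgr _ _ _ _ (fun=> 0) (fun n => K * 4^-1 ^+ n)).
  + by apply: nearW => n; rewrite p_ge0 Hp.
  + exact: cvg_cst.
  + rewrite -[X in _ --> X](mulr0 K); apply: cvgM; first exact: cvg_cst.
    by apply: cvg_expr; rewrite ger0_norm ?invf_lt1 ?ltr1n.
Qed.
End scale.

Lemma mult_le_gradient (kap : R) : 0 < kap -> exists2 C, 0 < C & forall t r : R,
  0 < t -> 0 < r -> kap * phi r <= t -> forall i : 'I_d,
  mult_le (fun xi => 'i * (xi ord0 i)%:C *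
     cexp (- (symbol_re leb (fun h => t * nu phi a0 h) xi +i*
              symbol_im leb (fun h => t * nu phi a0 h) xi))) (C / r).
Proof.
move=> k0; have c_gt0 : 0 < kap * c0 * a1 by rewrite mulr_gt0 // mulr_gt0 // c0_gt0.
have [K K0 HK] := nojump_sum_bound c_gt0 (growth_gt1 d1_gt0).
exists (2 * K) => [|t r t0 r0 ktr i]; first by rewrite mulr_gt0.
exact: mult_le_gradient_of ktr _ _ HK.
Qed.

End gradient.

(** * Limits of functions with bounded derivatives *)

Lemma norm_coord_le (R : realType) (d : nat) (v : 'rV[R]_d) i : `|v ord0 i| <= `|v|.
Proof.
rewrite [leRHS]mx_normrE.
exact: (le_bigmax 0 (fun ij => `|v ij.1 ij.2|) (ord0, i)).
Qed.

Lemma l1_norm_le (R : realType) (d : nat) (v : 'rV[R]_d) :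
  \sum_i `|v ord0 i| <= d%:R * `|v|.
Proof.
apply: (@le_trans _ _ (\sum_(i < d) `|v|)).
  by apply: ler_sum => i _; exact: norm_coord_le.
by rewrite sumr_const card_ord mulr_natl.
Qed.

(** A remainder quadratic in the [l1] norm is [o(|v|)], because that norm is at most [d] times the
    library norm; this identifies the differential. *)
Lemma differentiable_of_quadratic (R : realType) (d : nat) (f : 'rV[R]_d -> R) (x w : 'rV[R]_d)
    (K : R) : 0 <= K ->
  (forall v, `|f (x + v) - f x - euclid_dot w v| <= K * (\sum_i `|v ord0 i|) ^+ 2) ->
  differentiable f x /\ forall i, 'D_(unitv i) f x = w ord0 i.
Proof.
move=> K0 H.
have lin : linear (euclid_dot w : 'rV[R]_d -> R^o).
  move=> a u v; rewrite euclid_dotDr; congr (_ + _).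
  by rewrite /euclid_dot scaler_sumr; apply: eq_bigr => i _; rewrite mxE; rewrite mulrCA.
pose L : {linear 'rV[R]_d -> R^o} := HB.pack (euclid_dot w) (GRing.isLinear.Build _ _ _ _ _ lin).
have Lc : continuous L by exact: euclid_dot_continuous.
have E : (f : 'rV[R]_d -> R^o) \o shift x = cst (f x : R^o) + (L : 'rV[R]_d -> R^o) +o_ (0 : 'rV[R]_d) id.
  apply/eqaddoP => e e0.
  (* This radius ensures [K d^2 |v| <= e]; the added 1 keeps the denominator positive when
     [K = 0]. *)
  have d0 : 0 < e / (K * d%:R ^+ 2 + 1).
    by rewrite divr_gt0 // ltr_wpDl // mulr_ge0 // exprn_ge0.
  near=> v.
  have -> : (f \o shift x - (cst (f x) + L)) v = f (x + v) - f x - euclid_dot w v.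
    by rewrite -[LHS]/(f (v + x) - (f x + euclid_dot w v)) [v + x]addrC opprD addrA.
  apply: (le_trans (H v)).
  apply: (@le_trans _ _ (K * (d%:R * `|v|) ^+ 2)).
    by rewrite ler_wpM2l // lerXn2r ?nnegrE ?sumr_ge0 ?mulr_ge0 // l1_norm_le.
  rewrite exprMn [`|v| ^+ 2]expr2 !mulrA ler_wpM2r // -[K * _ * _]mulrA -expr2.
  have vd : `|v| <= e / (K * d%:R ^+ 2 + 1).
    by near: v; have := @pseudometric_normed_Zmodule.nbhs0_le R 'rV[R]_d _ d0.
  apply: (@le_trans _ _ ((K * d%:R ^+ 2) * (e / (K * d%:R ^+ 2 + 1)))).
    by rewrite ler_wpM2l // mulr_ge0 // exprn_ge0.
  rewrite mulrA ler_pdivrMr; last by rewrite ltr_wpDl // mulr_ge0 // exprn_ge0.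
  by rewrite mulrC ler_pM2l // lerDl.
have dE : 'd f x = L :> ('rV[R]_d -> R) by exact: diff_unique.
have df : differentiable f x by apply/diff_locallyP; rewrite dE.
split=> // i; rewrite deriveE // dE /= /euclid_dot (bigD1 i) //= big1 => [|j ji].
  by rewrite /unitv !mxE !eqxx mulr1 addr0.
by rewrite /unitv !mxE eqxx (negbTE ji) mulr0.
Unshelve. all: by end_near. Qed.

Lemma line_is_derive (R : realType) (d : nat) (f : 'rV[R]_d -> R) (x v : 'rV[R]_d) (t : R) :
  differentiable f (x + t *: v) ->
  is_derive t 1 (fun t : R => f (x + t *: v)) (\sum_i v ord0 i * 'D_(unitv i) f (x + t *: v)).
Proof.
move=> df.
have -> : \sum_i v ord0 i * 'D_(unitv i) f (x + t *: v) = 'D_v f (x + t *: v).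
  move: (x + t *: v) df => y df; rewrite deriveE // {2}(row_sum_delta v) linear_sum.
  apply: eq_bigr => i _; rewrite deriveE //.
  by have := linearZ_LR ('d f y) (v ord0 i) (unitv i) => ->.
have E : (fun h : R => h^-1 *: (((fun t : R => f (x + t *: v)) \o shift t) (h *: 1) - f (x + t *: v)))
   = (fun h : R => h^-1 *: ((f \o shift (x + t *: v)) (h *: v) - f (x + t *: v))).
  apply/funext => h /=; congr (_ *: (f _ - _)).
  by rewrite [h *: 1]mulr1 scalerDl addrCA.
have dv : derivable f (x + t *: v) v by exact: diff_derivable.
by split; rewrite /derivable /derive E.
Qed.

Lemma line_MVT (R : realType) (d : nat) (f : 'rV[R]_d -> R) (x v : 'rV[R]_d) :
  (forall y, differentiable f y) ->
  exists2 c : R, 0 <= c <= 1 & f (x + v) - f x = \sum_i v ord0 i * 'D_(unitv i) f (x + c *: v).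
Proof.
move=> df.
have H (t : R) := line_is_derive (df (x + t *: v)).
have [|c] := @MVT_segment R _ _ 0 1 ler01 (fun t _ => H t).
  apply: continuous_subspaceT => t.
  by apply: differentiable_continuous; apply/derivable1_diffP; have [] := H t.
rewrite in_itv /= => c01; rewrite scale1r scale0r addr0 subr0 mulr1 => e.
by exists c.
Qed.

(** The mean value theorem is applied along [v], then to each partial derivative between [x] and
    [x + c v]. *)
Lemma taylor_bound (R : realType) (d : nat) (f : 'rV[R]_d -> R) (K : R) :
  (forall y, differentiable f y) ->
  (forall i y, differentiable (fun y => 'D_(unitv i) f y) y) ->
  (forall i j y, `|'D_(unitv j) (fun y => 'D_(unitv i) f y) y| <= K) ->
  forall x v, `|f (x + v) - f x - \sum_i v ord0 i * 'D_(unitv i) f x|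
     <= K * (\sum_i `|v ord0 i|) ^+ 2.
Proof.
move=> df ddf fK x v.
have [c /andP[c0 c1] ->] := line_MVT x v df.
rewrite -sumrB expr2 mulrA mulr_sumr; apply: (le_trans (ler_norm_sum _ _ _)).
apply: ler_sum => i _; rewrite -mulrBr normrM mulrC ler_wpM2r //.
have [c' _ ->] := line_MVT x (c *: v) (ddf i).
apply: (le_trans (ler_norm_sum _ _ _)); rewrite mulr_sumr; apply: ler_sum => j _.
rewrite mxE normrM mulrC ler_pM // normrM ger0_norm // ler_piMl //.
Qed.

Lemma cvg_of_approx (R : realType) (c : nat -> R) :
  (forall e : R, 0 < e -> exists a : nat -> R, (cvg (a @ \oo)) /\ forall n, `|c n - a n| <= e) ->
  cvg (c @ \oo).
Proof.
move=> H; apply/cauchy_cvgP; apply: cauchy_exP => e e0.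
have e3 : 0 < e / 3 by rewrite divr_gt0.
have [a [ca ac]] := H (e / 3) e3; exists (lim (a @ \oo)).
have /cvgrPdist_le /(_ _ e3) := ca.
apply: filterS => n hn; rewrite /ball /=.
have -> : lim (a @ \oo) - c n = (lim (a @ \oo) - a n) + (a n - c n) by ring.
apply: (le_lt_trans (ler_normD _ _)).
have := ac n; rewrite distrC => h; move: hn e0; lra.
Qed.

(** By Taylor's formula, difference quotients of step [h] approximate the derivatives of [u n]
    within [K h], uniformly in [n]. For fixed [h] they converge, so the derivatives converge too.
    Their limits satisfy the limiting Taylor inequality, hence are the derivatives of [u']. *)
Lemma gradient_cvg (R : realType) (d : nat) (u : nat -> 'rV[R]_d -> R) (u' : 'rV[R]_d -> R) (K : R) :
  0 <= K ->
  (forall n y, differentiable (u n) y) ->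
  (forall n i y, differentiable (fun y => 'D_(unitv i) (u n) y) y) ->
  (forall n i j y, `|'D_(unitv j) (fun y => 'D_(unitv i) (u n) y) y| <= K) ->
  (forall x, (fun n => u n x) @ \oo --> u' x) ->
  forall x, differentiable u' x /\
    forall i, (fun n => 'D_(unitv i) (u n) x) @ \oo --> 'D_(unitv i) u' x.
Proof.
move=> K0 du ddu uK cu x.
have T n := taylor_bound (du n) (ddu n) (uK n) x.
have cg i : cvg ((fun n => 'D_(unitv i) (u n) x) @ \oo).
  apply: cvg_of_approx => e e0.
  have h0 : 0 < e / (K + 1) by rewrite divr_gt0 // ltr_wpDl.
  set h := e / (K + 1) in h0.
  exists (fun n => (u n (x + h *: unitv i) - u n x) / h); split.
    apply: cvgP; apply: cvgM; last exact: cvg_cst.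
    by apply: cvgB; exact: cu.
  move=> n; have := T n (h *: unitv i).
  have -> : \sum_j (h *: (unitv i : 'rV[R]_d)) ord0 j * 'D_(unitv j) (u n) x
      = h * 'D_(unitv i) (u n) x.
    rewrite (bigD1 i) //= big1 => [|j ji].
      by rewrite /unitv !mxE !eqxx mulr1 addr0.
    by rewrite /unitv !mxE eqxx (negbTE ji) mulr0 mul0r.
  have -> : \sum_j `|(h *: (unitv i : 'rV[R]_d)) ord0 j| = h.
    rewrite (bigD1 i) //= big1 => [|j ji].
      by rewrite /unitv !mxE !eqxx mulr1 addr0 gtr0_norm.
    by rewrite /unitv !mxE eqxx (negbTE ji) mulr0 normr0.
  move=> Th; rewrite distrC.
  have -> : (u n (x + h *: unitv i) - u n x) / h - 'D_(unitv i) (u n) x =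
    (u n (x + h *: unitv i) - u n x - h * 'D_(unitv i) (u n) x) / h.
    by field; rewrite gt_eqF.
  rewrite normrM [`|h^-1|]gtr0_norm ?invr_gt0 // ler_pdivrMr //.
  apply: (le_trans Th); rewrite expr2 mulrA ler_pM2r //.
  rewrite /h mulrA ler_pdivrMr ?ltr_wpDl // mulrC ler_pM2l // lerDl.
  by [].
pose w : 'rV[R]_d := \row_i lim ((fun n => 'D_(unitv i) (u n) x) @ \oo).
have [|duw dw] := @differentiable_of_quadratic R d u' x w K K0.
  move=> v.
  have c1 : (fun n => \sum_i v ord0 i * 'D_(unitv i) (u n) x) @ \oo --> euclid_dot w v.
    rewrite /euclid_dot; elim: (index_enum _) => [|i s IH].
      by rewrite big_nil; under eq_fun do rewrite big_nil; exact: cvg_cst.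
    rewrite big_cons; under eq_fun do rewrite big_cons; apply: cvgD => //.
    by rewrite mulrC mxE; apply: cvgM; [exact: cvg_cst | exact: cg].
  have c2 : (fun n => `|u n (x + v) - u n x - \sum_i v ord0 i * 'D_(unitv i) (u n) x|) @ \oo -->
    `|u' (x + v) - u' x - euclid_dot w v|.
    by apply: cvg_norm; apply: cvgB => //; apply: cvgB; exact: cu.
  apply: (ler_cvg_to c2 (cvg_cst _)); apply: nearW => n; exact: T.
by split=> // i; rewrite dw mxE; exact: cg.
Qed.

Definition tame {R : realType} {d : nat} (B : nat -> R) (u : 'rV[R]_d -> R) : Prop :=
  smooth u /\ forall s x, `|pderiv s u x| <= B (size s).

(** Convergence of the derivatives of order [k], with the common bound in order [k + 2], gives
    differentiability of the limit and convergence in order [k + 1]; this drives the induction on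
    [s]. *)
Lemma tame_limit (R : realType) (d : nat) (B : nat -> R) (u : nat -> 'rV[R]_d -> R)
    (u' : 'rV[R]_d -> R) : (forall n, tame B (u n)) ->
  (forall x, (fun n => u n x) @ \oo --> u' x) -> tame B u'.
Proof.
move=> tu cu.
have B0 (i : 'I_d) k : 0 <= B k.
  by have := (tu 0%N).2 (nseq k i) 0; rewrite size_nseq; exact: le_trans.
have step s : (forall x, (fun n => pderiv s (u n) x) @ \oo --> pderiv s u' x) ->
    forall x, differentiable (pderiv s u') x /\
    forall i, (fun n => pderiv (i :: s) (u n) x) @ \oo --> pderiv (i :: s) u' x.
  move=> H; apply: (@gradient_cvg R d (fun n => pderiv s (u n)) (pderiv s u') `|B (size s).+2|) => //.
  - by move=> n y; exact: (tu n).1.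
  - by move=> n i y; exact: ((tu n).1 (i :: s)).
  - move=> n i j y; apply: le_trans (ler_norm _).
    exact: ((tu n).2 (j :: i :: s) y).
have cs s : forall x, (fun n => pderiv s (u n) x) @ \oo --> pderiv s u' x.
  by elim: s => [|i s IH] x; [exact: cu | exact: (step s IH x).2].
split=> [s x|s x]; first exact: (step s (cs s) x).1.
have c2 : (fun n => `|pderiv s (u n) x|) @ \oo --> `|pderiv s u' x|.
  by apply: cvg_norm; exact: cs.
by apply: (ler_cvg_to c2 (cvg_cst _)); apply: nearW => n; exact: (tu n).2.
Qed.

(** * Approximation by trigonometric polynomials *)

(* The law of independent Bernoulli variables of parameters [p a]; indexing them by coordinate
   and trial makes [bern F n p] the [d]-dimensional Bernstein polynomial of degree [n.+1]. *)
Definition bern_w {R : realType} {T : finType} (p : T -> R) (w : {ffun T -> bool}) : R :=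
  \prod_a (if w a then p a else 1 - p a).

Lemma bern_w_sum (R : realType) (T : finType) (p : T -> R) : \sum_w bern_w p w = 1.
Proof.
rewrite /bern_w -(bigA_distr_bigA (fun a (b : bool) => if b then p a else 1 - p a)) big1 // => a _.
by rewrite big_bool /= addrC subrK.
Qed.

Lemma bern_w_ge0 (R : realType) (T : finType) (p : T -> R) w :
  (forall a, 0 <= p a <= 1) -> 0 <= bern_w p w.
Proof.
move=> p01; apply: prodr_ge0 => a _; have /andP[p0 p1] := p01 a.
by case: (w a); rewrite ?subr_ge0.
Qed.

(** Independence: the sum over outcomes factors over the trials. For [a != b] the factor at [a] is a
    centred mean, hence 0; for [a = b] every factor lies in [[0, 1]]. *)
Lemma bern_cov (R : realType) (T : finType) (p : T -> R) (a b : T) :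
  (forall a, 0 <= p a <= 1) ->
  \sum_w bern_w p w * (((w a)%:R - p a) * ((w b)%:R - p b)) <= (a == b)%:R.
Proof.
move=> p01.
pose g c (o : bool) : R := (if o then p c else 1 - p c) *
  ((if c == a then o%:R - p c else 1) * (if c == b then o%:R - p c else 1)).
have -> : \sum_w bern_w p w * (((w a)%:R - p a) * ((w b)%:R - p b)) =
    \sum_(w : {ffun T -> bool}) \prod_c g c (w c).
  apply: eq_bigr => w _; rewrite /g !big_split /= -!big_mkcond !big_pred1_eq //.
rewrite -(bigA_distr_bigA g).
have E c : \sum_o g c o = p c * ((if c == a then 1 - p c else 1) * (if c == b then 1 - p c else 1))
   + (1 - p c) * ((if c == a then - p c else 1) * (if c == b then - p c else 1)).
  by rewrite big_bool /g /= !sub0r.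
have [ab|ab] := eqVneq a b.
  subst b; apply: prodr_ile1 => c _; rewrite E; have /andP[p0 p1] := p01 c.
  by case: eqP => _; apply/andP; split; nra.
rewrite (bigD1 a) //= E eqxx (negbTE ab).
rewrite [X in X * _ <= _](_ : _ = 0) ?mul0r //; ring.
Qed.

Lemma bern_var (R : realType) (I : finType) (n : nat) (P : I -> R) (i : I) :
  (forall a, 0 <= P a <= 1) ->
  \sum_(w : {ffun I * 'I_n -> bool}) bern_w (fun a => P a.1) w *
     (\sum_j ((w (i, j))%:R - P i)) ^+ 2 <= n%:R.
Proof.
move=> P01.
under eq_bigr do rewrite expr2 mulr_suml mulr_sumr.
rewrite exchange_big /=.
have -> : n%:R = \sum_(j < n) 1 :> R by rewrite sumr_const card_ord.
apply: ler_sum => j _.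
under eq_bigr do rewrite !mulr_sumr.
rewrite exchange_big /=.
apply: (@le_trans _ _ (\sum_(l < n) ((i, j) == (i, l))%:R)).
  apply: ler_sum => l _.
  by have := @bern_cov R _ (fun a : I * 'I_n => P a.1) (i, j) (i, l) (fun a => P01 a.1).
rewrite (bigD1 j) //= eqxx big1 ?addr0 // => l lj.
by rewrite xpair_eqE eqxx eq_sym (negbTE lj).
Qed.

Definition bern_pt {R : realType} {d n : nat} (w : {ffun 'I_d * 'I_n.+1 -> bool}) : 'rV[R]_d :=
  \row_i ((\sum_j (w (i, j))%:R) / n.+1%:R).

Definition bern {R : realType} {d : nat} (F : 'rV[R]_d -> R) (n : nat) (p : 'rV[R]_d) : R :=
  \sum_(w : {ffun 'I_d * 'I_n.+1 -> bool}) F (bern_pt w) * bern_w (fun a => p ord0 a.1) w.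

Lemma bern_bounded (R : realType) (d : nat) (F : 'rV[R]_d -> R) (M : R) n (p : 'rV[R]_d) :
  (forall x, `|F x| <= M) -> (forall i, 0 <= p ord0 i <= 1) -> `|bern F n p| <= M.
Proof.
move=> FM p01; apply: (le_trans (ler_norm_sum _ _ _)).
rewrite -[M]mulr1 -(@bern_w_sum R _ (fun a : 'I_d * 'I_n.+1 => p ord0 a.1)) mulr_sumr.
apply: ler_sum => w _; have w0 := @bern_w_ge0 R _ (fun a : 'I_d * 'I_n.+1 => p ord0 a.1) w (fun a => p01 a.1).
by rewrite normrM (ger0_norm w0) ler_wpM2r.
Qed.

(** Chebyshev's argument: the quadratic bound on the oscillation of [F] is averaged, each empirical
    frequency having variance at most [1 / n.+1]. *)
Lemma bern_dist (R : realType) (d : nat) (F : 'rV[R]_d -> R) (e K : R) n (p : 'rV[R]_d) :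
  0 <= K -> (forall i, 0 <= p ord0 i <= 1) ->
  (forall y, `|F y - F p| <= e + K * \sum_i (y ord0 i - p ord0 i) ^+ 2) ->
  `|bern F n p - F p| <= e + K * d%:R / n.+1%:R.
Proof.
move=> K0 p01 H.
set W := bern_w (fun a : 'I_d * 'I_n.+1 => p ord0 a.1).
have W1 : \sum_w W w = 1 by exact: bern_w_sum.
have W0 w : 0 <= W w by exact: bern_w_ge0.
have -> : bern F n p - F p = \sum_w (F (bern_pt w) - F p) * W w.
  under eq_bigr do rewrite mulrBl.
  by rewrite sumrB -mulr_sumr W1 mulr1.
apply: (le_trans (ler_norm_sum _ _ _)).
apply: (@le_trans _ _ (\sum_w (e + K * \sum_i (bern_pt w ord0 i - p ord0 i) ^+ 2) * W w)).
  by apply: ler_sum => w _; rewrite normrM (ger0_norm (W0 w)) ler_wpM2r.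
under eq_bigr do rewrite mulrDl.
rewrite big_split /= -mulr_sumr W1 mulr1 lerD2l.
under eq_bigr do rewrite -mulrA.
rewrite -mulr_sumr -mulrA ler_wpM2l //.
under eq_bigr do rewrite mulr_suml.
rewrite exchange_big /=.
have -> : d%:R / n.+1%:R = \sum_(i < d) n.+1%:R^-1 :> R.
  by rewrite sumr_const card_ord mulr_natl.
apply: ler_sum => i _.
have := @bern_var R _ n.+1 (fun i => p ord0 i) i p01.
rewrite -/W => V.
rewrite -(ler_pM2l (_ : 0 < n.+1%:R ^+ 2 :> R)) ?exprn_gt0 ?ltr0n //.
rewrite [leRHS](_ : _ = n.+1%:R); last by field; rewrite nat1r pnatr_eq0.
apply: le_trans V; rewrite mulr_sumr; apply: ler_sum => w _.
apply: le_of_eq.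
have -> : \sum_j ((w (i, j))%:R - p ord0 i) = n.+1%:R * (bern_pt w ord0 i - p ord0 i) :> R.
  by rewrite mxE sumrB sumr_const card_ord -mulr_natl; field; rewrite nat1r pnatr_eq0.
ring.
Qed.

Lemma bern_cvg (R : realType) (d : nat) (F : 'rV[R]_d -> R) (M : R) (p : 'rV[R]_d) :
  continuous F -> (forall x, `|F x| <= M) -> (forall i, 0 <= p ord0 i <= 1) ->
  (fun n => bern F n p) @ \oo --> F p.
Proof.
move=> cF FM p01; apply/cvgrPdist_le => e e0.
have M0 : 0 <= M := le_trans (normr_ge0 _) (FM 0).
have e2 : 0 < e / 2 by rewrite divr_gt0.
have /cvgrPdist_le /(_ _ e2) /nbhs_ballP [del del0 hdel] := cF p.
(* Within distance [del] of [p] continuity gives [e / 2]. Farther away some coordinate moves by at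
   least [del], so the trivial bound [2 M] is absorbed by the quadratic term. *)
have H y : `|F y - F p| <= e / 2 + (2 * M / del ^+ 2) * \sum_i (y ord0 i - p ord0 i) ^+ 2.
  have S0 : 0 <= \sum_i (y ord0 i - p ord0 i) ^+ 2 by rewrite sumr_ge0 // => i _; exact: sqr_ge0.
  have c0 : 0 <= 2 * M / del ^+ 2 by rewrite divr_ge0 ?sqr_ge0 ?mulr_ge0.
  have [yp|] := pselect (ball p del y).
    rewrite distrC; apply: le_trans (hdel _ yp) _.
    by rewrite lerDl mulr_ge0.
  move=> nb.
  have [i hi] : exists i, del <= `|y ord0 i - p ord0 i|.
    apply: contrapT => /forallNP hn; apply: nb; split=> // i j; rewrite (ord1 i).
    have /negP := hn j; rewrite -ltNge distrC; exact.
  apply: (@le_trans _ _ (2 * M)).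
    by apply: (le_trans (ler_normB _ _)); have := FM y; have := FM p; lra.
  have hS : del ^+ 2 <= \sum_i (y ord0 i - p ord0 i) ^+ 2.
    rewrite (bigD1 i) //=; apply: (@le_trans _ _ ((y ord0 i - p ord0 i) ^+ 2)).
      by rewrite -[leRHS]real_normK ?num_real // lerXn2r // nnegrE ltW.
    by rewrite lerDl sumr_ge0 // => j _; exact: sqr_ge0.
  have := ler_wpM2l c0 hS; rewrite divfK ?expf_neq0 ?gt_eqF //.
  by move: e2; lra.
have c0 : 0 <= 2 * M / del ^+ 2 by rewrite divr_ge0 ?sqr_ge0 ?mulr_ge0.
have B n := @bern_dist R d F _ _ n p c0 p01 H.
set c := 2 * M / del ^+ 2 * d%:R in B.
have cc : (fun n : nat => c / n.+1%:R) @ \oo --> (0 : R).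
  rewrite -(mulr0 c); apply: cvgM; [exact: cvg_cst|exact: cvg_harmonic].
have /cvgr0Pnorm_le /(_ _ e2) := cc.
apply: filterS => n hn; rewrite distrC; apply: (le_trans (B n)).
by rewrite [leRHS]splitr lerD2l; exact: le_trans (ler_norm _) hn.
Qed.

Definition is_trig {R : realType} {d : nat} (g : 'rV[R]_d -> R) : Prop :=
  exists s, trig s =1 g.

Lemma is_trig_cst (R : realType) (d : nat) (a : R) : is_trig (fun _ : 'rV[R]_d => a).
Proof.
exists [:: (a%:C, 0)] => x; rewrite /evm big_seq1 /= mul1r.
rewrite (_ : euclid_dot 0 x = 0); first by rewrite cos0 sin0; ring.
by rewrite /euclid_dot big1 // => i _; rewrite mxE mul0r.
Qed.

Lemma is_trigD (R : realType) (d : nat) (f g : 'rV[R]_d -> R) :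
  is_trig f -> is_trig g -> is_trig (fun x => f x + g x).
Proof. by move=> [s sf] [s' sg]; exists (s ++ s') => x; rewrite /evm big_cat -sf -sg. Qed.

Lemma is_trig_sum (R : realType) (d : nat) (I : Type) (r : seq I) (F : I -> 'rV[R]_d -> R) :
  (forall i, is_trig (F i)) -> is_trig (fun x => \sum_(i <- r) F i x).
Proof.
move=> hF; elim: r => [|i r IH].
  by have [s hs] := is_trig_cst d (0 : R); exists s => x; rewrite big_nil hs.
by have [s hs] := is_trigD (hF i) IH; exists s => x; rewrite big_cons hs.
Qed.

Lemma cisN (R : realType) (y : R) : cis (- y) = cos y +i* - sin y.
Proof. by rewrite /cis cosN sinN. Qed.

(** Product to sum: [Re u * Re v] is half of [Re (u v)] plus half of [Re (u v')], with [v'] the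
    conjugate of [v], so the frequencies add and subtract. *)
Lemma is_trigM (R : realType) (d : nat) (f g : 'rV[R]_d -> R) :
  is_trig f -> is_trig g -> is_trig (fun x => f x * g x).
Proof.
move=> [s sf] [s' sg].
suff [t ht] : is_trig (fun x => trig s x * trig s' x) by exists t => x; rewrite ht sf sg.
have [t ht] : is_trig (fun x => \sum_(c <- s) \sum_(c' <- s')
   Re (1 * c.1 * cis (euclid_dot c.2 x)) * Re (1 * c'.1 * cis (euclid_dot c'.2 x))); last first.
  by exists t => x; rewrite ht /evm mulr_suml; apply: eq_bigr => c _; rewrite mulr_sumr.
apply: is_trig_sum => -[c xi]; apply: is_trig_sum => -[c' xi'] /=.
exists [:: ((2^-1)%:C * (c * c'), xi + xi'); ((2^-1)%:C * (c * (Re c' +i* - Im c')), xi - xi')] => x.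
rewrite /evm big_cons big_seq1 /= !euclid_dotDl (_ : euclid_dot (- xi') x = - euclid_dot xi' x).
  by rewrite !cisD cisN !reimE /=; field.
by rewrite /euclid_dot -sumrN; apply: eq_bigr => i _; rewrite mxE mulNr.
Qed.

Lemma is_trig_prod (R : realType) (d : nat) (I : Type) (r : seq I) (F : I -> 'rV[R]_d -> R) :
  (forall i, is_trig (F i)) -> is_trig (fun x => \prod_(i <- r) F i x).
Proof.
move=> hF; elim: r => [|i r IH].
  by have [s hs] := is_trig_cst d (1 : R); exists s => x; rewrite big_nil hs.
by have [s hs] := is_trigM (hF i) IH; exists s => x; rewrite big_cons hs.
Qed.

Lemma is_trig_sin (R : realType) (d : nat) (L : R) (i : 'I_d) :
  is_trig (fun x : 'rV[R]_d => sin (x ord0 i / L)).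
Proof.
(* The sine is the real part of [- i e^(i y)]. *)
exists [:: (0 +i* (-1), L^-1 *: unitv i)] => x; rewrite /evm big_seq1 /=.
rewrite (_ : euclid_dot (L^-1 *: unitv i) x = x ord0 i / L); first by ring.
rewrite /euclid_dot (bigD1 i) //= big1 => [|j ji].
  by rewrite /unitv !mxE !eqxx mulr1 addr0 mulrC.
by rewrite /unitv !mxE eqxx (negbTE ji) mulr0 mul0r.
Qed.

(** Sends the whole space into the unit cube, where Bernstein polynomials converge, and turns them
    into trigonometric polynomials. *)
Definition sin_coord {R : realType} {d : nat} (L : R) (x : 'rV[R]_d) : 'rV[R]_d :=
  \row_i ((1 + sin (x ord0 i / L)) / 2).

Lemma sin_coord01 (R : realType) (d : nat) (L : R) (x : 'rV[R]_d) i :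
  0 <= sin_coord L x ord0 i <= 1.
Proof.
rewrite mxE; have := sin_geN1 (x ord0 i / L); have := sin_le1 (x ord0 i / L).
by move=> h1 h2; apply/andP; split; lra.
Qed.

Lemma is_trig_bern (R : realType) (d : nat) (F : 'rV[R]_d -> R) n (L : R) :
  is_trig (fun x => bern F n (sin_coord L x)).
Proof.
apply: is_trig_sum => w; apply: is_trigM; first exact: is_trig_cst.
apply: is_trig_prod => -[i j] /=.
have h : is_trig (fun x : 'rV[R]_d => (sin_coord L x) ord0 i).
  have [s hs] := is_trigM (is_trig_cst d (2^-1 : R)) (is_trigD (is_trig_cst d (1 : R)) (is_trig_sin L i)).
  by exists s => x; rewrite hs mxE mulrC.
case: (w (i, j)) => //.
have [s hs] := is_trigD (is_trig_cst d (1 : R)) (is_trigM (is_trig_cst d (-1 : R)) h).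
by exists s => x; rewrite hs mulN1r.
Qed.

(** Clamping at [1/2] keeps the argument inside the open interval where [asin] is continuous, so the
    function is continuous on all of R and still inverts the sine on [|y| <= 1/2]. *)
Definition clamp_asin {R : realType} (t : R) : R := asin (Num.max (- 2^-1) (Num.min t 2^-1)).

Lemma clamp_asin_continuous (R : realType) : continuous (@clamp_asin R).
Proof.
move=> t; apply: (@continuous_comp _ _ _ (fun t : R => Num.max (- 2^-1) (Num.min t 2^-1)) (@asin R)).
  apply: continuous_max; first exact: cst_continuous.
  by apply: continuous_min => //; exact: cst_continuous.
apply: continuous_asin; apply/andP; split.
  by rewrite lt_max; apply/orP; left; lra.
by rewrite gt_max gt_min; apply/andP; split; [lra | apply/orP; right; lra].
Qed.

Lemma clamp_asin_sin (R : realType) (y : R) : `|y| <= 2^-1 -> clamp_asin (sin y) = y.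
Proof.
move=> hy; have := le_trans (abs_sin_le y) hy; rewrite ler_norml => /andP[h1 h2].
rewrite /clamp_asin (min_idPl h2) (max_idPr h1) sinK // in_itv /=.
by move: hy; rewrite ler_norml => /andP[h3 h4]; have pi2 := pi_ge2 R; apply/andP; split; lra.
Qed.

(* [wrap L \o sin_coord L] is periodic, and the identity where all [|x_i| <= L / 2]. *)
Definition wrap {R : realType} {d : nat} (L : R) (p : 'rV[R]_d) : 'rV[R]_d :=
  \row_i (L * clamp_asin (2 * p ord0 i - 1)).

Lemma wrap_continuous (R : realType) (d : nat) (L : R) : continuous (@wrap R d L).
Proof.
have cg : continuous (fun t : R => L * clamp_asin (2 * t - 1)).
  apply: continuous_scale => t; apply: continuous_comp; last exact: clamp_asin_continuous.
  apply: (@continuous_sub R R (fun t => 2 * t) (cst 1)); last by move=> x; exact: cst_continuous.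
  by apply: continuous_scale => x.
move=> p U /= [Q Qn QU]; exists (fun i j => (fun t => L * clamp_asin (2 * t - 1)) @^-1` Q i j).
  by move=> i j; apply: cg; have := Qn i j; rewrite mxE (ord1 i).
by move=> q hq; apply: QU => i j; rewrite mxE (ord1 i); exact: hq.
Qed.

Lemma wrap_sin_coord (R : realType) (d : nat) (L : R) (x : 'rV[R]_d) : 0 < L ->
  (forall i, `|x ord0 i| <= L / 2) -> wrap L (sin_coord L x) = x.
Proof.
move=> L0 hx; apply/rowP => i; rewrite !mxE.
rewrite (_ : 2 * _ - 1 = sin (x ord0 i / L)); last by field.
rewrite clamp_asin_sin; first by rewrite mulrC divfK // gt_eqF.
rewrite normrM normfV (gtr0_norm L0) ler_pdivrMr // mulrC; exact: hx.
Qed.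

(** * The semigroup *)

Lemma Re_cis_taylor (R : realType) (u : R[i]) (b : R) :
  `|Re (u * cis b) - Re u - b * Re ('i * u)| <= cn1 u * b ^+ 2.
Proof.
have -> : Re (u * cis b) - Re u - b * Re ('i * u) =
   Re u * (cos b - 1) - Im u * (sin b - b) by rewrite !reimE /=; ring.
apply: (le_trans (ler_normB _ _)); rewrite !normrM mulrDl.
by apply: lerD; rewrite ler_wpM2l //; [exact: abs_cos_sub1_le | exact: abs_sin_sub_le].
Qed.

Lemma euclid_dot_l1_le (R : realType) (d : nat) (xi v : 'rV[R]_d) :
  `|euclid_dot xi v| <= (\sum_i `|xi ord0 i|) * \sum_i `|v ord0 i|.
Proof.
apply: (le_trans (ler_norm_sum _ _ _)); rewrite mulr_suml; apply: ler_sum => i _.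
by rewrite normrM ler_wpM2l // (bigD1 i) //= lerDl sumr_ge0.
Qed.

Lemma evm_derive (R : realType) (d : nat) (m : 'rV[R]_d -> R[i]) s x :
  differentiable (evm m s) x /\
  forall i, 'D_(unitv i) (evm m s) x = evm (fun xi => 'i * (xi ord0 i)%:C * m xi) s x.
Proof.
pose w : 'rV[R]_d := \row_i evm (fun xi => 'i * (xi ord0 i)%:C * m xi) s x.
pose U (c : R[i] * 'rV[R]_d) := m c.2 * c.1 * cis (euclid_dot c.2 x).
pose K := \sum_(c <- s) cn1 (U c) * (\sum_j `|c.2 ord0 j|) ^+ 2.
have [||df dw] := @differentiable_of_quadratic R d (evm m s) x w K.
- by rewrite sumr_ge0 // => c _; rewrite mulr_ge0 ?cn1_ge0 ?sqr_ge0.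
- move=> v.
  have -> : euclid_dot w v = \sum_(c <- s) euclid_dot c.2 v * Re ('i * U c).
    rewrite /euclid_dot; under eq_bigr do rewrite mxE mulr_suml.
    rewrite exchange_big; apply: eq_bigr => c _ /=; rewrite mulr_suml; apply: eq_bigr => i _.
    by rewrite /U !reimE /=; ring.
  rewrite /evm -!sumrB; apply: (le_trans (ler_norm_sum _ _ _)).
  rewrite mulr_suml; apply: ler_sum => c _.
  rewrite euclid_dotDr cisD mulrA -/(U c).
  apply: (le_trans (Re_cis_taylor _ _)); rewrite -mulrA ler_wpM2l ?cn1_ge0 //.
  rewrite -exprMn -[leLHS]real_normK ?num_real // lerXn2r ?nnegrE //.
    by rewrite mulr_ge0 // sumr_ge0.
  exact: euclid_dot_l1_le.
by split=> // i; rewrite dw mxE.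
Qed.

Definition grad_mult {R : realType} {d : nat} (l : seq 'I_d) (xi : 'rV[R]_d) : R[i] :=
  \prod_(i <- l) ('i * (xi ord0 i)%:C).

Lemma pderiv_evm (R : realType) (d : nat) (m : 'rV[R]_d -> R[i]) s l :
  pderiv l (evm m s) = evm (fun xi => grad_mult l xi * m xi) s.
Proof.
elim: l => [|i l IH]; apply/funext => x.
  by apply: evm_eq => xi; rewrite /grad_mult big_nil mul1r.
rewrite [LHS]/= -/(pderiv l _) IH (evm_derive _ _ _).2.
by apply: evm_eq => xi; rewrite /grad_mult big_cons mulrA.
Qed.

Lemma smooth_evm (R : realType) (d : nat) (m : 'rV[R]_d -> R[i]) s : smooth (evm m s).
Proof. by move=> l x; rewrite pderiv_evm; exact: (evm_derive _ _ _).1. Qed.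

Section probability_semigroup.
Context (R : realType) (d : nat) (P : probability (Rd R d) R).

Lemma semigroupE f x : semigroup P f x = \int[P]_y f (x + (y : 'rV[R]_d)).
Proof. by []. Qed.

(** The law [P] itself takes the place of the base measure, with density 1, so [m] is its
    characteristic function [hat P (cst 1)]. *)
Lemma semigroup_trig (m : 'rV[R]_d -> R[i]) s :
  (forall xi, (\int[P]_y (cos (euclid_dot xi y))%:E)%E = (Re (m xi))%:E /\
     (\int[P]_y (sin (euclid_dot xi y))%:E)%E = (Im (m xi))%:E) ->
  semigroup P (trig s) = evm m s.
Proof.
move=> hm; apply/funext => x.
have i1 : P.-integrable setT (EFin \o (cst 1 : Rd R d -> R)).
  exact: finite_measure_integrable_cst.
rewrite semigroupE (@evm_eq _ _ m (hat P (cst 1))); last first.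
  move=> xi; have [h1 h2] := hm xi; apply: complex_ext; rewrite /hat /=.
    by under eq_Rintegral do rewrite mulr1; rewrite /Rintegral h1.
  by under eq_Rintegral do rewrite mulr1; rewrite /Rintegral h2.
by rewrite evm_hat //; under [RHS]eq_Rintegral do rewrite mulr1.
Qed.

Lemma semigroup_cvg (u : nat -> 'rV[R]_d -> R) (f : 'rV[R]_d -> R) (M : R) :
  (forall n, measurable_fun setT (u n : Rd R d -> R)) -> (forall n x, `|u n x| <= M) ->
  (forall x, (fun n => u n x) @ \oo --> f x) ->
  forall x, (fun n => semigroup P (u n) x) @ \oo --> semigroup P f x.
Proof.
move=> mu uM uf x.
have mx : measurable_fun setT ((fun y => x + y) : Rd R d -> Rd R d).
  apply: (@continuous_Rd_measurable R d (fun y => x + y)) => y.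
  by under eq_fun do rewrite addrC; exact: translate_continuous.
have mux n : measurable_fun setT (fun y : Rd R d => u n (x + (y : 'rV[R]_d))).
  by have := measurableT_comp (mu n) mx.
have [|||||] := @dominated_convergence _ _ _ P setT measurableT
  (fun n y => (u n (x + (y : 'rV[R]_d)))%:E) (fun y => (f (x + (y : 'rV[R]_d)))%:E) (cst M%:E).
- by move=> n; apply/measurable_EFinP.
- apply/measurable_EFinP.
  exact: (measurable_fun_cvg mux (fun y _ => uf (x + y))).
- by apply: aeW => y _; apply: cvg_EFin; [exact: nearW | exact: uf].
- exact: finite_measure_integrable_cst.
- by apply: aeW => y n _; rewrite /= lee_fin.
move=> i1 _ H; apply: fine_cvg; rewrite fineK; first exact: H.
exact: (integrable_fin_num measurableT i1).
Qed.

(** Measurability and the bound [M] are carried along because dominated convergence needs them again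
    at the next limit. *)
Definition tame_class (M : R) (B : nat -> R) (f : 'rV[R]_d -> R) : Prop :=
  [/\ measurable_fun setT (f : Rd R d -> R), forall x, `|f x| <= M & tame B (semigroup P f)].

Lemma tame_class_cvg (M : R) (B : nat -> R) (u : nat -> 'rV[R]_d -> R) (f : 'rV[R]_d -> R) :
  (forall n, tame_class M B (u n)) -> (forall x, (fun n => u n x) @ \oo --> f x) ->
  tame_class M B f.
Proof.
move=> hu uf; have uM n := let: And3 _ h _ := hu n in h.
have mu n : measurable_fun setT (u n : Rd R d -> R) by case: (hu n).
split.
- exact: (measurable_fun_cvg mu (fun x _ => uf x)).
- move=> x; have c : (fun n => `|u n x|) @ \oo --> `|f x| by apply: cvg_norm; exact: uf.
  by apply: (ler_cvg_to c (cvg_cst _)); apply: nearW => n; exact: uM.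
- apply: (@tame_limit R d B (fun n => semigroup P (u n))); first by move=> n; case: (hu n).
  exact: (semigroup_cvg mu uM uf).
Qed.

Lemma tame_class_continuous (M : R) (B : nat -> R) :
  (forall s, (forall x, `|trig s x| <= M) -> tame B (semigroup P (trig s))) ->
  forall f : 'rV[R]_d -> R, continuous f -> (forall x, `|f x| <= M) -> tame B (semigroup P f).
Proof.
move=> hB f cf fM.
have trigC g : is_trig g -> (forall x, `|g x| <= M) -> tame_class M B g.
  move=> [s /funext <-] sM; split=> //; last exact: hB.
  exact: (continuous_measurable_Rd (@trig_continuous R d _ s)).
(* Bernstein polynomials average values of the function, so the approximants keep the bound [M] and
   with it the same [B]. *)
have wrapC (L : R) : tame_class M B (fun x => f (wrap L (sin_coord L x))).
  apply: (@tame_class_cvg M B (fun n x => bern (f \o wrap L) n (sin_coord L x))).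
    move=> n; apply: trigC; first exact: is_trig_bern.
    by move=> x; apply: bern_bounded => [y|i]; [exact: fM | exact: sin_coord01].
  move=> x; apply: (@bern_cvg R d (f \o wrap L) M).
  - by move=> y; apply: continuous_comp; [exact: wrap_continuous | exact: cf].
  - by move=> y; exact: fM.
  - exact: sin_coord01.
suff [] : tame_class M B f by [].
apply: (@tame_class_cvg M B (fun n x => f (wrap n.+1%:R (sin_coord n.+1%:R x)))) => // x.
(* At a fixed [x] the approximants equal [f x] once [n.+1 >= 2 b], since wrapping is then the
   identity at [x]. *)
apply: cvg_near_cst.
pose b := \sum_i `|x ord0 i|.
have /archi_boundP : 0 <= 2 * b by rewrite mulr_ge0 // sumr_ge0.
set N := Num.bound _ => hN; exists N => // n /= Nn.
rewrite wrap_sin_coord // => i.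
have : `|x ord0 i| <= b by rewrite /b (bigD1 i) //= lerDl sumr_ge0.
have : (N%:R : R) <= n.+1%:R by rewrite ler_nat (leq_trans Nn).
move: hN; lra.
Qed.
End probability_semigroup.

Section levy_semigroup.
Context (R : realType) (d : nat) (d_gt0 : (0 < d)%N).
Context (leb : {measure set (Rd R d) -> \bar R}) (hleb : is_lebesgue_Rd leb).
Context (phi : R -> R) (d1 d2 a1 a2 : R).
Hypothesis phi_gt0 : forall r : R, 0 < r -> 0 < phi r.
Hypothesis phi_cont : forall r : R, 0 < r -> {for r, continuous phi}.
Hypothesis phi1 : phi 1 = 1.
Hypothesis d1_gt0 : 0 < d1.
Hypothesis d2_gt0 : 0 < d2.
Hypothesis d2_lt1 : d2 < 1.
Hypothesis a1_gt0 : 0 < a1.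
Hypothesis a2_gt0 : 0 < a2.
Hypothesis phi_lower : forall lam r : R, 1 <= lam -> 0 < r ->
  a1 * lam `^ (2 * d1) * phi r <= phi (lam * r).
Hypothesis phi_upper : forall lam r : R, 1 <= lam -> 0 < r ->
  phi (lam * r) <= a2 * lam `^ (2 * d2) * phi r.
Context (Lam1 Lam2 : R) (Lam1_gt0 : 0 < Lam1) (a0 : 'rV[R]_d -> R).
Hypothesis ha0m : measurable_fun [set h : Rd R d | (h : 'rV[R]_d) != 0] a0.
Hypothesis ha0b : forall h : 'rV[R]_d, h != 0 -> Lam1 <= a0 h <= Lam2.

Let nu_wt : leb.-integrable setT (EFin \o (fun h => wt h * nu phi a0 h)).
Proof. 
exact: (wt_nu_integrable d_gt0 hleb phi_gt0 phi_cont phi1 d1_gt0 d2_gt0 d2_lt1 a1_gt0 a2_gt0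
  phi_lower phi_upper Lam1_gt0 ha0m ha0b).
 Qed.

Let nu_mul_integrable (F : Rd R d -> R) (C : R) : measurable_fun setT F ->
  (forall h, `|F h| <= C * wt h) -> leb.-integrable setT (EFin \o (fun h => F h * nu phi a0 h)).
Proof.
move=> mF FC.
apply: (@le_integrable _ _ _ leb setT measurableT _ (EFin \o (fun h => C * (wt h * nu phi a0 h)))).
- by apply/measurable_EFinP; apply: measurable_funM => //; exact: measurable_nu.
- move=> h _; rewrite /= lee_fin (le_trans _ (ler_norm _)) // normrM mulrA ler_pM //.
  rewrite ger0_norm //; exact: (nu_ge0 phi_gt0 Lam1_gt0 ha0b).
- exact: RintegrableZl.
Qed.

Let fine_nu (F : Rd R d -> R) (t C : R) : measurable_fun setT F -> (forall h, `|F h| <= C * wt h) ->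
  \int[leb]_h (F h * (t * nu phi a0 h)) =
  t * fine (\int[leb]_(h in [set h : Rd R d | (h : 'rV[R]_d) != 0%R])
          (F h * levy_density phi a0 h)%R%:E)%E.
Proof.
move=> mF FC; under eq_Rintegral do rewrite mulrCA.
rewrite RintegralZl //; last exact: (nu_mul_integrable mF FC).
congr (_ * _); rewrite -[fine _]/(Rintegral _ _ _) [RHS]Rintegral_mkcond.
apply: eq_Rintegral => h _; rewrite /nu !patchE.
by case: ifP => // _; rewrite mulr0.
Qed.

Let expo t xi : R[i] := cexp (- ((t * levy_exp_re leb phi a0 xi) +i* (t * levy_exp_im leb phi a0 xi))).

Let symbolE t xi : cexp (- (symbol_re leb (fun h => t * nu phi a0 h) xi +i*
   symbol_im leb (fun h => t * nu phi a0 h) xi)) = expo t xi.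
Proof.
rewrite /expo /symbol_re /symbol_im.
rewrite (fine_nu t (measurable_one_sub_cos xi) (one_sub_cos_le xi)).
by rewrite (fine_nu t (measurable_comp_sub_sin xi) (comp_sub_sin_le xi)).
Qed.

Let expo_root t k xi : expo (t / k.+1%:R) xi ^+ k.+1 = expo t xi.
Proof.
have nat_mul n (z : R[i]) : Re (z *+ n) = n%:R * Re z /\ Im (z *+ n) = n%:R * Im z.
  elim: n => [|n [IH1 IH2]]; first by rewrite mulr0n !mul0r.
  by rewrite mulrS ReD ImD IH1 IH2 -nat1r !mulrDl !mul1r.
rewrite /expo -cexp_natmul; congr cexp; apply: complex_ext.
  by rewrite (nat_mul _ _).1 !reimE /=; field; rewrite nat1r pnatr_eq0.
by rewrite (nat_mul _ _).2 !reimE /=; field; rewrite nat1r pnatr_eq0.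
Qed.

Let mult_le_expo t : 0 < t -> mult_le (expo t) 1.
Proof.
move=> t0; apply: mult_le_eq (fun xi => symbolE t xi) _.
apply: (@mult_le_symbol R d leb _ _ _ _ _ (fun j => j.+1%:R^-1)).
- by apply: measurable_funM => //; exact: measurable_nu.
- by move=> h; rewrite mulr_ge0 ?(ltW t0) //; exact: (nu_ge0 phi_gt0 Lam1_gt0 ha0b).
- by move=> h h0; rewrite nu0 ?mulr0.
- rewrite (_ : _ \o _ = EFin \o (fun h => t * (wt h * nu phi a0 h))); first exact: RintegrableZl.
  by apply/funext => h /=; rewrite mulrCA.
- by move=> j; rewrite invr_gt0.
- move=> e e0; have /cvgr0Pnorm_lt /(_ _ e0) := @cvg_harmonic R.
  by apply: filterS => j; apply: le_lt_trans; exact: ler_norm.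
Qed.

(** Each of the [k] derivatives is paired with its own factor [expo (t / k)] and costs a multiple of
    [1 / r]. The length [r] belongs to [t] and not to [t / k], which is why the gradient bound is
    taken with [kap = 1 / k]. Order 0 is plain contractivity. *)
Lemma mult_le_grad_expo k : exists2 C, 0 < C & forall t r, 0 < t -> 0 < r -> phi r = t ->
  forall l : seq 'I_d, size l = k ->
  mult_le (fun xi => grad_mult l xi * expo t xi) (C * r ^- k).
Proof.
case: k => [|k].
  exists 1 => // t r t0 _ _ l /size0nil ->.
  rewrite expr0 invr1 mulr1; apply: mult_le_eq (mult_le_expo t0) => xi.
  by rewrite /grad_mult big_nil mul1r.
have k0 : 0 < k.+1%:R^-1 :> R by rewrite invr_gt0.
have [C C0 hC] := mult_le_gradient d_gt0 hleb phi_gt0 phi_cont phi1 d1_gt0 d2_gt0 d2_lt1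
  a1_gt0 a2_gt0 phi_lower phi_upper Lam1_gt0 ha0m ha0b k0.
exists (C ^+ k.+1); first exact: exprn_gt0.
move=> t r t0 r0 phir l sl.
have tk0 : 0 < t / k.+1%:R by rewrite divr_gt0.
have ktr : k.+1%:R^-1 * phi r <= t / k.+1%:R by rewrite phir mulrC.
have := @mult_le_prod R d _ l _ _ (hC _ r tk0 r0 ktr).
rewrite sl -exprVn -exprMn; apply: mult_le_eq => xi.
rewrite big_split /= -/(grad_mult l xi); congr (_ * _).
by rewrite symbolE big_const_seq count_predT iter_mulr_1 sl expo_root.
Qed.

(** The constants are fixed before the time, the law and the function, so they depend on the order
    alone; the arbitrary bound [M] is later specialised to the sup norm. *)
Lemma tame_semigroup : exists2 C : nat -> R, (forall k, 0 < C k) &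
  forall t r (P : probability (Rd R d) R) f M, 0 < t -> 0 < r -> phi r = t ->
  levy_law leb phi a0 t P -> continuous f -> (forall x, `|f x| <= M) ->
  tame (fun k => C k * r ^- k * M) (semigroup P f).
Proof.
have H k : exists C, 0 < C /\ forall t r, 0 < t -> 0 < r -> phi r = t ->
    forall l : seq 'I_d, size l = k -> mult_le (fun xi => grad_mult l xi * expo t xi) (C * r ^- k).
  by have [C C0 hC] := mult_le_grad_expo k; exists C.
have [C HC] := choice H; exists C => [k|]; first by have [] := HC k.
move=> t r P f M t0 r0 phir lawP cf fM.
apply: tame_class_continuous cf fM => s sM.
rewrite (@semigroup_trig R d P (expo t)); last first.
  move=> xi; have [-> ->] := lawP xi.
  rewrite /expo /cexp /cis /= !mul0r subr0 addr0 -mulNr.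
  by rewrite cosN sinN mulrN.
split=> [|l x]; first exact: smooth_evm.
by rewrite pderiv_evm; exact: ((HC _).2 t r t0 r0 phir l erefl s M sM x).
Qed.
End levy_semigroup.

Lemma le_supnorm (R : realType) (d : nat) (f : 'rV[R]_d -> R) (M : R) :
  (forall x, `|f x| <= M) -> forall x, `|f x| <= supnorm f.
Proof.
move=> fM x; apply: ub_le_sup; last by exists x.
by exists M => _ [y _ <-].
Qed.

Local Close Scope complex_scope.

Theorem theorem3p3 (R : realType) (d : nat) (hd : (0 < d)%N)
  (phi : R -> R) (hphi : admissible phi)
  (Lam1 Lam2 : R) (hL1 : 0 < Lam1) (hL12 : Lam1 <= Lam2)
  (a0 : 'rV[R]_d -> R)
  (leb : {measure set (Rd R d) -> \bar R}) (hleb : is_lebesgue_Rd leb)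
  (ha0m : measurable_fun [set h : Rd R d | (h : 'rV[R]_d) != (0%R : 'rV[R]_d)] a0)
  (ha0b : forall h : 'rV[R]_d, h != 0 -> Lam1 <= a0 h <= Lam2)
  (mu : R -> probability (Rd R d) R)
  (hmu : forall t, 0 < t -> levy_law leb phi a0 t (mu t)) :
  (forall (f : 'rV[R]_d -> R), continuous f ->
     (exists M, forall x, `|f x| <= M) ->
     forall t, 0 < t -> smooth (semigroup (mu t) f)) /\
  (forall k : nat, exists C : R, 0 < C /\
     forall (f : 'rV[R]_d -> R), continuous f ->
       (exists M, forall x, `|f x| <= M) ->
       forall (s : seq 'I_d), size s = k ->
       forall t, 0 < t -> forall x : 'rV[R]_d,
         `|pderiv s (semigroup (mu t) f) x|
           <= C * (inv_order phi t) ^- k * supnorm f).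
Proof.
have [phi_gt0 [phi1 [dphi [_ [_ [_ [d1 [d2 [a1 [a2 [[d1_gt0 [d12 [d2_lt1 [a1_gt0 [a1_le1 a2_ge1]]]]] hs]]]]]]]]]]] := hphi.
have phi_cont r : 0 < r -> {for r, continuous phi}.
  by move=> r0; apply: differentiable_continuous; apply/derivable1_diffP; exact: (dphi 0%N).
have d2_gt0 := lt_le_trans d1_gt0 d12.
have a2_gt0 := lt_le_trans ltr01 a2_ge1.
have phi_lower lam r (h1 : 1 <= lam) (h2 : 0 < r) := (hs lam r h1 h2).1.
have phi_upper lam r (h1 : 1 <= lam) (h2 : 0 < r) := (hs lam r h1 h2).2.
have [C C0 hC] := tame_semigroup hd hleb phi_gt0 phi_cont phi1 d1_gt0 d2_gt0 d2_lt1 a1_gt0 a2_gt0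
  phi_lower phi_upper hL1 ha0m ha0b.
have T f t M : continuous f -> (forall x, `|f x| <= M) -> 0 < t ->
    tame (fun k => C k * inv_order phi t ^- k * M) (semigroup (mu t) f).
  move=> cf fM t0.
  have [r0 phir] := inv_orderP phi_gt0 phi_cont phi1 d1_gt0 a1_gt0 a1_le1 phi_lower t0.
  exact: hC (hmu t t0) cf fM.
split=> [f cf [M fM] t t0|k]; first exact: (T f t M cf fM t0).1.
exists (C k); split=> // f cf [M fM] s <- t t0 x.
exact: (T f t _ cf (le_supnorm fM) t0).2.
Qed.
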